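(* Let $R$ be a commutative noetherian local ring of positive depth, and let $M\in \mathsf{D}^{\mathsf{b}}_{\mathsf{f}}(R)$ be such that $\operatorname{Gid}_R(\mathrm{H}(M)^{\oplus}) < \infty$. Let $\mathsf{GI}$ be the collection of all Gorenstein injective $R$-modules. Then $$\operatorname{level}_R^{\mathsf{GI}}(M) = \operatorname{depth}(R) + 1 .$$
   Context: $\mathsf{D}(R)$ is the derived category of $R$; $\mathsf{D}^{\mathsf{b}}_{\mathsf{f}}(R)$ is the full subcategory of complexes $M$ with bounded homology ($\mathrm{H}_i(M)=0$ for all $|i|\gg 0$) such that every $\mathrm{H}_i(M)$ is finitely generated. Complexes are graded homologically. $\mathrm{H}(M)^{\oplus} = \bigoplus_{i\in\mathbb{Z}} \mathrm{H}_i(M)$, an $R$-module. Level: for a nonempty collection $\mathsf{C}$ of objects of $\mathsf{D}(R)$ (modules are viewed as complexes concentrated in degree $0$), set $\operatorname{thick}_R^0(\mathsf{C}) = \{0\}$; $\operatorname{thick}_R^1(\mathsf{C})$ is the smallest collection of objects containing $\mathsf{C}$ and closed under isomorphism, shifts, finite direct sums and direct summands; for $n\ge 2$, $\operatorname{thick}_R^n(\mathsf{C})$ consists of all $M\in \mathsf{D}(R)$ for which there is a distinguished triangle $K \to L\oplus M \to N \to$ (for some object $L$) with $K\in \operatorname{thick}_R^1(\mathsf{C})$ and $N \in \operatorname{thick}_R^{n-1}(\mathsf{C})$. Then $\operatorname{level}_R^{\mathsf{C}}(M) = \inf\{n \mid M\in \operatorname{thick}_R^n(\mathsf{C})\}$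 (equal to $\infty$ if no such $n$ exists). A module is Gorenstein injective if it is a kernel of a differential in an acyclic complex $I$ of injective modules such that $\operatorname{Hom}_R(E,I)$ is acyclic for every injective module $E$. $\operatorname{Gid}_R(N)$, the Gorenstein injective dimension of a module $N$, is the least $n\ge 0$ such that there is an exact sequence $0\to N\to C_0\to C_{-1}\to\cdots\to C_{-n}\to 0$ with all $C_i$ Gorenstein injective, or $\infty$ if no such $n$ exists.
   Formalization: The formal theorem additionally assumes that M is not isomorphic to 0 in D(R); for M = 0 the claim fails, since Gid(0) = 0 is finite and the level of 0 is 0, while depth(R) + 1 is at least 2. *)

(* Defs.v *)
From HB Require Import structures.
From mathcomp Require Import all_boot all_order all_algebra.
From mathcomp Require Import boolp.

Set Implicit Arguments.
Unset Strict Implicit.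
Unset Printing Implicit Defensive.

Import Order.TTheory GRing.Theory Num.Theory.
Local Open Scope ring_scope.
Local Open Scope quotient_scope.

(* [option nat] stands for the naturals extended with infinity = [None]. *)

Definition enat_inf (P : nat -> Prop) : option nat :=
  if pselect (exists n, `[< P n >]) is left exP then Some (ex_minn exP)
  else None.

Definition enat_sup (P : nat -> Prop) : option nat :=
  enat_inf (fun d => forall n, P n -> (n <= d)%N).

#[local] Obligation Tactic := idtac.

Section Modules.
Variable R : comNzRingType.

Definition mklinear (U V : lmodType R) (f : U -> V) (lin_f : linear f) :
  {linear U -> V} := HB.pack f (GRing.isLinear.Build R U V _ f lin_f).

Definition module0 : lmodType R := 'rV[R]_0.

Definition finitely_generated (V : lmodType R) : Prop :=
  exists n (g : 'I_n -> V), forall v, exists c : 'I_n -> R,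
    v = \sum_(i < n) c i *: g i.

Section Kernel.
Variables (U V : lmodType R) (f : {linear U -> V}).

Definition in_ker : {pred U} := [pred x | f x == 0].

Lemma in_ker_submod : submod_closed in_ker.
Proof.
split=> [|a x y]; rewrite !inE ?raddf0 // => /eqP fx /eqP fy.
by rewrite linearP fx fy scaler0 addr0.
Qed.

HB.instance Definition _ := GRing.isSubmodClosed.Build R U in_ker in_ker_submod.

Record ker := Ker { ker_val :> U; _ : ker_val \in in_ker }.

HB.instance Definition _ := [isSub for ker_val].
HB.instance Definition _ := [Choice of ker by <:].
HB.instance Definition _ := [SubChoice_isSubLmodule of ker by <:].

Lemma kerP (x : ker) : f (ker_val x) = 0.
Proof. by apply/eqP; have := valP x; rewrite inE. Qed.

End Kernel.

Section QuotientModule.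
Variables (V : lmodType R) (S : {pred V}) (subS : submod_closed S).

Definition submodule of submod_closed S : {pred V} := S.

HB.instance Definition _ := GRing.isSubmodClosed.Build R V (submodule subS) subS.

Definition mquot := Quotient.quot (submodule subS).

HB.instance Definition _ := GRing.Zmodule.on mquot.

Definition mpi (x : V) : mquot := \pi_(Quotient.quot (submodule subS)) x.
Definition mrepr (x : mquot) : V := repr (x : Quotient.quot (submodule subS)).

Lemma mreprK : cancel mrepr mpi.
Proof. exact: reprK. Qed.

Lemma mpi_eq x y : mpi x = mpi y <-> x - y \in S.
Proof.
rewrite -[S]/(submodule subS). by rewrite Quotient.idealrBE; split=> [/eqP|/eqP]. Qed.

Lemma mpiD x y : mpi (x + y) = mpi x + mpi y.
Proof. exact: Quotient.pi_add. Qed.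

Definition mquot_scale (a : R) (x : mquot) : mquot := mpi (a *: mrepr x).

Lemma mquot_scale_pi a x : mquot_scale a (mpi x) = mpi (a *: x).
Proof. 
have xr : mrepr (mpi x) - x \in S by apply/mpi_eq/mreprK.
by apply/mpi_eq; rewrite -scalerBr (@rpredZ _ _ (submodule subS)). Qed.

Lemma mquot_scaleA a b x :
  mquot_scale a (mquot_scale b x) = mquot_scale (a * b) x.
Proof. by rewrite -[x]mreprK !mquot_scale_pi scalerA. Qed.

Lemma mquot_scale1 : left_id 1 mquot_scale.
Proof. by move=> x; rewrite -[x]mreprK mquot_scale_pi scale1r. Qed.

Lemma mquot_scaleDr : right_distributive mquot_scale +%R.
Proof.
move=> a x y; rewrite -[x]mreprK -[y]mreprK -mpiD !mquot_scale_pi.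
by rewrite scalerDr mpiD.
Qed.

Lemma mquot_scaleDl x : {morph mquot_scale^~ x : a b / a + b}.
Proof. by move=> a b /=; rewrite -[x]mreprK !mquot_scale_pi scalerDl mpiD. Qed.

HB.instance Definition _ := GRing.Zmodule_isLmodule.Build R mquot
  mquot_scaleA mquot_scale1 mquot_scaleDr mquot_scaleDl.

End QuotientModule.

Section DirectSum.
Variables (I : eqType) (V : I -> lmodType R).

Definition dprod := forall i, V i.

HB.instance Definition _ := gen_eqMixin dprod.
HB.instance Definition _ := gen_choiceMixin dprod.

Definition dprod_zero : dprod := fun _ => 0.
Definition dprod_opp (f : dprod) : dprod := fun i => - f i.
Definition dprod_add (f g : dprod) : dprod := fun i => f i + g i.
Definition dprod_scale (a : R) (f : dprod) : dprod := fun i => a *: f i.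

Lemma dprod_addA : associative dprod_add.
Proof. by move=> f g h; apply: functional_extensionality_dep => i; apply: addrA. Qed.
Lemma dprod_addC : commutative dprod_add.
Proof. by move=> f g; apply: functional_extensionality_dep => i; apply: addrC. Qed.
Lemma dprod_add0 : left_id dprod_zero dprod_add.
Proof. by move=> f; apply: functional_extensionality_dep => i; apply: add0r. Qed.
Lemma dprod_addN : left_inverse dprod_zero dprod_opp dprod_add.
Proof. by move=> f; apply: functional_extensionality_dep => i; apply: addNr. Qed.

HB.instance Definition _ := GRing.isZmodule.Build dprod
  dprod_addA dprod_addC dprod_add0 dprod_addN.

Lemma dprod_scaleA a b f : dprod_scale a (dprod_scale b f) = dprod_scale (a * b) f.
Proof. by apply: functional_extensionality_dep => i; apply: scalerA. Qed.
Lemma dprod_scale1 : left_id 1 dprod_scale.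
Proof. by move=> f; apply: functional_extensionality_dep => i; apply: scale1r. Qed.
Lemma dprod_scaleDr : right_distributive dprod_scale +%R.
Proof. by move=> a f g; apply: functional_extensionality_dep => i; apply: scalerDr. Qed.
Lemma dprod_scaleDl f : {morph dprod_scale^~ f : a b / a + b}.
Proof. by move=> a b; apply: functional_extensionality_dep => i; apply: scalerDl. Qed.

HB.instance Definition _ := GRing.Zmodule_isLmodule.Build R dprod
  dprod_scaleA dprod_scale1 dprod_scaleDr dprod_scaleDl.

Definition finsupp : {pred dprod} :=
  [pred f : dprod | `[< exists s : seq I, forall i, i \notin s -> f i = 0 >]].

Lemma finsupp_submod : submod_closed finsupp.
Proof.
split=> [|a f g]; rewrite !inE.
  by apply/asboolP; exists [::].
move=> /asboolP[s sf] /asboolP[t tg]; apply/asboolP; exists (s ++ t) => i.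
rewrite mem_cat negb_or => /andP[/sf fi /tg gi].
by rewrite -[LHS]/(a *: f i + g i) fi gi scaler0 addr0.
Qed.

HB.instance Definition _ :=
  GRing.isSubmodClosed.Build R dprod finsupp finsupp_submod.

(* The direct sum: finitely supported families. *)
Record dsum := DSum { dsum_val :> dprod; _ : dsum_val \in finsupp }.

HB.instance Definition _ := [isSub for dsum_val].
HB.instance Definition _ := [Choice of dsum by <:].
HB.instance Definition _ := [SubChoice_isSubLmodule of dsum by <:].

End DirectSum.

Definition injective_module (E : lmodType R) : Prop :=
  forall (A B : lmodType R) (f : {linear A -> B}) (g : {linear A -> E}),
    injective f -> exists h : {linear B -> E}, forall x, h (f x) = g x.

(* Identity when [i = j], zero otherwise: replaces casts along equalities
   between degrees. *)
Definition transfer (X : int -> lmodType R) (i j : int) : {linear X i -> X j} :=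
  match i =P j with
  | ReflectT e => match e in _ = j return {linear X i -> X j} with
                  | erefl => (idfun : {linear X i -> X i})
                  end
  | ReflectF _ => (\0 : {linear X i -> X j})
  end.

Lemma transfer_id X i x : transfer X i i x = x.
Proof. by rewrite /transfer; case: eqP => // e; rewrite (eq_irrelevance e erefl). Qed.

Lemma transfer_neq X i j x : i != j -> transfer X i j x = 0.
Proof. by rewrite /transfer; case: eqP. Qed.

(* Homological grading. The differential is a matrix of maps whose only
   possibly nonzero entries are those from degree [j + 1] to degree [j]; this
   avoids casts between [X (i - n - 1)] and [X (i - 1 - n)]. *)
Record complex := Complex {
  cobj :> int -> lmodType R;
  diff : forall i j, {linear cobj i -> cobj j};
  diff_shape : forall i j x, i != j + 1 -> diff i j x = 0;
  diff_diff : forall i j k x, diff j k (diff i j x) = 0 }.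

Record chain_map (X Y : complex) := ChainMap {
  cmap :> forall i, {linear X i -> Y i};
  cmap_diff : forall i j x, cmap j (diff X i j x) = diff Y i j (cmap i x) }.

Program Definition chain_id (X : complex) : chain_map X X :=
  @ChainMap X X (fun i => idfun) _.
Next Obligation. by []. Qed.

Program Definition chain_comp (X Y Z : complex) (g : chain_map Y Z)
    (f : chain_map X Y) : chain_map X Z :=
  @ChainMap X Z (fun i => g i \o f i : {linear X i -> Z i}) _.
Next Obligation. by move=> X Y Z g f i j x /=; rewrite !cmap_diff. Qed.

Definition cycles (X : complex) (i : int) : lmodType R := ker (diff X i (i - 1)).

Section Homology.
Variables (X : complex) (i : int).

Definition in_boundaries : {pred cycles X i} :=
  [pred z : cycles X i | `[< exists y, diff X (i + 1) i y = ker_val z >]].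

Lemma in_boundaries_submod : submod_closed in_boundaries.
Proof.
split=> [|a u v]; rewrite !inE; first by apply/asboolP; exists 0; rewrite raddf0.
move=> /asboolP[x xu] /asboolP[y yv]; apply/asboolP.
by exists (a *: x + y); rewrite linearP xu yv.
Qed.

Definition homology : lmodType R := mquot in_boundaries_submod.

End Homology.
Arguments in_boundaries : clear implicits.

Section HomologyMap.
Variables (X Y : complex) (f : chain_map X Y) (i : int).

Fact cycles_map_subproof (z : cycles X i) :
  f i (ker_val z) \in in_ker (diff Y i (i - 1)).
Proof. by rewrite inE -cmap_diff kerP raddf0. Qed.

Definition cycles_map (z : cycles X i) : cycles Y i := Ker (cycles_map_subproof z).

Definition homology_map (h : homology X i) : homology Y i :=
  mpi (in_boundaries_submod Y i) (cycles_map (mrepr h)).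

Lemma homology_map_pi z : homology_map (mpi _ z) = mpi _ (cycles_map z).
Proof.
apply/mpi_eq; set r := mrepr _.
have : r - z \in in_boundaries X i by exact/(mpi_eq (in_boundaries_submod X i))/mreprK.
rewrite !inE => /asboolP[y yE]; apply/asboolP; exists (f _ y).
by rewrite -cmap_diff yE /= raddfB.
Qed.

End HomologyMap.

Definition quasi_iso (X Y : complex) (f : chain_map X Y) : Prop :=
  forall i, bijective (homology_map f (i := i)).

Program Definition shift (n : int) (X : complex) : complex :=
  @Complex (fun i => X (i - n))
    (fun i j => mklinear (f := fun x => (-1) ^+ `|n|%N *: diff X (i - n) (j - n) x) _)
    _ _.
Next Obligation.
by move=> n X i j a x y; rewrite linearP scalerDr !scalerA [in RHS]mulrC.
Qed.
Next Obligation.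
move=> n X i j x /= ij; rewrite diff_shape ?scaler0 //.
by apply: contra ij => /eqP ij; rewrite -(subrK n i) ij addrAC subrK.
Qed.
Next Obligation. by move=> n X i j k x /=; rewrite linearZ /= diff_diff !scaler0. Qed.

Program Definition shift_map (n : int) (X Y : complex) (f : chain_map X Y) :
    chain_map (shift n X) (shift n Y) :=
  @ChainMap (shift n X) (shift n Y) (fun i => f (i - n)) _.
Next Obligation. by move=> n X Y f i j x /=; rewrite linearZ /= cmap_diff. Qed.

Lemma quasi_isoP (X Y : complex) (f : chain_map X Y) :
  quasi_iso f <-> forall a b c : int, a = b + 1 -> b = c + 1 ->
    (forall x, diff X b c x = 0 -> forall y, f b x = diff Y a b y ->
       exists x', x = diff X a b x') /\
    (forall y, diff Y b c y = 0 ->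
       exists x z, diff X b c x = 0 /\ y = f b x + diff Y a b z).
Proof.
split=> [qf a b c -> bc|qf i].
  have {bc} -> : c = b - 1 by rewrite bc addrK.
  have [g fK gK] := qf b; have fI := can_inj fK; split=> [x x0 y fxy|y y0].
    have xP : x \in in_ker (diff X b (b - 1)) by rewrite inE x0.
    have : mpi (in_boundaries_submod X b) (Ker xP) = mpi _ 0.
      apply: fI; rewrite !homology_map_pi; apply/mpi_eq; rewrite inE.
      by apply/asboolP; exists y; rewrite /= raddf0 subr0.
    by move/mpi_eq; rewrite subr0 inE => /asboolP[x' /= <-]; exists x'.
  have yP : y \in in_ker (diff Y b (b - 1)) by rewrite inE y0.
  have := gK (mpi _ (Ker yP)); rewrite -[g _]mreprK homology_map_pi.
  set x := mrepr _ => /esym/mpi_eq; rewrite inE => /asboolP[z /= zE].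
  exists (ker_val x), z; split; first exact: kerP.
  by rewrite zE [RHS]addrC subrK.
have [inj_f surj_f] := qf (i + 1) i (i - 1) erefl (esym (subrK 1 i)).
have fI : injective (homology_map f (i := i)).
  move=> h k; rewrite -[h]mreprK -[k]mreprK !homology_map_pi => /mpi_eq.
  rewrite inE => /asboolP[y /= yE]; apply/mpi_eq; rewrite inE; apply/asboolP.
  pose x := ker_val (mrepr h) - ker_val (mrepr k).
  have x0 : diff X i (i - 1) x = 0.
    by rewrite raddfB /= (kerP (mrepr h)) (kerP (mrepr k)) subr0.
  have fx : f i x = diff Y (i + 1) i y by rewrite raddfB /= yE.
  by have [x' xE] := inj_f x x0 y fx; exists x'; rewrite -xE.
have fS (h : homology Y i) : exists k, homology_map f k = h.
  rewrite -[h]mreprK; have [x [z [x0 hE]]] := surj_f _ (kerP (mrepr h)).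
  have xP : x \in in_ker (diff X i (i - 1)) by rewrite inE x0.
  exists (mpi _ (Ker xP)); rewrite homology_map_pi; apply/esym/mpi_eq.
  by rewrite inE; apply/asboolP; exists z; rewrite /= hE [in RHS]addrAC subrr add0r.
exists (fun h => projT1 (cid (fS h))) => h; last by case: cid.
by apply: fI; case: cid.
Qed.

Lemma quasi_iso_shift n (X Y : complex) (f : chain_map X Y) :
  quasi_iso f -> quasi_iso (shift_map n f).
Proof.
move=> /quasi_isoP qf; apply/quasi_isoP => a b c /= ab bc.
have sgnK (V : lmodType R) (v : V) : (-1) ^+ `|n|%N *: ((-1) ^+ `|n|%N *: v) = v.
  by rewrite scalerA -expr2 sqrr_sign scale1r.
have sgn0 (V : lmodType R) (v : V) : (-1) ^+ `|n|%N *: v = 0 -> v = 0.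
  by move=> v0; rewrite -[v]sgnK v0 scaler0.
have [||fi fs] := qf (a - n) (b - n) (c - n).
- by rewrite ab addrAC.
- by rewrite bc addrAC.
split=> [x /sgn0 x0 y fxy|y /sgn0 /fs[x [z [x0 yE]]]].
  have [|x' xE] := fi x x0 ((-1) ^+ `|n|%N *: y); first by rewrite linearZ.
  by exists ((-1) ^+ `|n|%N *: x'); rewrite linearZ /= sgnK.
exists x, ((-1) ^+ `|n|%N *: z); rewrite x0 scaler0; split=> //.
by rewrite linearZ /= sgnK.
Qed.

Program Definition complex0 : complex :=
  @Complex (fun _ => module0) (fun i j => \0) _ _.
Next Obligation. by []. Qed.
Next Obligation. by []. Qed.

Program Definition complex_sum (X Y : complex) : complex :=
  @Complex (fun i => (X i * Y i)%type)
    (fun i j => mklinear (f := fun p => (diff X i j p.1, diff Y i j p.2)) _) _ _.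
Next Obligation. by move=> X Y i j a [x y] [x' y'] /=; rewrite !linearP. Qed.
Next Obligation. by move=> X Y i j [x y] ij /=; rewrite !diff_shape. Qed.
Next Obligation. by move=> X Y i j k [x y] /=; rewrite !diff_diff. Qed.

(* A module viewed as a complex concentrated in degree 0. *)
Program Definition stalk (N : lmodType R) : complex :=
  @Complex (fun i => if i == 0 then N else module0) (fun i j => \0) _ _.
Next Obligation. by []. Qed.
Next Obligation. by []. Qed.

Section Cone.
Variables (X Y : complex) (f : chain_map X Y).

Lemma cone_comm i j k (x : X i) :
  diff Y j k (f j (transfer X i j x)) =
  f k (transfer X (j - 1) k (diff X i (j - 1) x)).
Proof.
have [<-{j}|ij] := eqVneq i j; last first.
  by rewrite transfer_neq // (diff_shape (i := i)) ?subrK // !linear0.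
rewrite transfer_id -cmap_diff; congr (f k _).
have [<-|ik] := eqVneq (i - 1) k; first by rewrite transfer_id.
by rewrite transfer_neq // diff_shape //; apply: contra ik => /eqP ->; rewrite addrK.
Qed.

Definition cone_diff i j (p : Y i * shift 1 X i) : Y j * shift 1 X j :=
  (diff Y i j p.1 + f j (transfer X (i - 1) j p.2), diff (shift 1 X) i j p.2).

Fact cone_diff_linear i j : linear (@cone_diff i j).
Proof.
move=> a [y x] [y' x']; rewrite /cone_diff /= !linearP /=.
by congr (_, _); rewrite /= scalerDr addrACA.
Qed.

(* In degree [i] the cone is [Y i (+) X (i - 1)], with differential
   [(y, x) |-> (d y + f x, - d x)]. *)
Program Definition cone : complex :=
  @Complex (fun i => (Y i * shift 1 X i)%type)
    (fun i j => mklinear (@cone_diff_linear i j)) _ _.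
Next Obligation.
move=> i j [y x] ij; rewrite /= /cone_diff /= -[_ *: _]/(diff (shift 1 X) i j x).
rewrite !diff_shape // add0r transfer_neq ?raddf0 //.
by apply: contra ij => /eqP <-; rewrite subrK.
Qed.
Next Obligation.
move=> i j k [y x]; rewrite /= /cone_diff /= !linearD /= diff_diff add0r.
rewrite cone_comm !scaleN1r !raddfN /= addrN.
by rewrite diff_diff !oppr0.
Qed.

Program Definition cone_in : chain_map Y cone :=
  @ChainMap Y cone (fun i => mklinear (f := fun y => (y, 0)) _) _.
Next Obligation. by move=> i a y y'; congr (_, _); rewrite /= scaler0 addr0. Qed.
Next Obligation.
by move=> i j y /=; rewrite /cone_diff /= !raddf0 addr0.
Qed.

Program Definition cone_out : chain_map cone (shift 1 X) :=
  @ChainMap cone (shift 1 X) (fun i => mklinear (f := snd) _) _.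
Next Obligation. by move=> i a [y x] [y' x']. Qed.
Next Obligation. by move=> i j [y x]. Qed.

End Cone.

(* The derived category is the localization of the category of complexes at the
   quasi-isomorphisms: [dhom X Y] consists of the formal composites of chain
   maps and formal inverses of quasi-isomorphisms, and [deq] is the congruence
   by which they are identified. *)
Inductive dhom : complex -> complex -> Type :=
| DMap X Y (f : chain_map X Y) : dhom X Y
| DInv X Y (s : chain_map X Y) (qs : quasi_iso s) : dhom Y X
| DComp X Y Z (g : dhom Y Z) (f : dhom X Y) : dhom X Z.

Definition did (X : complex) : dhom X X := DMap (chain_id X).

Inductive deq : forall X Y, dhom X Y -> dhom X Y -> Prop :=
| deq_refl X Y (f : dhom X Y) : deq f f
| deq_sym X Y (f g : dhom X Y) : deq f g -> deq g f
| deq_trans X Y (f g h : dhom X Y) : deq f g -> deq g h -> deq f h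
| deq_comp X Y Z (g g' : dhom Y Z) (f f' : dhom X Y) :
    deq g g' -> deq f f' -> deq (DComp g f) (DComp g' f')
| deq_assoc X Y Z T (h : dhom Z T) (g : dhom Y Z) (f : dhom X Y) :
    deq (DComp h (DComp g f)) (DComp (DComp h g) f)
| deq_idl X Y (f : dhom X Y) : deq (DComp (did Y) f) f
| deq_idr X Y (f : dhom X Y) : deq (DComp f (did X)) f
| deq_ext X Y (f g : chain_map X Y) :
    (forall i, f i =1 g i) -> deq (DMap f) (DMap g)
| deq_map_comp X Y Z (g : chain_map Y Z) (f : chain_map X Y) :
    deq (DMap (chain_comp g f)) (DComp (DMap g) (DMap f))
| deq_invl X Y (s : chain_map X Y) (qs : quasi_iso s) :
    deq (DComp (DInv qs) (DMap s)) (did X)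
| deq_invr X Y (s : chain_map X Y) (qs : quasi_iso s) :
    deq (DComp (DMap s) (DInv qs)) (did Y).

Fixpoint dshift (n : int) X Y (f : dhom X Y) : dhom (shift n X) (shift n Y) :=
  match f in dhom X Y return dhom (shift n X) (shift n Y) with
  | DMap X Y f => DMap (shift_map n f)
  | DInv X Y s qs => DInv (quasi_iso_shift n qs)
  | DComp X Y Z g f => DComp (dshift n g) (dshift n f)
  end.

Definition is_diso X Y (f : dhom X Y) : Prop :=
  exists g : dhom Y X, deq (DComp g f) (did X) /\ deq (DComp f g) (did Y).

Definition disomorphic (X Y : complex) : Prop := exists f : dhom X Y, is_diso f.

Record triangle := Triangle {
  tri1 : complex; tri2 : complex; tri3 : complex;
  tri12 : dhom tri1 tri2; tri23 : dhom tri2 tri3; tri31 : dhom tri3 (shift 1 tri1) }.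

Definition triangle_iso (S T : triangle) : Prop :=
  exists (a : dhom (tri1 S) (tri1 T)) (b : dhom (tri2 S) (tri2 T))
         (c : dhom (tri3 S) (tri3 T)),
    [/\ is_diso a, is_diso b & is_diso c] /\
    [/\ deq (DComp b (tri12 S)) (DComp (tri12 T) a),
        deq (DComp c (tri23 S)) (DComp (tri23 T) b)
      & deq (DComp (dshift 1 a) (tri31 S)) (DComp (tri31 T) c)].

Definition cone_triangle X Y (f : chain_map X Y) : triangle :=
  Triangle (DMap f) (DMap (cone_in f)) (DMap (cone_out f)).

Definition distinguished (T : triangle) : Prop :=
  exists X Y (f : chain_map X Y), triangle_iso T (cone_triangle f).

Definition dtriangle (X Y Z : complex) : Prop :=
  exists (u : dhom X Y) (v : dhom Y Z) (w : dhom Z (shift 1 X)),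
    distinguished (Triangle u v w).

(* Finite direct sums are generated by the empty one and the binary ones. *)
Inductive thick1 (C : complex -> Prop) : complex -> Prop :=
| thick1_in X : C X -> thick1 C X
| thick1_iso X Y : disomorphic X Y -> thick1 C X -> thick1 C Y
| thick1_shift n X : thick1 C X -> thick1 C (shift n X)
| thick1_sum0 : thick1 C complex0
| thick1_sum X Y : thick1 C X -> thick1 C Y -> thick1 C (complex_sum X Y)
| thick1_summand X Y : thick1 C (complex_sum X Y) -> thick1 C X.

Fixpoint thick (C : complex -> Prop) (n : nat) (M : complex) : Prop :=
  match n with
  | 0 => disomorphic M complex0
  | n'.+1 =>
      match n' with
      | 0 => thick1 C M
      | _ => exists K L N, [/\ dtriangle K (complex_sum L M) N,
                               thick1 C K & thick C n' N]
      end
  end.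

Definition level (C : complex -> Prop) (M : complex) : option nat :=
  enat_inf (fun n => thick C n M).

Definition acyclic (X : complex) : Prop := forall i (h : homology X i), h = 0.

(* Acyclicity of the complex [Hom(E, X)], whose differential is composition
   with the differential of [X]. *)
Definition Hom_acyclic (E : lmodType R) (X : complex) : Prop :=
  forall (i : int) (g : {linear E -> X i}), (forall e, diff X i (i - 1) (g e) = 0) ->
    exists h : {linear E -> X (i + 1)}, forall e, diff X (i + 1) i (h e) = g e.

Definition gorenstein_injective (N : lmodType R) : Prop :=
  exists I : complex,
    [/\ forall i, injective_module (I i),
        acyclic I,
        forall E, injective_module E -> Hom_acyclic E I
      & exists i (phi : {linear N -> cycles I i}), bijective phi].

(* Exact sequences [0 -> N -> C 0 -> C 1 -> ... -> C n -> 0], prolonged by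
   zeros; [C k] sits in homological degree [- k]. *)
Definition GI_coresolution (N : lmodType R) (n : nat) : Prop :=
  exists (C : nat -> lmodType R) (e : {linear N -> C 0%N})
         (d : forall k, {linear C k -> C k.+1}),
    [/\ forall k, (k <= n)%N -> gorenstein_injective (C k),
        forall k, (n < k)%N -> forall x : C k, x = 0,
        injective e,
        forall x, d 0%N x = 0 <-> exists y, e y = x
      & forall k x, d k.+1 x = 0 <-> exists y, d k y = x].

Definition Gid (N : lmodType R) : option nat := enat_inf (GI_coresolution N).

Definition GI (X : complex) : Prop :=
  exists2 N, gorenstein_injective N & X = stalk N.

Definition in_Dbf (M : complex) : Prop :=
  (exists n, forall i : int, (n < `|i|)%N -> forall h : homology M i, h = 0) /\
  (forall i, finitely_generated (homology M i)).

Definition total_homology (M : complex) : lmodType R := dsum (homology M).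

(* Ideals of [R] are the submodules of the regular module. *)
Definition noetherian : Prop :=
  forall J : {pred R^o}, submod_closed J ->
    exists n (g : 'I_n -> R), forall x,
      x \in J <-> exists c : 'I_n -> R, x = \sum_(i < n) c i * g i.

Definition maximal_ideal (m : {pred R}) : Prop :=
  idealr_closed m /\
  forall J : {pred R}, idealr_closed J -> {subset m <= J} -> J =i m.

Definition local_ring (m : {pred R}) : Prop :=
  maximal_ideal m /\ forall m', maximal_ideal m' -> m' =i m.

Definition generated_ideal (s : seq R) (x : R) : Prop :=
  exists c : nat -> R, x = \sum_(i < size s) c i * s`_i.

Definition regular_sequence (s : seq R) : Prop :=
  (forall i a, (i < size s)%N ->
     generated_ideal (take i s) (s`_i * a) -> generated_ideal (take i s) a) /\
  ~ generated_ideal s 1.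

(* For a noetherian local ring with maximal ideal [m]: the supremum of the
   lengths of the regular sequences in [m]. *)
Definition depth (m : {pred R}) : option nat :=
  enat_sup (fun n => exists s : seq R,
    [/\ size s = n, {subset s <= m} & regular_sequence s]).

End Modules.

(* Main.v *)
(* Let [d] be the depth of [R].

   Upper bound.  A finitely generated module of finite Gorenstein injective
   dimension has dimension at most [d] (Bass): let [0 -> W -> I -> V -> 0] be
   exact with [I] injective, [V] Gorenstein injective and [W] an [n]th cosyzygy of
   a finitely generated module, [n >= d].  Take a surjection [B -> V] from an
   injective module whose kernel is Gorenstein injective, and let [X] be the
   kernel of the induced surjection onto [B] from [I] plus an injective cover of
   that kernel.  If [X] were not injective, then [Ext^1(R/p,X) <> 0] for a largest
   ideal [p], which is prime; elements killed by a sequence that is regular at [p]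
   lift along injective covers, and Nakayama's lemma ([p] not maximal) or the depth
   ([p] maximal) gives a contradiction.  Hence all [H_i(M)] have dimension at most
   [d].  Mapping [M] to injective hulls of the [H_i(M)] and passing to the fibre
   lowers all these dimensions by one, and when they are at most one, [M] is
   quasi-isomorphic to a complex whose boundaries [B] and quotients [X/B] are
   Gorenstein injective; so [M] has a filtration with [d + 1] layers.

   Lower bound.  For a regular sequence [x_1, ..., x_n], each [x_k] acts
   surjectively on the elements killed by [x_1, ..., x_(k-1)] in a Gorenstein
   injective module.  Adjoining [x_k] to a Koszul complex therefore induces zero
   on the homology of an object of [thick^1], and composing along the triangles,
   [H(M) -> H(Koszul(x_1, ..., x_n; M))] vanishes for [M] in [thick^n].  In the
   lowest nonzero degree this map is [H -> H/(x_1, ..., x_n)H], which contradicts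
   Nakayama's lemma. *)

Require Import Defs.
From HB Require Import structures.
From mathcomp Require Import all_boot all_order all_algebra.
From mathcomp Require Import boolp.
From mathcomp Require classical_sets.
From mathcomp Require Import zify.

Set Implicit Arguments.
Unset Strict Implicit.
Unset Printing Implicit Defensive.

Import GRing.Theory.
Local Open Scope ring_scope.

#[local] Obligation Tactic := idtac.

(** * Modules and linear relations *)

(** Hulls are not minimal here: a hull is any embedding into an injective module, and these
    embeddings are read off from the finite Gorenstein injective dimension. Dimension is measured by
    [idg], a condition on one cosyzygy, because it passes to extensions, retracts and fibres. The
    obstacle in the upper bound is that Gorenstein injective homology does not by itself make
    boundaries and cycles Gorenstein injective. The recursion over fibres therefore stops at
    dimension one and not at zero; there the complex is cut into its boundaries and the quotient by
    them, which costs two layers. This is where the depth has to be positive. The obstacle in the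
    lower bound is that a morphism of the derived category is a formal word in chain maps and
    inverses of quasi-isomorphisms. Its effect on Koszul homology is therefore kept as a linear
    relation between cycles, in which an inverse is simply the converse relation. Graphs in place of
    formulas also serve to build many of the linear maps of the proof. *)

Section LinearRelations.
Variable R : comNzRingType.
Implicit Types U V W A B C E : lmodType R.

(** A submodule of the product, read as a multivalued map. Preimages chosen one by one are not
    linear, but their graph is; [linrel_fun] recovers a map once the indeterminacy vanishes. *)
Definition linrel U V (G : U -> V -> Prop) : Prop :=
  G 0 0 /\ forall a x y u v, G x u -> G y v -> G (a *: x + y) (a *: u + v).

(** [Prop]-valued, so that submodules can be cut out by existential statements; [quot_ex] and
    [sub_ex] turn them into modules. *)
Definition lsub V (S : V -> Prop) : Prop :=
  S 0 /\ forall a x y, S x -> S y -> S (a *: x + y).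

Lemma lsubD V (S : V -> Prop) x y : lsub S -> S x -> S y -> S (x + y).
Proof. by case=> _ SD Sx Sy; rewrite -[x]scale1r; apply: SD. Qed.

Lemma lsubZ V (S : V -> Prop) a x : lsub S -> S x -> S (a *: x).
Proof. by case=> S0 SD Sx; rewrite -[_ *: _]addr0; apply: SD. Qed.

Lemma lsubN V (S : V -> Prop) x : lsub S -> S x -> S (- x).
Proof. by move=> SS Sx; rewrite -scaleN1r; apply: lsubZ. Qed.

Lemma lsubB V (S : V -> Prop) x y : lsub S -> S x -> S y -> S (x - y).
Proof. by move=> SS Sx Sy; apply: lsubD => //; apply: lsubN. Qed.

Lemma lsub_sum V (S : V -> Prop) (I : Type) (r : seq I) (F : I -> V) :
  lsub S -> (forall i, S (F i)) -> S (\sum_(i <- r) F i).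
Proof.
by move=> SS SF; apply: big_rec => [|i x _]; [case: SS | apply: lsubD].
Qed.

Lemma linrelB U V (G : U -> V -> Prop) x u v : linrel G -> G x u -> G x v ->
  G 0 (u - v).
Proof.
case=> _ GD Gu Gv; rewrite -[0](addNr x) -scaleN1r addrC.
by have := GD (-1) _ _ _ _ Gv Gu; rewrite !scaleN1r [- v + u]addrC [- x + x]addrC.
Qed.

Lemma linrel_fun U V (G : U -> V -> Prop) :
  linrel G -> (forall x, exists u, G x u) -> (forall u, G 0 u -> u = 0) ->
  exists h : {linear U -> V}, forall x u, G x u <-> h x = u.
Proof.
move=> GL Gt G0; pose h x := projT1 (cid (Gt x)).
have hP x : G x (h x) by rewrite /h; case: cid.
have hU x u : G x u -> h x = u.
  by move=> Gxu; apply/eqP; rewrite -subr_eq0; apply/eqP/G0; apply: linrelB Gxu.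
have h_lin : linear h by move=> a x y; apply: hU; apply: (proj2 GL).
by exists (mklinear h_lin) => x u; split=> [/hU //|<-]; apply: hP.
Qed.

Definition surj U V (f : U -> V) : Prop := forall v, exists u, f u = v.

Lemma bij_surj U V (f : U -> V) : injective f -> surj f -> bijective f.
Proof.
move=> fI fS; pose g v := projT1 (cid (fS v)).
have gK : cancel g f by move=> v; rewrite /g; case: cid.
by exists g => // u; apply: fI; rewrite gK.
Qed.

Lemma linear_inj U V (f : {linear U -> V}) :
  (forall x, f x = 0 -> x = 0) -> injective f.
Proof.
move=> f0 x y fxy; apply/eqP; rewrite -subr_eq0; apply/eqP/f0.
by rewrite raddfB /= fxy subrr.
Qed.

Lemma inj0 U V (f : {linear U -> V}) x : injective f -> f x = 0 -> x = 0.
Proof. by move=> fI fx; apply: fI; rewrite fx raddf0. Qed.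

Lemma quot_ex V (S : V -> Prop) : lsub S ->
  exists (Q : lmodType R) (p : {linear V -> Q}),
    surj p /\ forall v, p v = 0 <-> S v.
Proof.
move=> [S0 SD]; pose T := [pred v : V | `[< S v >]].
have TS : submod_closed T.
  split=> [|a x y]; rewrite !inE; first exact/asboolP.
  by move=> /asboolP Sx /asboolP Sy; apply/asboolP/SD.
have pL : linear (Defs.mpi TS).
  by move=> a x y; rewrite mpiD -(mquot_scale_pi TS).
exists (mquot TS), (mklinear pL); split=> [v|v /=].
  by exists (mrepr v); apply: mreprK.
have -> : (Defs.mpi TS v = 0) <-> (Defs.mpi TS v = Defs.mpi TS 0).
  by have -> : Defs.mpi TS 0 = 0 by rewrite -(raddf0 (mklinear pL)).
by rewrite mpi_eq subr0 inE; split=> /asboolP.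
Qed.

Lemma sub_ex V (S : V -> Prop) : lsub S ->
  exists (A : lmodType R) (f : {linear A -> V}),
    injective f /\ forall v, S v <-> exists a, f a = v.
Proof.
move=> /quot_ex[Q [p [_ pS]]].
have fL : linear (@ker_val R V Q p) by [].
exists (ker p), (mklinear fL); split=> [x y|v]; first exact: val_inj.
split=> [Sv|[a <-]]; last by apply/pS/kerP.
have vP : v \in in_ker p by rewrite inE; apply/eqP/pS.
by exists (Ker vP).
Qed.

Lemma fst_linear U V : linear (@fst U V). Proof. by []. Qed.
Lemma snd_linear U V : linear (@snd U V). Proof. by []. Qed.
Definition lfst U V : {linear (U * V)%type -> U} := mklinear (@fst_linear U V).
Definition lsnd U V : {linear (U * V)%type -> V} := mklinear (@snd_linear U V).

Lemma inl_linear U V : linear (fun u : U => (u, 0 : V)).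
Proof. by move=> a x y; congr (_, _); rewrite /= scaler0 addr0. Qed.
Lemma inr_linear U V : linear (fun v : V => (0 : U, v)).
Proof. by move=> a x y; congr (_, _); rewrite /= scaler0 addr0. Qed.
Definition linl U V : {linear U -> (U * V)%type} := mklinear (@inl_linear U V).
Definition linr U V : {linear V -> (U * V)%type} := mklinear (@inr_linear U V).

Lemma pair_linear U V W (f : {linear U -> V}) (g : {linear U -> W}) :
  linear (fun u => (f u, g u)).
Proof. by move=> a x y; rewrite !linearP. Qed.
Definition lpair U V W (f : {linear U -> V}) (g : {linear U -> W}) :=
  mklinear (pair_linear f g).

Lemma copair_linear U V W (f : {linear U -> W}) (g : {linear V -> W}) :
  linear (fun p : U * V => f p.1 + g p.2).
Proof. by move=> a [x y] [x' y']; rewrite /= !linearP scalerDr addrACA. Qed.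
Definition lcopair U V W (f : {linear U -> W}) (g : {linear V -> W}) :=
  mklinear (copair_linear f g).

Definition lcomp U V W (g : {linear V -> W}) (f : {linear U -> V}) :
  {linear U -> W} := g \o f.

Lemma lsubf_linear U V (f g : {linear U -> V}) : linear (fun u => f u - g u).
Proof. by move=> a x y; rewrite !linearP /= scalerDr addrACA. Qed.
Definition lsubf U V (f g : {linear U -> V}) := mklinear (lsubf_linear f g).

Lemma scale_linear U (a : R) : linear (fun u : U => a *: u).
Proof. by move=> b x y; rewrite scalerDr !scalerA mulrC. Qed.
Definition lscale U (a : R) : {linear U -> U} := mklinear (@scale_linear U a).

(** [G] is a map defined on a submodule of [U]. Single-valuedness makes the projection of its graph
    to [U] injective, and the other projection is extended along it. *)
Lemma inj_rel E U (G : U -> E -> Prop) : injective_module E ->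
  linrel G -> (forall u, G 0 u -> u = 0) ->
  exists h : {linear U -> E}, forall x u, G x u -> h x = u.
Proof.
move=> Einj [G00 GD] G0; pose S (p : U * E) := G p.1 p.2.
have SS : lsub S by split=> // a [x u] [y v]; apply: GD.
have [A [f [fI fS]]] := sub_ex SS.
have f1I : injective (lcomp (lfst U E) f).
  apply: linear_inj => a /= fa; apply: (inj0 fI).
  have : S (f a) by apply/fS; exists a.
  by case: (f a) fa => x u /= ->; rewrite /S /= => /G0 ->.
have [h hP] := Einj _ _ _ (lcomp (lsnd U E) f) f1I.
exists h => x u Gxu; have /fS[a fa] : S (x, u) by [].
by have := hP a; rewrite /= fa.
Qed.

Definition ses A B C (f : {linear A -> B}) (g : {linear B -> C}) : Prop :=
  [/\ injective f, forall y, g y = 0 <-> exists x, f x = y & surj g].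

Lemma ses_gf A B C (f : {linear A -> B}) (g : {linear B -> C}) x :
  ses f g -> g (f x) = 0.
Proof. by case=> _ fg _; apply/fg; exists x. Qed.

Lemma coker_ex A B (f : {linear A -> B}) : injective f ->
  exists C (g : {linear B -> C}), ses f g.
Proof.
move=> fI; have SS : lsub (fun y => exists x, f x = y).
  split=> [|a _ _ [x <-] [y <-]]; first by exists 0; rewrite raddf0.
  by exists (a *: x + y); rewrite linearP.
by have [Q [p [pS pK]]] := quot_ex SS; exists Q, p.
Qed.

Lemma ker_ex B C (g : {linear B -> C}) : surj g ->
  exists A (f : {linear A -> B}), ses f g.
Proof.
move=> gS; have SS : lsub (fun y => g y = 0).
  by split=> [|a x y gx gy]; rewrite ?raddf0 // linearP gx gy scaler0 addr0.
by have [A [f [fI fP]]] := sub_ex SS; exists A, f.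
Qed.

Lemma desc A B C (p : {linear A -> B}) (f : {linear A -> C}) : surj p ->
  (forall x, p x = 0 -> f x = 0) ->
  exists h : {linear B -> C}, forall x, h (p x) = f x.
Proof.
move=> pS pf; pose G b c := exists2 x, p x = b & f x = c.
have [||u|h hP] := @linrel_fun B C G.
- split=> [|a _ _ _ _ [x <- <-] [y <- <-]]; first by exists 0; rewrite raddf0.
  by exists (a *: x + y); rewrite linearP.
- by move=> b; have [x <-] := pS b; exists (f x), x.
- by case=> x /pf -> <-.
by exists h => x; apply/hP; exists x.
Qed.

Lemma factor A B C (i : {linear A -> B}) (f : {linear C -> B}) : injective i ->
  (forall x, exists a, i a = f x) ->
  exists h : {linear C -> A}, forall x, i (h x) = f x.
Proof.
move=> iI fi; pose G c a := i a = f c.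
have [||u|h hP] := @linrel_fun C A G.
- by split=> [|a x y u v]; rewrite /G ?raddf0 // !linearP => -> ->.
- exact: fi.
- by rewrite /G raddf0 => /(inj0 iI).
by exists h => x; have /hP : h x = h x by [].
Qed.

End LinearRelations.

(** * Gorenstein injective modules *)

Section GorensteinInjective.
Variable R : comNzRingType.
Implicit Types (U V W A B C D E K N Y : lmodType R) (P : lmodType R -> Prop).

(** [Ext^1(E,A) = 0] for all injective [E], as a lifting property against every extension of [A]. *)
Definition ext1v A : Prop :=
  forall Y C (f : {linear A -> Y}) (g : {linear Y -> C}), ses f g ->
  forall E, injective_module E -> forall h : {linear E -> C},
    exists l : {linear E -> Y}, forall e, g (l e) = h e.

Definition lstep P A : Prop :=
  exists K E (f : {linear K -> E}) (g : {linear E -> A}),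
    [/\ injective_module E, P K & ses f g].

Definition rstep P A : Prop :=
  exists E C (f : {linear A -> E}) (g : {linear E -> C}),
    [/\ injective_module E, P C & ses f g].

(** Every extension of [A] is the pullback of this one along a map [k'] of the quotients, since [E]
    is injective. A map thus lifts to the extension as soon as its composite with [k'] lifts to
    [E]. *)
Lemma ext1v_inj A E C (f : {linear A -> E}) (g : {linear E -> C}) :
  injective_module E -> ses f g ->
  (forall E', injective_module E' -> forall h : {linear E' -> C},
    exists l : {linear E' -> E}, forall e, g (l e) = h e) ->
  ext1v A.
Proof.
move=> Einj [fI fg gS] lift Y D f' g' s' E' E'inj h.
have [f'I f'g' g'S] := s'.
have [k kP] := Einj _ _ f' f f'I.
have gk y : g' y = 0 -> g (k y) = 0.
  by move/f'g'=> [x <-]; rewrite kP; apply/fg; exists x.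
have [k' k'P] := desc (f := lcomp g k) g'S gk.
have [l lP] := lift _ E'inj (lcomp k' h).
pose G e y := g' y = h e /\ k y = l e.
have [||u|t tP] := @linrel_fun R E' Y G.
- split=> [|a x y u v]; first by rewrite /G !raddf0.
  by rewrite /G !linearP => -[-> ->] [-> ->].
- move=> e; have [y yP] := g'S (h e).
  have /fg[a aP] : g (k y - l e) = 0.
    by rewrite raddfB /= lP /= -yP k'P subrr.
  exists (y - f' a); split.
    by rewrite raddfB /= (ses_gf _ s') subr0.
  by rewrite raddfB /= kP aP opprB addrC subrK.
- rewrite /G !raddf0 => -[/f'g'[a <-]]; rewrite kP => /(inj0 fI) ->.
  by rewrite raddf0.
by exists t => e; have [_ /(_ erefl)[]] := tP e (t e).
Qed.

(** A coinductive description: the Gorenstein injective modules form the largest class of this kind,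
    by [GI_coind] and [GI_gclass]. Closure properties then ask for one step to either side and not
    for a doubly infinite complex. *)
Definition gclass P : Prop :=
  forall A, P A -> [/\ ext1v A, lstep P A & rstep P A].

Lemma acyclic_exact (X : complex R) (a b c : int) : acyclic X ->
  a = b + 1 -> b = c + 1 -> forall x, diff X b c x = 0 ->
  exists y, diff X a b y = x.
Proof.
move=> Xa -> bc x dx; have {bc} cE : c = b - 1 by rewrite bc addrK.
rewrite {}cE in dx; have xP : x \in in_ker (diff X b (b - 1)) by rewrite inE dx.
have /= := Xa b (Defs.mpi (in_boundaries_submod X b) (Ker xP)).
have <- : Defs.mpi (in_boundaries_submod X b) 0 = 0.
  have pL : linear (Defs.mpi (in_boundaries_submod X b)).
    by move=> a' u v; rewrite mpiD -(mquot_scale_pi (in_boundaries_submod X b)).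
  exact: (raddf0 (mklinear pL)).
by move/mpi_eq; rewrite subr0 inE => /asboolP[y /= yP]; exists y.
Qed.

Lemma transfer_surj (X : int -> lmodType R) i j : i = j -> surj (transfer X i j).
Proof. by move=> <- x; exists x; rewrite transfer_id. Qed.

Lemma transferK (X : int -> lmodType R) i j x : i = j ->
  transfer X j i (transfer X i j x) = x.
Proof. by move=> ij; subst j; rewrite !transfer_id. Qed.

Lemma diff_transfer (X : complex R) i j k x : i = j ->
  diff X j k (transfer X i j x) = diff X i k x.
Proof. by move=> ij; subst j; rewrite transfer_id. Qed.

Lemma ker_val_linear U V (f : {linear U -> V}) : linear (@ker_val R U V f).
Proof. by []. Qed.
Definition lker U V (f : {linear U -> V}) : {linear ker f -> U} :=
  mklinear (@ker_val_linear U V f).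

Lemma lker_inj U V (f : {linear U -> V}) : injective (lker f).
Proof. exact: val_inj. Qed.

Lemma lkerP U V (f : {linear U -> V}) x : f x = 0 -> exists z, lker f z = x.
Proof.
by move=> fx; have xP : x \in in_ker f by [rewrite inE fx]; exists (Ker xP).
Qed.

(** The short exact sequence as data, so that a family indexed by the integers can be spliced. *)
Record stepT (K A : lmodType R) := StepT {
  step_mid : lmodType R;
  step_in : {linear K -> step_mid};
  step_out : {linear step_mid -> A};
  step_inj : injective_module step_mid;
  step_ses : ses step_in step_out }.

Lemma gclass_complex P A : gclass P -> P A ->
  exists Z : int -> lmodType R,
    [/\ Z 0 = A, forall i, ext1v (Z i) & forall i, inhabited (stepT (Z i) (Z (i - 1)))].
Proof.
move=> gP PA; pose St := {A | P A}.
pose stp (K A : St) := inhabited (stepT (sval K) (sval A)).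
have [l lP] : {l : St -> St & forall B : St, stp (l B) B}.
  apply: (@choice _ _ (fun B K : St => stp K B)) => -[B PB].
  have [_ [K [E [f [g [Einj PK fg]]]]] _] := gP B PB.
  by exists (exist _ K PK); split; exists E f g.
have [r rP] : {r : St -> St & forall B : St, stp B (r B)}.
  apply: choice => -[B PB].
  have [_ _ [E [C [f [g [Einj PC fg]]]]]] := gP B PB.
  by exists (exist _ C PC); split; exists E f g.
pose s0 : St := exist _ A PA.
(* Homological grading: steps to the left lead to positive degrees, steps to the right to negative
   ones. *)
pose Z i := match i with Posz n => iter n l s0 | Negz n => iter n.+1 r s0 end.
exists (fun i => sval (Z i)); split=> // i; first by have [] := gP _ (svalP (Z i)).
case: i => [[|n]|n].
- exact: rP.
- have -> : n.+1%:Z - 1 = n%:Z by rewrite -addn1 PoszD addrK.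
  exact: lP.
- have -> : Negz n - 1 = Negz n.+1 by rewrite !NegzE -opprD -PoszD addn1.
  exact: rP.
Qed.

(** Splicing the sequences gives an acyclic complex of injectives with cycles [Z i]. A map from an
    injective [E] to the cycles [Z i] lifts to degree [i + 1] because [Ext^1(E, Z (i + 1))]
    vanishes, so [Hom(E,-)] keeps the complex acyclic. *)
Lemma GI_coind P A : gclass P -> P A -> gorenstein_injective A.
Proof.
move=> gP PA; have [Z [Z0 Zext Zst]] := gclass_complex gP PA.
have st i : stepT (Z i) (Z (i - 1)).
  have /cid[] : exists s : stepT (Z i) (Z (i - 1)), True by case: (Zst i) => s; exists s.
  by [].
pose X i := step_mid (st i).
pose d i j : {linear X i -> X j} :=
  lcomp (step_in (st j)) (lcomp (transfer Z (i - 1) j) (step_out (st i))).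
have dE i x : d i (i - 1) x = step_in (st (i - 1)) (step_out (st i) x).
  by rewrite /d /= transfer_id.
have sI i : injective (step_in (st i)) by case: (step_ses (st i)).
have dS i j x : i != j + 1 -> d i j x = 0.
  move=> ij; rewrite /d /= transfer_neq ?raddf0 //.
  by apply: contra ij => /eqP <-; rewrite subrK.
have dd i j k x : d j k (d i j x) = 0.
  by rewrite /d /= (ses_gf _ (step_ses (st j))) !raddf0.
have d0 i x : d i (i - 1) x = 0 -> exists z, step_in (st i) z = x.
  by rewrite dE => /(inj0 (@sI _)); case: (step_ses (st i)) => _ H _ /H.
pose I := Complex dS dd; exists I; split.
- by move=> i; apply: step_inj.
- move=> i h; rewrite -[h]mreprK.
  have <- : Defs.mpi (in_boundaries_submod I i) 0 = 0.
    have pL : linear (Defs.mpi (in_boundaries_submod I i)).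
      by move=> a' u v; rewrite mpiD -(mquot_scale_pi (in_boundaries_submod I i)).
    exact: (raddf0 (mklinear pL)).
  apply/mpi_eq; rewrite subr0 inE; apply/asboolP.
  have /d0[z zE] : d i (i - 1) (ker_val (mrepr h)) = 0 by apply: (kerP (mrepr h)).
  have [w wE] := @transfer_surj Z (i + 1 - 1) i (addrK _ _) z.
  have [y yE] : exists y, step_out (st (i + 1)) y = w.
    by case: (step_ses (st (i + 1))).
  by exists y; rewrite -zE /= /d /= yE wE.
- move=> E Einj i g dg.
  have gz e : exists z, step_in (st i) z = g e by apply: d0; apply: dg.
  have [g' g'P] := factor (@sI i) gz.
  have [h hP] := Zext _ _ _ _ _ (step_ses (st (i + 1))) E Einj
    (lcomp (transfer Z i (i + 1 - 1)) g').
  exists h => e; rewrite /= /d /= hP /= -g'P; congr (step_in _ _).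
  by rewrite transferK ?addrK.
exists 0; subst A.
have [z|h hP] := @factor R _ _ _ (lker (diff I 0 (0 - 1))) (step_in (st 0)) (@lker_inj _ _ _).
  apply: lkerP; rewrite -[LHS]/(d 0 (0 - 1) (step_in (st 0) z)) dE.
  by rewrite (ses_gf _ (step_ses (st 0))) raddf0.
exists h; apply: bij_surj.
  by move=> x y hxy; apply: (@sI 0); rewrite -!hP hxy.
move=> v; have /d0[z zE] : d 0 (0 - 1) (lker _ v) = 0 by apply: kerP.
by exists z; apply: (@lker_inj _ _ (diff I 0 (0 - 1))); rewrite hP zE.
Qed.

(** All cycle modules of the complex that witnesses [N] are Gorenstein injective. The two steps are
    its short exact sequences around degree [i], and the vanishing of [Ext^1] is acyclicity of
    [Hom(E,I)] in degree [i - 1]. *)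
Lemma GI_gclass : gclass (@gorenstein_injective R).
Proof.
move=> N [I [Iinj Iac IH [i [phi phiB]]]].
have cycGI j : gorenstein_injective (cycles I j).
  by exists I; split=> //; exists j, idfun; exists idfun.
have phiI := bij_inj phiB.
pose e := lcomp (lker (diff I i (i - 1))) phi.
have eI : injective e by move=> x y /= /(@lker_inj _ _ (diff I i (i - 1)))/phiI.
have eP x : diff I i (i - 1) x = 0 <-> exists a, e a = x.
  split=> [/lkerP[z <-]|[a <-]]; last exact: kerP.
  by case: phiB => psi _ psiK; exists (psi z); rewrite /= psiK.
have [b bP] : exists b : {linear I i -> cycles I (i - 1)},
    forall x, lker (diff I (i - 1) (i - 1 - 1)) (b x) = diff I i (i - 1) x.
  by apply: factor (@lker_inj _ _ _) _ => x; apply: lkerP; rewrite diff_diff.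
have sR : ses e b.
  split=> [//|y|z].
    rewrite -eP -bP; split=> [->|/(inj0 (@lker_inj _ _ _)) //]; exact: raddf0.
  have [||y yE] := @acyclic_exact I i (i - 1) (i - 1 - 1) Iac _ _ (lker _ z) (kerP z).
  - by rewrite subrK.
  - by rewrite subrK.
  by exists y; apply: (@lker_inj _ _ (diff I (i - 1) (i - 1 - 1))); rewrite bP.
split.
- apply: (ext1v_inj (Iinj i) sR) => E' E'inj h.
  have [|l lP] := IH E' E'inj (i - 1) (lcomp (lker _) h).
    by move=> x; apply: kerP.
  have [t tP] : exists t : {linear E' -> I i},
      forall x, diff I i (i - 1) (t x) = lker (diff I (i - 1) (i - 1 - 1)) (h x).
    exists (lcomp (transfer I (i - 1 + 1) i) l) => x.
    by rewrite -[RHS]lP /= diff_transfer ?subrK.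
  exists t => x; apply: (@lker_inj _ _ (diff I (i - 1) (i - 1 - 1))).
  by rewrite bP tP.
- have [p pP] : exists p : {linear I (i + 1) -> N},
      forall x, e (p x) = diff I (i + 1) i x.
    by apply: factor eI _ => x; apply/eP; rewrite diff_diff.
  exists (cycles I (i + 1)), (I (i + 1)), (lker _), p; split=> //.
  split=> [|y|z]; first exact: lker_inj.
    have -> : (p y = 0) <-> (diff I (i + 1) (i + 1 - 1) y = 0).
      have -> : i + 1 - 1 = i by rewrite addrK.
      by rewrite -pP; split=> [->|/(inj0 eI) //]; rewrite raddf0.
    split=> [/lkerP //|[x <-]]; exact: kerP.
  have [|||y yE] := @acyclic_exact I (i + 1) i (i - 1) Iac _ _ (e z).
  - by [].
  - by rewrite subrK.
  - by apply/eP; exists z.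
  by exists y; apply: eI; rewrite pP.
- by exists (I i), (cycles I (i - 1)), e, b.
Qed.

Lemma lstepW P Q A : (forall B, P B -> Q B) -> lstep P A -> lstep Q A.
Proof. by move=> PQ [K [E [f [g [? /PQ ? ?]]]]]; exists K, E, f, g. Qed.

Lemma rstepW P Q A : (forall B, P B -> Q B) -> rstep P A -> rstep Q A.
Proof. by move=> PQ [E [C [f [g [? /PQ ? ?]]]]]; exists E, C, f, g. Qed.

(** Coinduction up to known members: a step may leave [P] if it lands on a module already known to
    be Gorenstein injective. *)
Lemma GI_coind_upto P A :
  (forall B, P B -> [/\ ext1v B, lstep (fun K => P K \/ gorenstein_injective K) B
                   & rstep (fun K => P K \/ gorenstein_injective K) B]) ->
  P A -> gorenstein_injective A.
Proof.
move=> PP PA; apply: (@GI_coind (fun K => P K \/ gorenstein_injective K)); last by left.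
move=> B [/PP //|/GI_gclass[Be Bl Br]]; split=> //; [apply: lstepW Bl|apply: rstepW Br];
  by right.
Qed.

End GorensteinInjective.

(** * Closure of Gorenstein injective modules under extensions, summands and cokernels *)

Section GIClosure.
Variable R : comNzRingType.
Implicit Types (U V W A B C D E G K N Y : lmodType R).
Local Notation GI := (@gorenstein_injective R).

Lemma GI_iso A B (f : {linear A -> B}) : bijective f -> GI B -> GI A.
Proof.
move=> fB [I [Iinj Iac IH [i [phi phiB]]]]; exists I; split=> //.
by exists i, (lcomp phi f); apply: bij_comp.
Qed.

Lemma ses_id A (T : lmodType R) (z : {linear A -> T}) : (forall t : T, t = 0) ->
  ses (idfun : {linear A -> A}) z.
Proof.
move=> T0; split=> [|y|t]; first by move=> x y.
  by split=> [_|_]; [exists y|apply: T0].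
by exists 0; rewrite raddf0; apply: esym; apply: T0.
Qed.

Lemma id_ses A (T : lmodType R) (z : {linear T -> A}) : (forall t : T, t = 0) ->
  ses z (idfun : {linear A -> A}).
Proof.
move=> T0; split=> [|y|t]; first by move=> x y _; rewrite (T0 x) (T0 y).
  by split=> [y0|[x <-]]; [exists 0; rewrite raddf0; apply: esym|rewrite (T0 x) raddf0].
by exists t.
Qed.

Lemma module0_eq (x : module0 R) : x = 0.
Proof. by apply/matrixP => i []. Qed.

Lemma injective_module_trivial (T : lmodType R) : (forall t : T, t = 0) -> injective_module T.
Proof.
by move=> T0 A B f g _; exists \0 => x; rewrite (T0 (g x)).
Qed.

Lemma injective_ext1v E : injective_module E -> ext1v E.
Proof.
move=> Einj Y C f g s D Dinj h; have [fI fg gS] := s.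
have [r rP] := Einj _ _ f idfun fI.
have [t tP] : exists t : {linear C -> Y}, forall y, t (g y) = y - f (r y).
  have [t tP] := @desc R _ _ _ g (lsubf idfun (lcomp f r)) gS
    (fun y gy => ltac:(by have /fg[x <-] := gy; rewrite /= rP subrr)).
  by exists t => y; rewrite tP.
exists (lcomp t h) => e /=; have [y yE] := gS (h e).
by rewrite -yE tP raddfB /= (ses_gf _ s) subr0.
Qed.

Lemma injective_GI E : injective_module E -> GI E.
Proof.
move=> Einj; have Z0 := injective_module_trivial module0_eq.
apply: (@GI_coind _ (@injective_module R)) => // {Einj} {}E Einj.
split; first exact: injective_ext1v.
  by exists (module0 R), E, \0, idfun; split=> //; apply: id_ses module0_eq.
by exists E, (module0 R), idfun, \0; split=> //; apply: ses_id module0_eq.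
Qed.

(** Given an extension [Z] of [C] by [Y], the quotient [Q = Z/A] is an extension of [C] by [B], and
    [Z] one of [Q] by [A]. Lift to [Q], then to [Z]. *)
Lemma ext1v_ext A Y B (f : {linear A -> Y}) (g : {linear Y -> B}) :
  ses f g -> ext1v A -> ext1v B -> ext1v Y.
Proof.
move=> s Ae Be Z C i p sp E Einj h; have [fI fg gS] := s; have [iI ip pS] := sp.
have jI : injective (lcomp i f) by move=> x y /iI/fI.
have [Q [q sq]] := coker_ex jI; have [_ jq qS] := sq.
have [u uP] : exists u : {linear B -> Q}, forall y, u (g y) = q (i y).
  apply: (desc (f := lcomp q i)) => //= y /fg[x <-]; exact: (ses_gf _ sq).
have [v vP] : exists v : {linear Q -> C}, forall z, v (q z) = p z.
  by apply: desc => // z /jq[x <-]; apply: (ses_gf _ sp).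
have suv : ses u v.
  split=> [|y|c].
  - apply: linear_inj => b; have [y <-] := gS b.
    by rewrite uP => /jq[x /iI <-]; rewrite (ses_gf _ s).
  - have [z <-] := qS y; rewrite vP ip; split=> [[y' <-]|[b]].
      by exists (g y').
    have [y' <-] := gS b; rewrite uP => /eqP; rewrite -subr_eq0 => /eqP yz.
    have /jq[x /= xE] : q (i y' - z) = 0 by rewrite raddfB.
    by exists (y' - f x); rewrite raddfB /= xE opprB addrC subrK.
  - by have [z <-] := pS c; exists (q z).
have [l lP] := Be _ _ _ _ suv _ Einj h.
have [t tP] := Ae _ _ _ _ sq _ Einj l.
by exists t => e; rewrite -vP tP lP.
Qed.

Lemma ext1v_summand A B : ext1v (A * B)%type -> ext1v A.
Proof.
move=> ABe Y C f g s E Einj h; have [fI fg gS] := s.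
pose f' := lpair (lcomp f (lfst A B)) (lsnd A B).
pose g' := lcomp g (lfst Y B).
have s' : ses f' g'.
  split=> [|[y b]|c].
  - by move=> [a b] [a' b'] [/= /fI -> ->].
  - rewrite /= fg; split=> [[a <-]|[[a b'] [<- _]]]; last by exists a.
    by exists (a, b).
  - by have [y <-] := gS c; exists (y, 0).
have [l lP] := ABe _ _ _ _ s' _ Einj h.
by exists (lcomp (lfst Y B) l).
Qed.

Lemma injective_prod E E' : injective_module E -> injective_module E' ->
  injective_module (E * E')%type.
Proof.
move=> Ei E'i A B f g fI.
have [h hP] := Ei _ _ f (lcomp (lfst _ _) g) fI.
have [k kP] := E'i _ _ f (lcomp (lsnd _ _) g) fI.
by exists (lpair h k) => x; rewrite /= hP kP /=; case: (g x).
Qed.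

Lemma horseshoe A Y B (f : {linear A -> Y}) (g : {linear Y -> B})
    (IA CA IB CB : lmodType R) (iA : {linear A -> IA}) (pA : {linear IA -> CA})
    (iB : {linear B -> IB}) (pB : {linear IB -> CB}) :
  ses f g -> injective_module IA -> ses iA pA -> ses iB pB ->
  exists C (j : {linear Y -> (IA * IB)%type}) (p : {linear (IA * IB)%type -> C})
    (a : {linear CA -> C}) (b : {linear C -> CB}), ses j p /\ ses a b.
Proof.
move=> s IAi tA tB; have [fI fg gS] := s.
have [iAI ipA pAS] := tA; have [iBI ipB pBS] := tB.
have [v vP] := IAi _ _ f iA fI.
pose j := lpair v (lcomp iB g).
have jI : injective j.
  apply: linear_inj => y [vy /(inj0 iBI)/fg[a aE]].
  by move: vy; rewrite -aE vP => /(inj0 iAI) ->; rewrite raddf0.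
have [C [p sp]] := coker_ex jI; have [_ jp pS] := sp.
have [a aP] : exists a : {linear CA -> C}, forall e, a (pA e) = p (e, 0).
  apply: (desc (f := lcomp p (linl _ _))) => // e /ipA[x <-] /=.
  by apply/jp; exists (f x); rewrite /= vP (ses_gf _ s) raddf0.
have [b bP] : exists b : {linear C -> CB}, forall e, b (p e) = pB e.2.
  apply: (desc (f := lcomp pB (lsnd _ _))) => // e /jp[y <-] /=.
  exact: (ses_gf _ tB).
exists C, j, p, a, b; split=> //; split=> [|c|c].
- apply: linear_inj => x; have [e <-] := pAS x; rewrite aP => /jp[y [ye iy]].
  have /fg[z zE] : g y = 0 by apply: (inj0 iBI).
  by rewrite -ye -zE vP (ses_gf _ tA).
- have [[e e'] <-] := pS c; rewrite bP /=; split=> [/ipB[x xE]|[x]].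
    have [y yE] := gS x; exists (pA (e - v y)); rewrite aP.
    apply/eqP; rewrite -subr_eq0 -raddfB /=; apply/eqP/jp; exists (- y).
    by rewrite /= !raddfN /= yE xE; congr (_, _); rewrite /= ?sub0r // addrAC subrr sub0r.
  have [z <-] := pAS x; rewrite aP => /eqP; rewrite -subr_eq0 -raddfB /=.
  move=> /eqP/jp[y [_ /= yE]]; apply/ipB; exists (- g y).
  by rewrite raddfN /= yE sub0r opprK.
- by have [e <-] := pBS c; exists (p (0, e)); rewrite bP.
Qed.

(** The class of all extensions is closed under steps: to the right by the horseshoe lemma, to the
    left by its analogue for injective covers. *)
Lemma GI_ext A Y B (f : {linear A -> Y}) (g : {linear Y -> B}) :
  ses f g -> GI A -> GI B -> GI Y.
Proof.
pose P Y := exists A B (f : {linear A -> Y}) (g : {linear Y -> B}),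
  [/\ ses f g, GI A & GI B].
move=> s0 A0 B0; apply: (@GI_coind _ P); last by exists A, B, f, g.
move=> {s0 A0 B0 f g A B}Y [A [B [f [g [s GA GB]]]]].
have [Ae [KA [EA [fA [gA [EAi GKA sA]]]]] [IA [CA [iA [pA [IAi GCA tA]]]]]] :=
  GI_gclass GA.
have [Be [KB [EB [fB [gB [EBi GKB sB]]]]] [IB [CB [iB [pB [IBi GCB tB]]]]]] :=
  GI_gclass GB.
have [fI fg gS] := s; split; first exact: ext1v_ext s Ae Be.
- have [fAI fgA gAS] := sA; have [fBI fgB gBS] := sB.
  (* The cover of [B] need not be projective; it lifts to [Y] because [Ext^1(EB,A) = 0]. *)
  have [u uP] := Ae _ _ _ _ s _ EBi gB.
  pose q := lcopair (lcomp f gA) u.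
  have qS : surj q.
    move=> y; have [b bE] := gBS (g y).
    have /fg[a aE] : g (y - u b) = 0 by rewrite raddfB /= uP bE subrr.
    have [e eE] := gAS a; exists (e, b).
    by rewrite /= eE aE subrK.
  have [K [k sk]] := ker_ex qS; have [kI kq _] := sk.
  have gq x : g (q x) = gB x.2 by rewrite raddfD /= (ses_gf _ s) uP add0r.
  have [v vP] : exists v : {linear K -> KB}, forall x, fB (v x) = (k x).2.
    apply: (factor (f := lcomp (lsnd _ _) k)) => // x; apply/fgB.
    by rewrite /= -gq (ses_gf _ sk) raddf0.
  have [w wP] : exists w : {linear KA -> K}, forall x, k (w x) = (fA x, 0).
    apply: (factor (f := lcomp (linl _ _) fA)) => // x; apply/kq.
    by rewrite /= (ses_gf _ sA) !raddf0 addr0.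
  exists K, (EA * EB)%type, k, q; split=> //; first exact: injective_prod.
  exists KA, KB, w, v; split=> //; split=> [||b].
  - apply: linear_inj => x wx; have := wP x; rewrite wx raddf0.
    by case=> /esym/(inj0 fAI).
  - move=> y; split=> [vy|[x <-]]; last by apply: fBI; rewrite vP wP raddf0.
    have y2 : (k y).2 = 0 by rewrite -vP vy raddf0.
    have y1 : gA (k y).1 = 0.
      apply: fI; rewrite raddf0; have /= := ses_gf y sk.
      by rewrite y2 raddf0 addr0.
    have /fgA[x xE] := y1; exists x; apply: kI.
    by rewrite wP xE -y2; case: (k y).
  - have /fg[a aE] : g (u (fB b)) = 0 by rewrite uP (ses_gf _ sB).
    have [e eE] := gAS a.
    have /kq[x xE] : q (- e, fB b) = 0 by rewrite /= !raddfN /= eE aE addNr.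
    by exists x; apply: fBI; rewrite vP xE.
- have [C [j [p [a [b [sj sab]]]]]] := horseshoe s IAi tA tB.
  exists (IA * IB)%type, C, j, p; split=> //; first exact: injective_prod.
  by exists CA, CB, a, b.
Qed.

Lemma GI_prod A B : GI A -> GI B -> GI (A * B)%type.
Proof.
apply: (@GI_ext _ _ _ (linl A B) (lsnd A B)); split.
- by move=> x y [].
- by move=> [a b]; split=> [/= ->|[x <-] //]; exists a.
- by move=> b; exists (0, b).
Qed.

(* If [K] is the kernel of an injective cover of a summand [A] of a Gorenstein
   injective module, then [K * A] is again Gorenstein injective; dually for
   cokernels. *)
Lemma GI_summand A B : GI (A * B)%type -> GI A.
Proof.
pose P A := exists B, GI (A * B)%type.
move=> GAB; apply: (@GI_coind_upto _ P); last by exists B.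
move=> {GAB A B}A [B GAB].
have [Ge [K [E [f [g [Ei GK sK]]]]] [I [C [i [p [Ii GC sC]]]]]] := GI_gclass GAB.
split; first exact: ext1v_summand Ge.
- have [fI fg gS] := sK.
  have [|KA [k sk]] := @ker_ex R E A (lcomp (lfst _ _) g).
    by move=> a; have [e eE] := gS (a, 0); exists e; rewrite /= eE.
  have [kI kg _] := sk.
  exists KA, E, k, (lcomp (lfst _ _) g); split=> //; left; exists A.
  have [u uP] : exists u : {linear K -> KA}, forall x, k (u x) = f x.
    by apply: factor => // x; apply/kg; rewrite /= (ses_gf _ sK).
  apply: (@GI_ext K _ (A * B)%type (lcomp (linl _ _) u)
            (lpair (lsnd KA A) (lcomp (lcomp (lsnd _ _) g) (lcomp k (lfst KA A))))) => //.
  split=> [||[a b]].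
  - by apply: linear_inj => x [ux]; apply: (inj0 fI); rewrite -uP ux raddf0.
  - move=> [y a]; split=> [[/= -> gy]|[x [<- <-]]]; last first.
      by rewrite /= uP (ses_gf _ sK).
    have /fg[x xE] : g (k y) = 0.
      have /= := ses_gf y sk; by case: (g (k y)) gy => ? ? /= -> ->.
    by exists x; congr (_, _); apply: kI; rewrite uP.
  - have [e eE] := gS (0, b); have /kg[y yE] : lcomp (lfst _ _) g e = 0 by rewrite /= eE.
    by exists (y, a); rewrite /= yE eE.
- have [iI ip pS] := sC.
  have jI : injective (lcomp i (linl A B)) by move=> x y /iI[].
  have [CA [q sq]] := coker_ex jI; have [_ jq qS] := sq.
  exists I, CA, (lcomp i (linl A B)), q; split=> //; left; exists A.
  have [u uP] : exists u : {linear CA -> C}, forall x, u (q x) = p x.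
    by apply: desc => // x /jq[a <-]; apply: (ses_gf _ sC).
  apply: (@GI_ext (A * B)%type _ C
    (lpair (lcomp q (lcomp i (lcomp (linr A B) (lsnd _ _)))) (lfst A B))
    (lcomp u (lfst CA A))) => //.
  split=> [|[c a]|c].
  - by apply: linear_inj => -[a b] [/= /jq[a' /iI[_ <-]] ->].
  - have [e <-] := qS c; rewrite /= uP ip; split=> [[[a' b] abE]|[[a' b] [/= qb _]]].
      exists (a, b); congr (_, _) => /=; rewrite -abE.
      apply/eqP; rewrite -subr_eq0 -!raddfB /=; apply/eqP/jq; exists (- a').
      by congr (i (_, _)); rewrite /= ?sub0r ?subrr.
    have /jq[z zE] : q (e - i (0, b)) = 0 by rewrite raddfB /= qb subrr.
    exists (z, b); rewrite -[e](subrK (i (0, b))) -zE /= -raddfD /=.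
    by congr (i (_, _)); rewrite /= ?addr0 ?add0r.
  - by have [e <-] := pS c; exists (q e, 0); rewrite /= uP.
Qed.

Lemma retract_split A G (i : {linear A -> G}) (r : {linear G -> A}) :
  cancel i r -> exists B (f : {linear (A * B)%type -> G}), bijective f.
Proof.
move=> iK; have [B [k sk]] := ker_ex (fun a => ex_intro _ (i a) (iK a)).
have [kI kr _] := sk; exists B, (lcopair i k); apply: bij_surj.
  apply: linear_inj => -[a b] /= ab0.
  have := congr1 r ab0; rewrite raddfD /= iK (ses_gf _ sk) addr0 raddf0 => a0.
  by move: ab0; rewrite a0 raddf0 add0r => /(inj0 kI) ->.
move=> g; have /kr[b bE] : r (g - i (r g)) = 0 by rewrite raddfB /= iK subrr.
by exists (r g, b); rewrite /= bE addrC subrK.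
Qed.

Lemma GI_retract A G (i : {linear A -> G}) (r : {linear G -> A}) :
  cancel i r -> GI G -> GI A.
Proof.
move=> iK GG; have [B [f fB]] := retract_split iK.
by apply: (@GI_summand _ B); apply: GI_iso fB GG.
Qed.

(* The pushout of [B] along an injective envelope of [A] is an extension of
   Gorenstein injectives, and [C] is a summand of it. *)
Lemma GI_coker A B C (f : {linear A -> B}) (g : {linear B -> C}) :
  ses f g -> GI A -> GI B -> GI C.
Proof.
move=> s GA GB; have [fI fg gS] := s.
have [_ _ [E [D [i [p [Ei GD sD]]]]]] := GI_gclass GA.
have [v vP] := Ei _ _ f i fI; have [iI ip pS] := sD.
have GY : GI (C * E)%type.
  have [u uP] : exists u : {linear C -> D}, forall b, u (g b) = p (v b).
    apply: (desc (f := lcomp p v)) => // b /fg[a <-] /=.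
    by rewrite vP (ses_gf _ sD).
  apply: (@GI_ext B _ D (lpair g v) (lsubf (lcomp p (lsnd _ _)) (lcomp u (lfst _ _)))) => //.
  split=> [||d].
  - apply: linear_inj => b [/fg[a <-]]; rewrite vP => /(inj0 iI) ->.
    by rewrite raddf0.
  - move=> [c e]; have [b <-] := gS c; rewrite /= uP -raddfB /= ip.
    split=> [[a aE]|[b' [gb <-]]].
      exists (b + f a); rewrite /= !raddfD /= (ses_gf _ s) addr0 vP aE.
      by rewrite addrC subrK.
    have /fg[a aE] : g (b' - b) = 0 by rewrite raddfB /= gb subrr.
    by exists a; rewrite -vP aE raddfB.
  - by have [e <-] := pS d; exists (0, e); rewrite /= !raddf0 addr0.
exact: GI_summand GY.
Qed.

End GIClosure.

(** * Gorenstein injective dimension *)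

Section GorensteinInjectiveDimension.
Variable R : comNzRingType.
Implicit Types (U V W A B C D E G I K N Q Y : lmodType R).
Local Notation GI := (@gorenstein_injective R).

(* [idg n N]: the [n]th cosyzygy of [N] in some injective resolution is
   Gorenstein injective. *)
Fixpoint idg (n : nat) N : Prop :=
  if n is n'.+1 then rstep (idg n') N else GI N.

Lemma ses_isol A A' B C (h : {linear A' -> A}) (f : {linear A -> B})
    (g : {linear B -> C}) : bijective h -> ses f g -> ses (lcomp f h) g.
Proof.
move=> hB [fI fg gS]; split=> // [|y].
  by move=> x y /fI/(bij_inj hB).
rewrite fg; split=> [[x <-]|[x <-]]; last by exists (h x).
by case: hB => k _ kK; exists (k x); rewrite /= kK.
Qed.

Lemma ses_prod A B C A' B' C' (f : {linear A -> B}) (g : {linear B -> C})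
    (f' : {linear A' -> B'}) (g' : {linear B' -> C'}) :
  ses f g -> ses f' g' ->
  ses (lpair (lcomp f (lfst A A')) (lcomp f' (lsnd A A')))
      (lpair (lcomp g (lfst B B')) (lcomp g' (lsnd B B'))).
Proof.
move=> s s'; have [fI fg gS] := s; have [f'I f'g' g'S] := s'; split.
- by move=> [x y] [x' y'] [/= /fI -> /f'I ->].
- move=> [y y']; split=> /= [[/fg[x <-] /f'g'[x' <-]]|[[x x'] [<- <-]]].
    by exists (x, x').
  by rewrite (ses_gf _ s) (ses_gf _ s').
- by move=> [z z']; have [y <-] := gS z; have [y' <-] := g'S z'; exists (y, y').
Qed.

Lemma idg_iso n A B (h : {linear A -> B}) : bijective h -> idg n B -> idg n A.
Proof.
case: n => [|n] hB; first exact: GI_iso hB.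
by move=> [I [V [f [g [Ii Vn s]]]]]; exists I, V, (lcomp f h), g; split=> //; apply: ses_isol.
Qed.

Lemma idg_prod n A B : idg n A -> idg n B -> idg n (A * B)%type.
Proof.
elim: n A B => [|n IHn] A B; first exact: GI_prod.
move=> [I [V [f [g [Ii Vn s]]]]] [I' [V' [f' [g' [I'i V'n s']]]]].
exists (I * I')%type, (V * V')%type, (lpair (lcomp f (lfst A B)) (lcomp f' (lsnd A B))).
exists (lpair (lcomp g (lfst I I')) (lcomp g' (lsnd I I'))).
by split; [apply: injective_prod|apply: IHn|apply: ses_prod].
Qed.

Lemma idg_ext n A Y B (f : {linear A -> Y}) (g : {linear Y -> B}) :
  ses f g -> idg n A -> idg n B -> idg n Y.
Proof.
elim: n A Y B f g => [|n IHn] A Y B f g s; first exact: GI_ext s.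
move=> [IA [CA [iA [pA [IAi An sA]]]]] [IB [CB [iB [pB [IBi Bn sB]]]]].
have [C [j [p [a [b [sj sab]]]]]] := horseshoe s IAi sA sB.
exists (IA * IB)%type, C, j, p; split=> //; first exact: injective_prod.
exact: IHn sab An Bn.
Qed.

Lemma injective_idg n E : injective_module E -> idg n E.
Proof.
elim: n E => [|n IHn] E Ei; first exact: injective_GI.
exists E, (module0 R), idfun, \0; split=> //; last exact: ses_id (@module0_eq R).
by apply/IHn/injective_module_trivial/module0_eq.
Qed.

Lemma idgS n N : idg n N -> idg n.+1 N.
Proof.
elim: n N => [|n IHn] N; first by move=> /GI_gclass[].
by move=> [I [V [f [g [Ii Vn s]]]]]; exists I, V, f, g; split=> //; apply: IHn.
Qed.

Lemma idgW n n' N : (n <= n')%N -> idg n N -> idg n' N.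
Proof. by move=> /subnK <-; elim: (n' - n)%N => // k IHk /IHk/idgS. Qed.

Lemma injective_split A B C (f : {linear A -> B}) (g : {linear B -> C}) :
  injective_module A -> ses f g ->
  exists (r : {linear B -> A}) (s : {linear C -> B}),
    [/\ cancel f r, cancel s g & forall b, b = f (r b) + s (g b)].
Proof.
move=> Ai s; have [fI fg gS] := s; have [r rP] := Ai _ _ f idfun fI.
have [t tP] : exists t : {linear C -> B}, forall y, t (g y) = y - f (r y).
  have [t tP] := @desc R _ _ _ g (lsubf idfun (lcomp f r)) gS
    (fun y gy => ltac:(by have /fg[x <-] := gy; rewrite /= rP subrr)).
  by exists t => y; rewrite tP.
exists r, t; split=> [x|c|b]; first by rewrite rP.
  by have [b <-] := gS c; rewrite tP raddfB /= (ses_gf _ s) subr0.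
by rewrite tP addrC subrK.
Qed.

Lemma idg_split n A B C (f : {linear A -> B}) (g : {linear B -> C}) :
  injective_module A -> ses f g -> idg n C -> idg n B.
Proof.
move=> Ai s Cn; have [r [t [rK tK rt]]] := injective_split Ai s.
apply: (@idg_iso n _ _ (lpair r g)); last by apply: idg_prod => //; apply: injective_idg.
apply: bij_surj => [|[a c]].
  by apply: linear_inj => b [rb gb]; rewrite [b]rt rb gb !raddf0 addr0.
exists (f a + t c) => /=; rewrite !raddfD /= rK tK (ses_gf _ s) add0r.
have E := rt (t c); rewrite tK in E; have [fI _ _] := s.
have -> : r (t c) = 0.
  by apply: (inj0 fI); apply: (addIr (t c)); rewrite add0r -E.
by rewrite addr0.
Qed.

(** The pushout of [f] and [-f']: the kernel of [p] consists of the pairs [(f a, f' a)] without a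
    sign, so the two composites from [A] differ by a sign. *)
Lemma pushout_ses A B C B' (f : {linear A -> B}) (g : {linear B -> C})
    (f' : {linear A -> B'}) : ses f g ->
  exists Q (p : {linear (B * B')%type -> Q}) (i : {linear B' -> Q})
      (q : {linear Q -> C}),
    [/\ surj p, forall x y, p (x, y) = 0 <-> exists a, f a = x /\ f' a = y,
        ses i q, forall y, i y = p (0, y) & forall x y, q (p (x, y)) = g x].
Proof.
move=> s; have [fI fg gS] := s.
have jI : injective (lpair f f') by move=> x y [/fI].
have [Q [p [_ jp pS]]] := coker_ex jI.
have pP x y : p (x, y) = 0 <-> exists a, f a = x /\ f' a = y.
  by rewrite jp; split=> [[a [<- <-]]|[a [<- <-]]]; exists a.
have [q qP] : exists q : {linear Q -> C}, forall z, q (p z) = g z.1.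
  apply: (desc (f := lcomp g (lfst B B'))) => // -[x y] /pP[a [<- _]] /=.
  exact: (ses_gf _ s).
exists Q, p, (lcomp p (linr B B')), q.
split=> [//|//||//|x y]; last by rewrite qP.
split=> [|z|c].
- by apply: linear_inj => y /pP[a [/(inj0 fI) -> <-]]; rewrite raddf0.
- have [[x y] <-] := pS z; rewrite qP /=; split=> [/fg[a aE]|[y' yE]].
    exists (y - f' a); apply/eqP; rewrite -subr_eq0 -raddfB; apply/eqP/pP.
    by exists (- a); rewrite !raddfN /= aE sub0r addrAC subrr sub0r.
  have /pP[a [xE _]] : p (x, y - y') = 0.
    by rewrite -[RHS](subrr (p (x, y))) -{2}yE -raddfB /=; congr (p (_, _)); rewrite subr0.
  by rewrite -xE (ses_gf _ s).
- by have [x <-] := gS c; exists (p (x, 0)); rewrite qP.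
Qed.

(** The property of being a retract passes to cosyzygies. The pushout [Q] of the cosyzygy sequence
    of [G] along [f i r] is an extension of [V] by the injective [I], hence a product. The cokernel
    [VA] of [A -> I] is a retract of [Q] by the diagonal [y |-> (y, y)] and the second
    projection. *)
Lemma idg_retract n A G (i : {linear A -> G}) (r : {linear G -> A}) :
  cancel i r -> idg n G -> idg n A.
Proof.
elim: n A G i r => [|n IHn] A G i r iK; first exact: GI_retract iK.
move=> [I [V [f [g [Ii Vn s]]]]]; have [fI fg gS] := s.
have fiI : injective (lcomp f i) by move=> x y /fI/(can_inj iK).
have [VA [q sq]] := coker_ex fiI; have [_ qP qS] := sq.
exists I, VA, (lcomp f i), q; split=> //.
have [Q [p [j [h [pS pP sj jE hE]]]]] := pushout_ses (lcomp f (lcomp i r)) s.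
have Qn : idg n Q := idg_split Ii sj Vn.
have [u uP] : exists u : {linear Q -> VA}, forall z, u (p z) = q z.2.
  apply: (desc (f := lcomp q (lsnd I I))) => // -[x y] /pP[a [_ <-]] /=.
  by apply/qP; exists (r a).
have [v vP] : exists v : {linear VA -> Q}, forall y, v (q y) = p (y, y).
  apply: (desc (f := lcomp p (lpair idfun idfun))) => // _ /qP[a <-] /=.
  by apply/pP; exists (i a); rewrite /= iK.
apply: (IHn _ _ v u) Qn => y; have [x <-] := qS y.
by rewrite vP uP.
Qed.

(** [V] is an [n]th cosyzygy of [N]. The recursion removes the last step, whereas that of [idg]
    removes the first: Bass' formula works back from the last cosyzygy. *)
Fixpoint reso (n : nat) N V : Prop :=
  if n is n'.+1 then
    exists W I (f : {linear W -> I}) (g : {linear I -> V}),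
      [/\ injective_module I, reso n' N W & ses f g]
  else exists f : {linear N -> V}, bijective f.

Lemma idg_reso n N W k : reso k N W -> idg n W ->
  exists V, reso (k + n) N V /\ GI V.
Proof.
elim: n W k => [|n IHn] W k NW; first by exists W; rewrite addn0.
move=> [I [V [f [g [Ii Vn s]]]]]; rewrite addnS -addSn; apply: IHn Vn.
by exists W, I, f, g.
Qed.

Lemma reso_idg n N V k : reso n N V -> idg k V -> idg (n + k) N.
Proof.
elim: n V k => [|n IHn] V k; first by move=> [f fB]; apply: idg_iso fB.
move=> [W [I [f [g [Ii NW s]]]]] Vk; rewrite addSnnS; apply: IHn NW _.
by exists I, V, f, g.
Qed.

Fixpoint gid_le (n : nat) N : Prop :=
  if n is n'.+1 then
    exists C N' (f : {linear N -> C}) (g : {linear C -> N'}),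
      [/\ GI C, gid_le n' N' & ses f g]
  else GI N.

(** Let [D] be the first term of a coresolution of [A]. The pushout [Q'] of [B] and [D] under [A] is
    an extension of [C] by [D], hence Gorenstein injective, and [B -> Q'] has the same cokernel [N']
    as [A -> D]. *)
Lemma gid_le_ext n A B C (f : {linear A -> B}) (g : {linear B -> C}) :
  ses f g -> gid_le n A -> GI C -> gid_le n B.
Proof.
case: n => [|n] s; first exact: GI_ext s.
move=> [D [N' [i [p [GD N'n si]]]]] GC; have [fI fg gS] := s; have [iI ip pS] := si.
have [Q [h [j [q [hS hP sj jE qE]]]]] := pushout_ses f si.
have [Q' [h' [j' [q' [h'S h'P sj' j'E q'E]]]]] := pushout_ses i s.
exists Q', N'.
have s1 : injective (lcomp h' (linl B D)).
  by apply: linear_inj => b /h'P[a [<- /(inj0 iI) ->]]; rewrite raddf0.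
have [u uP] : exists u : {linear Q' -> N'}, forall z, u (h' z) = p z.2.
  apply: (desc (f := lcomp p (lsnd B D))) => // -[x y] /h'P[a [_ <-]] /=.
  exact: (ses_gf _ si).
exists (lcomp h' (linl B D)), u; split=> //; first exact: GI_ext sj' GD GC.
split=> // [z|c].
  have [[b d] <-] := h'S z; rewrite uP /= ip; split=> [[a aE]|[b' b'E]].
    exists (b - f a); apply/eqP; rewrite -subr_eq0 -raddfB; apply/eqP/h'P.
    by exists (- a); rewrite !raddfN /= aE sub0r addrAC subrr sub0r.
  have /h'P[a [_ aE]] : h' (b' - b, - d) = 0.
    by rewrite -[RHS](subrr (h' (b, d))) -{1}b'E -raddfB /=; congr (h' (_, _)); rewrite sub0r.
  by exists (- a); rewrite raddfN /= aE opprK.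
by have [d <-] := pS c; exists (h' (0, d)); rewrite uP.
Qed.

(** The first term [C] is embedded in an injective [I] with Gorenstein injective cokernel [D]. The
    cokernel of [N -> I] is then an extension of [D] by [N'], to which [gid_le_ext] applies. *)
Lemma gid_le_idg n N : gid_le n N -> idg n N.
Proof.
elim: n N => [//|n IHn] N [C [N' [f [g [GC N'n s]]]]].
have [_ _ [I [D [i [p [Ii GD si]]]]]] := GI_gclass GC.
have [fI fg gS] := s; have [iI ip pS] := si.
have [|V [q sq]] := @coker_ex R _ _ (lcomp i f); first by move=> x y /iI/fI.
have [_ qP qS] := sq; exists I, V, (lcomp i f), q; split=> //.
apply: IHn.
have [u uP] : exists u : {linear N' -> V}, forall c, u (g c) = q (i c).
  by apply: (desc (f := lcomp q i)) => // _ /fg[x <-]; apply: (ses_gf _ sq).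
have [v vP] : exists v : {linear V -> D}, forall x, v (q x) = p x.
  by apply: desc => // _ /qP[x <-]; apply: (ses_gf _ si).
apply: (@gid_le_ext n _ _ _ u v) => //; split=> [|y|d].
- apply: linear_inj => b; have [c <-] := gS b; rewrite uP => /qP[x /iI <-].
  exact: (ses_gf _ s).
- have [x <-] := qS y; rewrite vP ip; split=> [[c <-]|[b]]; first by exists (g c).
  have [c <-] := gS b; rewrite uP => /eqP; rewrite -subr_eq0 -raddfB.
  move=> /eqP/qP[a /= aE]; exists (c - f a).
  by rewrite raddfB /= aE opprB addrC subrK.
- by have [x <-] := pS d; exists (q x).
Qed.

Lemma coresolution_gid_le n N : GI_coresolution N n -> gid_le n N.
Proof.
elim: n N => [|n IHn] N [C [e [d [CG C0 eI eP dP]]]].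
  apply: (@GI_iso _ _ _ e); last exact: CG.
  by apply: bij_surj => // x; apply/eP; apply: C0.
have [|N' [k [kI kP]]] := @sub_ex R _ (fun y => d 1%N y = 0).
  split=> [|a x y dx dy]; first exact: raddf0.
  by rewrite linearP dx dy scaler0 addr0.
have [g gP] : exists g : {linear C 0%N -> N'}, forall x, k (g x) = d 0%N x.
  by apply: factor => // x; apply/kP/dP; exists x.
exists (C 0%N), N', e, g; split; first exact: CG.
  apply: IHn; exists (fun i => C i.+1), k, (fun i => d i.+1); split=> [i ni|i ni x|//|//|//].
    exact: CG.
  exact: C0.
split=> // [x|y]; first rewrite -eP -gP.
  by split=> [->|/(inj0 kI) //]; rewrite raddf0.
have /dP[x xE] : d 1%N (k y) = 0 by apply/kP; exists y.
by exists x; apply: kI; rewrite gP.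
Qed.

End GorensteinInjectiveDimension.

(** * Noetherian rings and regular sequences *)

Section CommutativeAlgebra.
Variable R : comNzRingType.
Implicit Types (U V W A B C D E G I K N Q X Y T F : lmodType R).
Implicit Types (J p : R^o -> Prop).

(** Baer's criterion. Maps from ideals to [E] are given by their graphs in [R x E], and Zorn's lemma
    is applied to graphs in [B x E]. *)
Lemma baer E :
  (forall G : R^o -> E -> Prop, linrel G -> (forall v, G 0 v -> v = 0) ->
     exists e, forall x v, G x v -> v = x *: e) ->
  injective_module E.
Proof.
move=> HE A B f g fI.
pose good (S : classical_sets.set (B * E)) := [/\ forall a, S (f a, g a),
  linrel (fun b v => S (b, v)) & forall v, S (0, v) -> v = 0].
(* Only inhabited graphs are required to be good, so that the union of the empty chain qualifies. A
   maximal graph is inhabited because [G0] is. *)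
pose P (S : classical_sets.set (B * E)) := forall q, S q -> good S.
pose G0 : classical_sets.set (B * E) := fun q => exists a, q = (f a, g a).
have G0good : good G0.
  split=> [a||v [a [/esym/(inj0 fI) -> ->]]]; [by exists a| |exact: raddf0].
  split; first by exists 0; rewrite !raddf0.
  by move=> a _ _ _ _ [x [-> ->]] [y [-> ->]]; exists (a *: x + y); rewrite !linearP.
have [S [PS Smax]] : exists S, P S /\ forall S', classical_sets.proper S S' -> ~ P S'.
  apply: classical_sets.Zorn_bigcup => Fs FP Ftot q [X FX Xq].
  have Xg := FP X FX q Xq; have [X1 [X2 X3] X4] := Xg; split.
  - by move=> a; exists X.
  - split=> [|a x y u v [X' FX' X'x] [Y FY Yy]]; first by exists X.
    have [XY|YX] := Ftot _ _ FX' FY.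
      by exists Y => //; have [_ [_ H] _] := FP _ FY _ Yy; apply: H => //; apply: XY.
    by exists X' => //; have [_ [_ H] _] := FP _ FX' _ X'x; apply: H => //; apply: YX.
  - by move=> v [Y FY Yv]; have [_ _] := FP _ FY _ Yv; apply.
have [S1 S2 S3] : good S.
  have [[q Sq]|S0] := pselect (exists q, S q); first exact: PS q Sq.
  exfalso; apply: (Smax G0); last by move=> q _.
  split=> [q Sq|G0S]; first by case: S0; exists q.
  by apply: S0; exists (f 0, g 0); apply: G0S; exists 0.
have Stot z : exists v, S (z, v).
  apply: contrapT => zS.
  have [||e eP] := HE (fun r v => S (r *: z, v)).
  - split=> [|a x y u v Sx Sy]; first by rewrite scale0r; case: S2.
    by rewrite scalerDl -scalerA; apply: (proj2 S2).
  - by move=> v; rewrite scale0r; apply: S3.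
  pose S' : classical_sets.set (B * E) := fun q => exists b v r,
    S (b, v) /\ q = (b + r *: z, v + r *: e).
  have SS' : classical_sets.subset S S'.
    by move=> [b v] Sb; exists b, v, 0; rewrite !scale0r !addr0.
  apply: (Smax S').
    split=> // S'S; apply: zS; exists e; apply: S'S; exists 0, 0, 1.
    by rewrite !add0r !scale1r; split=> //; case: S2.
  move=> _ _; split.
  - by move=> a; apply: SS'.
  - split; first by apply: SS'; case: S2.
    move=> a x y u v [b [w [r [Sb [-> ->]]]]] [b' [w' [r' [Sb' [-> ->]]]]].
    exists (a *: b + b'), (a *: w + w'), (a * r + r'); split; first exact: (proj2 S2).
    by congr (_, _); rewrite [in LHS]scalerDr addrACA scalerDl -scalerA.
  - move=> v [b [w [r [Sb [/eqP]]]]]; rewrite eq_sym addr_eq0 => /eqP bE ->.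
    suff -> : w = - (r *: e) by rewrite addNr.
    rewrite -scaleNr; apply: eP; by rewrite scaleNr -bE.
have [h hP] := linrel_fun S2 Stot S3.
by exists h => x; apply/hP.
Qed.

Lemma idealM J a x : lsub J -> J x -> J (a * x).
Proof. by move=> JS; apply: lsubZ. Qed.

(** Multiplication by [y] embeds [R/(J:y)] in [R/J], and the map [R/(J:y) -> E] with value [e] at 1
    extends to [R/J]. *)
Lemma inj_div E (J : R^o -> Prop) (y : R) (e : E) : injective_module E -> lsub J ->
  (forall r, J (r * y) -> r *: e = 0) ->
  exists e1, (forall x, J x -> x *: e1 = 0) /\ y *: e1 = e.
Proof.
move=> Ei JS Jy.
pose G (x : R^o) v := exists r i, [/\ J i, x = r * y + i & v = r *: e].
have [||h hP] := @inj_rel R E R^o G Ei.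
- split=> [|a _ _ _ _ [r [i [Ji -> ->]]] [r' [i' [Ji' -> ->]]]].
    by exists 0, 0; rewrite mul0r addr0 scale0r; split=> //; case: JS.
  exists (a * r + r'), (a *: i + i'); split; first exact: (proj2 JS).
    by rewrite scalerDr mulrDl addrACA -mulrA.
  by rewrite scalerDl scalerA.
- move=> _ [r [i [Ji ri ->]]]; apply: Jy.
  by rewrite -[_ * _](addrK i) -ri; apply: lsubB => //; case: JS.
have hE x : h x = x *: h 1 by rewrite -linearZ; congr (h _); rewrite [RHS]mulr1.
exists (h 1); split=> [x Jx|]; rewrite -hE; apply: hP.
  by exists 0, x; rewrite mul0r add0r scale0r.
by exists 1, 0; rewrite mul1r addr0 scale1r; split=> //; case: JS.
Qed.

(** As [A] is injective, the last hypothesis says that [Ext^1(R/J,X) = 0] for every ideal [J]. *)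
Lemma baer_ker X A B (i : {linear X -> A}) (q : {linear A -> B}) :
  injective_module A -> ses i q ->
  (forall J b, lsub J -> (forall r, J r -> r *: b = 0) ->
     exists a, (forall r, J r -> r *: a = 0) /\ q a = b) ->
  injective_module X.
Proof.
move=> Ai s HJ; have [iI iq qS] := s; apply: baer => G GL G0.
have [||h hP] := @inj_rel R A R^o (fun r a => exists2 v, G r v & a = i v) Ai.
- split=> [|a x y _ _ [u Gu ->] [v Gv ->]].
    by exists 0; rewrite ?raddf0 //; case: GL.
  by exists (a *: u + v); rewrite ?linearP //; apply: (proj2 GL).
- by move=> _ [v /G0 -> ->]; rewrite raddf0.
have hE x : h x = x *: h 1 by rewrite -linearZ; congr (h _); rewrite [RHS]mulr1.
have [||a [Ja qa]] := HJ (fun r => exists v, G r v) (q (h 1)).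
- split=> [|a x y [u Gu] [v Gv]]; first by exists 0; case: GL.
  by exists (a *: u + v); apply: (proj2 GL).
- move=> r [v Gv]; rewrite -linearZ -hE (hP _ (i v)); last by exists v.
  exact: ses_gf s.
have /iq[e eE] : q (h 1 - a) = 0 by rewrite raddfB /= qa subrr.
exists e => x v Gv; apply: iI; rewrite linearZ /= eE scalerBr -hE.
by rewrite (Ja x) ?subr0; [apply/esym/hP; exists v|exists v].
Qed.

Fixpoint lspan V (s : seq V) (v : V) : Prop :=
  if s is g :: s' then exists a w, lspan s' w /\ v = a *: g + w else v = 0.

Lemma lspan_lsub V (s : seq V) : lsub (lspan s).
Proof.
elim: s => [|g s [IH0 IHD]]; first by split=> // a x y /= -> ->; rewrite scaler0 addr0.
split=> [|a _ _ [b [w [sw ->]]] [c [u [su ->]]]].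
  by exists 0, 0; rewrite scale0r addr0.
exists (a * b + c), (a *: w + u); rewrite scalerDr scalerDl scalerA addrACA.
by split=> //; apply: IHD.
Qed.

Lemma lspan_mem V (s : seq V) v : v \in s -> lspan s v.
Proof.
elim: s => // g s IHs; rewrite inE => /orP[/eqP ->|/IHs sv].
  by exists 1, 0; rewrite scale1r addr0; split=> //; case: (lspan_lsub s).
by exists 0, v; rewrite scale0r add0r.
Qed.

Lemma lspan_min V (s : seq V) (S : V -> Prop) : lsub S ->
  (forall v, v \in s -> S v) -> forall v, lspan s v -> S v.
Proof.
move=> SS; elim: s => [_ v -> |g s IHs Ss _ [a [w [sw ->]]]]; first by case: SS.
apply: (proj2 SS); first by apply: Ss; rewrite mem_head.
by apply: IHs sw => v vs; apply: Ss; rewrite inE vs orbT.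
Qed.

Lemma lspan_cons V g (s : seq V) v : lspan s v -> lspan (g :: s) v.
Proof. by move=> sv; exists 0, v; rewrite scale0r add0r. Qed.

Lemma lspan_map V W (f : {linear V -> W}) s v : lspan s v -> lspan (map f s) (f v).
Proof.
elim: s v => [v /= ->|g s IHs _ [a [w [sw ->]]]]; first exact: raddf0.
by exists a, (f w); rewrite linearP; split=> //; apply: IHs.
Qed.

Lemma lspan_cat V (s t : seq V) v : lspan (s ++ t) v <->
  exists u w, [/\ lspan s u, lspan t w & v = u + w].
Proof.
split=> [|[u [w [su tw ->]]]].
  elim: s v => [|g s IHs] v; first by move=> tv; exists 0, v; rewrite add0r.
  move=> [a [w [/IHs[u [x [su tx ->]]] ->]]]; exists (a *: g + u), x.
  by rewrite addrA; split=> //; exists a, u.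
apply: lsubD; first exact: lspan_lsub.
  by apply: lspan_min su; [exact: lspan_lsub|move=> x xs; apply: lspan_mem; rewrite mem_cat xs].
by apply: lspan_min tw; [exact: lspan_lsub|move=> x xs; apply: lspan_mem; rewrite mem_cat xs orbT].
Qed.

Hypothesis noeth : noetherian R.

Lemma noeth_ideal J : lsub J -> exists s : seq R^o, forall x, J x <-> lspan s x.
Proof.
move=> JS; pose T : {pred R^o} := [pred x | `[< J x >]].
have TP x : x \in T <-> J x by split=> [Tx|Jx]; apply/(asboolP (J x)).
have [|n [g gP]] := noeth (J := T).
  split=> [|a x y]; first by apply/TP; case: JS.
  by move=> /TP Jx /TP Jy; apply/TP; apply: (proj2 JS).
exists [seq (g i : R^o) | i <- enum 'I_n] => x.
rewrite -TP.
split=> [/gP[c ->]|].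
  apply: (@lsub_sum R R^o (lspan _)) => [|i]; first exact: lspan_lsub.
  apply: (lsubZ (c i) (x := (g i : R^o)) (lspan_lsub _)).
  by apply: lspan_mem; apply: map_f; rewrite mem_enum.
move=> sx; apply/TP; apply: lspan_min sx => // _ /mapP[i _ ->].
apply/TP/gP; exists (fun j => (j == i)%:R).
rewrite (bigD1 i) //= eqxx mul1r big1 ?addr0 // => j /negbTE ->.
by rewrite mul0r.
Qed.

Lemma noeth_max (Fam : (R^o -> Prop) -> Prop) J0 : Fam J0 ->
  (forall J, Fam J -> lsub J) ->
  exists J, [/\ Fam J, forall x, J0 x -> J x
    & forall J', Fam J' -> (forall x, J x -> J' x) -> forall x, J' x -> J x].
Proof.
move=> F0 FS; apply: contrapT => nomax.
pose St := {J | Fam J /\ forall x, J0 x -> J x}.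
pose lt (j k : St) := (forall x, sval j x -> sval k x) /\
  exists x, sval k x /\ ~ sval j x.
have [nx nxP] : {nx : St -> St & forall j : St, lt j (nx j)}.
  apply: choice => -[J [FJ J0J]]; apply: contrapT => H; apply: nomax.
  exists J; split=> // J' FJ' JJ' x J'x; apply: contrapT => Jx; apply: H.
  have J'P : Fam J' /\ forall x, J0 x -> J' x by split=> // z /J0J/JJ'.
  by exists (exist _ J' J'P); split=> //; exists x.
have s0P : Fam J0 /\ forall x, J0 x -> J0 x by [].
pose Jn n := iter n nx (exist _ J0 s0P).
have mono n k x : sval (Jn n) x -> sval (Jn (k + n)%N) x.
  by elim: k => // k IHk /IHk; apply: (proj1 (nxP (Jn (k + n)%N))).
pose Un x := exists n, sval (Jn n) x.
have UnS : lsub Un.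
  split=> [|a x y [n nX] [k kY]]; first by exists 0%N; case: (FS _ F0).
  exists (n + k)%N; have [_] := FS _ (proj1 (svalP (Jn (n + k)%N))); apply.
    by rewrite addnC; apply: mono.
  exact: mono.
have [s sP] := noeth_ideal UnS.
have [n nP] : exists n, forall x, x \in s -> sval (Jn n) x.
  have sU x : x \in s -> Un x by move=> xs; apply/sP/lspan_mem.
  elim: (s) sU => [|g t IHt] sU; first by exists 0%N.
  have [|n nP] := IHt; first by move=> x xt; apply: sU; rewrite inE xt orbT.
  have [|k kP] := sU g; first by rewrite mem_head.
  exists (n + k)%N => x; rewrite inE => /orP[/eqP ->|/nP]; first exact: mono.
  by rewrite addnC; apply: mono.
have [_ [x [x1 x2]]] := nxP (Jn n); apply: x2.
have /sP sx : Un x by exists n.+1.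
by apply: lspan_min sx => //; apply: FS; case: (svalP (Jn n)).
Qed.

(** The coefficients of [g] in elements of [S] form an ideal. Elements of [S] over its generators,
    together with generators of the part of [S] in the span of [s], span [S]. *)
Lemma noeth_span V (s : seq V) (S : V -> Prop) : lsub S ->
  (forall v, S v -> lspan s v) -> exists t, forall v, S v <-> lspan t v.
Proof.
elim: s S => [|g s IHs] S SS Ss.
  by exists [::] => v; split=> [/Ss //|/= ->]; case: SS.
have sS := lspan_lsub s.
have [||t tP] := IHs (fun v => S v /\ lspan s v).
- split=> [|a x y [Sx sx] [Sy sy]]; first by split; [case: SS|case: sS].
  by split; [apply: (proj2 SS)|apply: (proj2 sS)].
- by move=> v [].
have [|r rP] := @noeth_ideal (fun a => exists2 w, lspan s w & S (a *: g + w)).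
  split=> [|a x y [w sw Sw] [u su Su]].
    by exists 0; rewrite ?scale0r ?addr0; [case: sS|case: SS].
  exists (a *: w + u); first exact: (proj2 sS).
  by rewrite scalerDl -scalerA addrACA -scalerDr; apply: (proj2 SS).
have [q [qS qP]] : exists q : seq V, (forall v, v \in q -> S v) /\
    forall a, lspan r a -> exists2 w, lspan s w & lspan q (a *: g + w).
  have rS a : a \in r -> exists2 w, lspan s w & S (a *: g + w).
    by move=> ar; apply/rP/lspan_mem.
  elim: (r) rS => [|b r' IHr] rS.
    exists [::]; split=> // _ ->; exists 0; first by case: sS.
    by rewrite scale0r addr0.
  have [|q [qS qP]] := IHr; first by move=> a ar; apply: rS; rewrite inE ar orbT.
  have [|w sw Sw] := rS b; first by rewrite mem_head.
  exists ((b *: g + w) :: q); split=> [v|_ [c [d [/qP[u su qu] ->]]]].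
    by rewrite inE => /orP[/eqP ->|/qS].
  exists (c *: w + u); first exact: (proj2 sS).
  exists c, (d *: g + u); split=> //.
  by rewrite scalerDl -scalerA scalerDr addrACA.
exists (q ++ t) => v; split=> [Sv|/lspan_cat[u [w [qu /tP[Sw _] ->]]]]; last first.
  by apply: lsubD => //; apply: lspan_min qu.
have [a [w [sw vE]]] := Ss _ Sv.
have /rP/qP[u su qu] : exists2 w, lspan s w & S (a *: g + w) by exists w; rewrite -?vE.
apply/lspan_cat; exists (a *: g + u), (w - u); split=> //.
  apply/tP; split; last exact: lsubB.
  have -> : w - u = v - (a *: g + u) by rewrite vE opprD addrACA subrr add0r.
  by apply: lsubB => //; apply: lspan_min qu.
by rewrite vE addrACA subrr addr0.
Qed.

(* Prime avoidance for the finitely many maximal annihilators of the module [R/J]. *)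
Lemma regular_element J p : lsub J -> lsub p ->
  (forall t, ~ J t -> exists2 y, p y & ~ J (y * t)) ->
  exists2 x, p x & forall a, J (x * a) -> J a.
Proof.
move=> JS pS pJ; pose ann t : R^o -> Prop := fun r => J (r * t).
have annS t : lsub (ann t).
  split=> [|a x y Jx Jy]; rewrite /ann ?mul0r; first by case: JS.
  by rewrite mulrDl -mulrA; apply: (proj2 JS).
pose mx t := ~ J t /\ forall t', ~ J t' -> (forall r, ann t r -> ann t' r) ->
  forall r, ann t' r -> ann t r.
have mxP t : ~ J t -> exists2 t', mx t' & forall r, ann t r -> ann t' r.
  move=> Jt; have [||J' [[t' [Jt' ->]] tt' t'max]] :=
    @noeth_max (fun J' => exists t', ~ J t' /\ J' = ann t') (ann t).
  - by exists t.
  - by move=> _ [t' [_ ->]].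
  exists t' => //; split=> // t'' Jt''; apply: t'max.
  by exists t''.
have mx_prime t a b : mx t -> ann t (a * b) -> ann t a \/ ann t b.
  move=> [Jt tmax] tab; have [ta|ta] := pselect (ann t a); [by left|right].
  apply: (tmax (a * t)) => // [r rt|]; rewrite /ann mulrA; last by rewrite (mulrC b).
  by rewrite (mulrC r) -mulrA; apply: idealM.
have mx_eq t t' : mx t -> mx t' -> (forall r, ann t r -> ann t' r) ->
    forall r, ann t' r -> ann t r.
  by move=> [_ tmax] [Jt' _]; apply: tmax.
(* [ts] is chosen with the largest span modulo [J], so every [t] with maximal annihilator lies in
   it. If no annihilator of an element of [ts] contained that of [t], a product of ring elements
   would kill all of [ts] but not [t]. *)
have [ts [tsmx tsP]] : exists ts : seq R^o, (forall t, t \in ts -> mx t) /\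
    forall t, mx t -> exists2 t', t' \in ts & forall r, ann t r -> ann t' r.
  pose Fam J' := exists ts : seq R^o, (forall t, t \in ts -> mx t) /\
    J' = (fun x => exists2 w, lspan ts w & J (x - w)).
  have FamS J' : Fam J' -> lsub J'.
    move=> [ts [_ ->]]; split=> [|a x y [w sw Jw] [u su Ju]].
      by exists 0; rewrite ?subrr; [case: (lspan_lsub ts)|case: JS].
    exists (a *: w + u); first exact: (proj2 (lspan_lsub ts)).
    by rewrite opprD addrACA -scalerBr; apply: (proj2 JS).
  have [|J' [[ts [tsmx ->]] _ tsmax]] :=
    @noeth_max Fam (fun x => exists2 w, lspan [::] w & J (x - w)) _ FamS.
    by exists [::].
  exists ts; split=> // t tmx.
  have [] := tsmax (fun x => exists2 w, lspan (t :: ts) w & J (x - w)) _ _ t.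
  - exists (t :: ts); split=> // x; rewrite inE => /orP[/eqP -> //|]; exact: tsmx.
  - by move=> x [w sw Jw]; exists w => //; apply: lspan_cons.
  - exists t; last by rewrite subrr; case: JS.
    by apply: lspan_mem; rewrite mem_head.
  move=> w sw Jw; apply: contrapT => nts.
  have [z [zt zts]] : exists z, ~ ann t z /\ forall t', t' \in ts -> ann t' z.
    elim: (ts) nts tsmx => [|t' ts' IHts] nts mxs.
      by exists 1; split=> //; rewrite /ann mul1r; case: tmx.
    have [||z [zt zts]] := IHts.
    - by move=> [u uts tu]; apply: nts; exists u => //; rewrite inE uts orbT.
    - by move=> u uts; apply: mxs; rewrite inE uts orbT.
    have [z' [z't' z't]] : exists z', ann t' z' /\ ~ ann t z'.
      apply: contrapT => nz; apply: nts; exists t'; first by rewrite mem_head.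
      have t'mx : mx t' by apply: mxs; rewrite mem_head.
      apply: mx_eq => // r tr; apply: contrapT => ntr.
      by apply: nz; exists r.
    exists (z * z'); split; first by case/(mx_prime _ _ _ tmx).
    move=> u; rewrite inE => /orP[/eqP ->|/zts uz]; rewrite /ann.
      by rewrite -mulrA; apply: idealM.
    by rewrite mulrAC mulrC; apply: idealM.
  apply: zt; rewrite /ann; have : J (z * (t - w)) by apply: idealM.
  have zw : J (z * w).
    have zS : lsub (fun w : R^o => J (z * w)).
      split=> [|a x y Jx Jy]; first by rewrite mulr0; case: JS.
      by rewrite mulrDr [z * (a *: x)]mulrCA; apply: (proj2 JS).
    exact: (lspan_min zS zts sw).
  rewrite mulrBr => Jzw; rewrite -[z * t](subrK (z * w)).
  exact: (lsubD JS Jzw zw).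
(* Prime avoidance: when [x] fails at the next [t], add an element of [p] that avoids [ann t] and
   lies in the annihilators treated before. *)
have [x px xP] : exists2 x, p x & forall t, t \in ts -> ~ ann t x.
  elim: (ts) tsmx => [|t ts' IHts] mxs; first by exists 0; case: pS.
  have [|x px xP] := IHts; first by move=> u uts; apply: mxs; rewrite inE uts orbT.
  have tmx : mx t by apply: mxs; rewrite mem_head.
  have [tx|tx] := pselect (ann t x); last first.
    by exists x => // u; rewrite inE => /orP[/eqP ->|/xP].
  have [y [py ty yts]] : exists y, [/\ p y, ~ ann t y & forall u, u \in ts' -> ann u y].
    have : forall u, u \in ts' -> mx u /\ ~ ann u x.
      by move=> u uts; split; [apply: mxs; rewrite inE uts orbT|apply: xP].
    elim: (ts') => [|u us IHus] usP.
      have [y py Jy] := pJ t (proj1 tmx); by exists y.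
    have [|y [py ty yus]] := IHus.
      by move=> v vus; apply: usP; rewrite inE vus orbT.
    have [|umx ux] := usP u; first by rewrite mem_head.
    have [z [uz tz]] : exists z, ann u z /\ ~ ann t z.
      apply: contrapT => nz; apply: ux; apply: (mx_eq u t) => // r ur.
      by apply: contrapT => ntr; apply: nz; exists r.
    exists (z * y); split; first exact: idealM.
      by case/(mx_prime _ _ _ tmx).
    move=> v; rewrite inE => /orP[/eqP ->|/yus vy]; rewrite /ann.
      by rewrite mulrAC mulrC; apply: idealM.
    by rewrite -mulrA; apply: idealM.
  exists (x + y); first exact: lsubD.
  move=> u; rewrite inE => /orP[/eqP ->|uts].
    by move=> txy; apply: ty; rewrite -[y](addKr x) addrC; apply: lsubB.
  move=> uxy; apply: (xP u uts); rewrite -[x](addrK y).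
  by apply: lsubB => //; apply: yts.
exists x => // a xa; apply: contrapT => /mxP[t tmx at_].
have [t' t'ts tt'] := tsP _ tmx; apply: (xP _ t'ts); apply/tt'/at_; exact: xa.
Qed.

End CommutativeAlgebra.

(** * Finite generation of Hom modulo maps through injective modules *)

Section StableHom.
Variable R : comNzRingType.
Implicit Types (U V W A B C D E G I K N Q X Y T F : lmodType R).

(** Combinations are bare functions, which avoids a module structure on Hom; [hcomb_linear] restores
    linearity. *)
Fixpoint hcomb T V (hs : seq {linear T -> V}) (k : T -> V) : Prop :=
  if hs is h :: hs' then
    exists a k', hcomb hs' k' /\ forall x, k x = a *: h x + k' x
  else forall x, k x = 0.

Definition fgm T : Prop := exists s : seq T, forall v, lspan s v.

Definition projective F : Prop :=
  forall U V (q : {linear U -> V}) (f : {linear F -> V}), surj q ->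
    exists l : {linear F -> U}, forall x, q (l x) = f x.

Lemma fgm_prod A B : fgm A -> fgm B -> fgm (A * B)%type.
Proof.
move=> [s sP] [t tP]; exists (map (linl A B) s ++ map (linr A B) t) => -[a b].
apply/lspan_cat; exists (linl A B a), (linr A B b).
by split; [apply: lspan_map|apply: lspan_map|congr (_, _); rewrite /= ?addr0 ?add0r].
Qed.

Lemma rmap_linear V (g : V) : linear (fun a : R^o => a *: g).
Proof. by move=> a x y; rewrite scalerDl scalerA. Qed.
Definition rmap V (g : V) : {linear R^o -> V} := mklinear (rmap_linear g).

Lemma free_cover T (s : seq T) : exists F (p : {linear F -> T}),
  [/\ projective F, fgm F & forall v, lspan s v <-> exists x, p x = v].
Proof.
elim: s => [|g s [F [p [Fp Ff pP]]]].
  exists (module0 R), \0; split=> [U V q f _||v].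
  - by exists \0 => x; rewrite (module0_eq x) !raddf0.
  - by exists [::] => v; rewrite (module0_eq v).
  - by split=> [/= ->|[_ <-] //]; exists 0.
exists (R^o * F)%type, (lcopair (rmap g) p); split=> [U V q f qS||v].
- have [u uE] := qS (f (1, 0)).
  have [l lP] := Fp _ _ q (lcomp f (linr _ _)) qS.
  exists (lcopair (rmap u) l) => -[a x] /=.
  rewrite raddfD /= linearZ /= uE lP /= -linearZ -raddfD /=; congr (f _).
  congr (_, _); first by rewrite /= addr0 [LHS]mulr1.
  by rewrite /= scaler0 add0r.
- apply: fgm_prod => //; exists [:: (1 : R^o)] => v; exists v, 0.
  by rewrite addr0 [RHS]mulr1.
- split=> [[a [w [/pP[x <-] ->]]]|[[a x] <-]]; first by exists (a, x).
  by exists a, (p x); split=> //; apply/pP; exists x.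
Qed.

Definition fgStable W : Prop :=
  forall T, fgm T -> exists hs : seq {linear T -> W}, forall f : {linear T -> W},
    exists k E (a : {linear T -> E}) (b : {linear E -> W}),
      [/\ hcomb hs k, injective_module E & forall x, f x = k x + b (a x)].

Hypothesis noeth : noetherian R.

Lemma fgm_sub A B (i : {linear A -> B}) : injective i -> fgm B -> fgm A.
Proof.
move=> iI [s sP].
have [||t tP] := @noeth_span R noeth B s (fun y => exists x, i x = y).
- split=> [|a _ _ [x <-] [y <-]]; first by exists 0; rewrite raddf0.
  by exists (a *: x + y); rewrite linearP.
- by move=> v _; apply: sP.
have [t' t'E] : exists t' : seq A, t = map i t'.
  have : forall y, y \in t -> exists x, i x = y.
    by move=> y yt; apply/tP/lspan_mem.
  elim: (t) => [|y u IHu] uP; first by exists [::].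
  have [|u' u'E] := IHu; first by move=> z zu; apply: uP; rewrite inE zu orbT.
  have [|x xE] := uP y; first by rewrite mem_head.
  by exists (x :: u'); rewrite /= xE u'E.
exists t' => v; have /tP : exists x, i x = i v by exists v.
rewrite t'E; elim: (t') v => [|g u IHu] v /=; first by move=> /(inj0 iI).
move=> [a [w [uw vE]]]; exists a, (v - a *: g); split; last by rewrite addrC subrK.
by apply: IHu; rewrite raddfB /= linearZ /= vE addrC addKr.
Qed.

Lemma hcomb_cat T V (hs ks : seq {linear T -> V}) f k :
  hcomb hs f -> hcomb ks k -> hcomb (hs ++ ks) (fun x => f x + k x).
Proof.
elim: hs f => [f f0 kP|h hs IHhs f [a [f' [f'P fE]]] kP] /=.
  by have -> : (fun x => f x + k x) = k by apply/funext => x; rewrite f0 add0r.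
by exists a, (fun x => f' x + k x); split=> [|x]; [apply: IHhs|rewrite fE addrA].
Qed.

Lemma hcomb_linear T V (hs : seq {linear T -> V}) f : hcomb hs f -> linear f.
Proof.
elim: hs f => [f f0|h hs IHhs f [a [f' [/IHhs f'L fE]]]] c x y.
  by rewrite !f0 scaler0 addr0.
by rewrite !fE f'L linearP !scalerDr !scalerA [a * c]mulrC addrACA.
Qed.

(** [Hom(T,N)] itself is finitely generated, by induction on the generators of [T]: the values at
    one generator of the maps that vanish on those treated before form a submodule of [N]. *)
Lemma fgm_stable N : fgm N -> fgStable N.
Proof.
move=> [ns nsP] T [s sP].
suff [hs hsP] : exists hs : seq {linear T -> N}, forall f : {linear T -> N},
    exists k, hcomb hs k /\ forall t, t \in s -> f t = k t.
  exists hs => f; have [k [kh kE]] := hsP f.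
  exists k, (module0 R), \0, \0; split=> // [|x].
    exact: injective_module_trivial (@module0_eq R).
  rewrite addr0; apply/eqP; rewrite -subr_eq0; apply/eqP.
  have kL := hcomb_linear kh.
  apply: (lspan_min (S := fun x => lsubf f (mklinear kL) x = 0)) (sP x) => [|v /kE vs].
    by split=> [|a y z fy fz]; rewrite ?raddf0 // linearP fy fz scaler0 addr0.
  by rewrite /= vs subrr.
elim: (s) => [|t u [hs hsP]]; first by exists [::] => f; exists (fun=> 0); split.
pose S v := exists f : {linear T -> N}, (forall x, x \in u -> f x = 0) /\ f t = v.
have [||vs vsP] := @noeth_span R noeth N ns S.
- split=> [|a _ _ [f [fu <-]] [g [gu <-]]]; first by exists \0.
  have L : linear (fun x => a *: f x + g x).
    by move=> b x y; rewrite (linearP f) (linearP g) !scalerDr !scalerA (mulrC a) addrACA.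
  by exists (mklinear L); split=> // x xu; rewrite /= fu // gu // scaler0 addr0.
- by move=> v _; apply: nsP.
have [ks [ksu ksP]] : exists ks : seq {linear T -> N},
    (forall k, hcomb ks k -> forall x, x \in u -> k x = 0) /\
    (forall v, lspan vs v -> exists k, hcomb ks k /\ k t = v).
  have : forall v, v \in vs -> S v by move=> v vvs; apply/vsP/lspan_mem.
  elim: (vs) => [|v ws IHws] wsP.
    by exists [::]; split=> [k kP x _ //|_ ->]; exists (fun=> 0).
  have [|ks [ksu ksP]] := IHws; first by move=> w ww; apply: wsP; rewrite inE ww orbT.
  have [|f [fu <-]] := wsP v; first by rewrite mem_head.
  exists (f :: ks); split=> [k [a [k' [/ksu k'u kE]]] x xu|_ [a [w [/ksP[k [kk kt]] ->]]]].
    by rewrite kE fu // k'u // scaler0 addr0.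
  exists (fun x => a *: f x + k x); rewrite kt; split=> //.
  by exists a, k.
exists (hs ++ ks) => f; have [k [kh kE]] := hsP f.
have kL := hcomb_linear kh.
have /vsP/ksP[l [lk lt]] : S (f t - k t).
  exists (lsubf f (mklinear kL)); split=> //= x xu.
  by rewrite kE // subrr.
exists (fun x => k x + l x); split; first exact: hcomb_cat.
move=> x; rewrite inE => /orP[/eqP ->|xu]; first by rewrite lt addrC subrK.
by rewrite (ksu _ lk) // addr0 kE.
Qed.

(* The connecting map onto [Ext^n(T,N) = Hom(T,V)/Hom(T,I)]: with [F] free
   covering [T] with kernel [S], maps [S -> W] extend to [F -> I]. *)
Lemma fgStable_step W I V (i : {linear W -> I}) (q : {linear I -> V}) :
  injective_module I -> ses i q -> fgStable W ->
  forall T, fgm T -> exists hs : seq {linear T -> V}, forall f : {linear T -> V},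
    exists k (g : {linear T -> I}), hcomb hs k /\ forall x, f x = k x + q (g x).
Proof.
move=> Ii s Wf T [t tP]; have [iI iq qS] := s.
have [F [p [Fp Ff pP]]] := free_cover t.
have pS : surj p by move=> v; apply/pP.
have [S [j sj]] := ker_ex pS; have [jI jp _] := sj.
have [gs gsP] := Wf S (fgm_sub jI Ff).
have ext (g : {linear S -> W}) : exists (h : {linear T -> V}),
    exists g' : {linear F -> I}, (forall x, g' (j x) = i (g x)) /\
      forall x, h (p x) = q (g' x).
  have [g' g'P] := Ii _ _ j (lcomp i g) jI.
  have [h hP] : exists h : {linear T -> V}, forall x, h (p x) = q (g' x).
    apply: (desc (f := lcomp q g')) => // _ /jp[x <-] /=.
    by rewrite g'P /= (ses_gf _ s).
  by exists h, g'.
have [e eP] := choice ext.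
exists (map e gs) => f.
have [f' f'P] := Fp _ _ q (lcomp f p) qS.
have [phi phiP] : exists phi : {linear S -> W}, forall x, i (phi x) = f' (j x).
  apply: (factor (f := lcomp f' j)) => // x; apply/iq.
  by rewrite f'P /= (ses_gf _ sj) raddf0.
have [k [E [a [b [kgs Ei phiE]]]]] := gsP phi.
have [k1 [k2 [k2P k1j k1q]]] : exists (k1 : {linear F -> I}) (k2 : T -> V),
    [/\ hcomb (map e gs) k2, forall x, k1 (j x) = i (k x)
      & forall x, k2 (p x) = q (k1 x)].
  elim: (gs) k kgs {phiE gsP} => [k k0|g gs' IHgs k [c [k' [k'P kE]]]].
    exists \0, (fun=> 0); split=> // x; last by rewrite raddf0.
    by rewrite k0 !raddf0.
  have [k1 [k2 [k2P k1j k1q]]] := IHgs _ k'P.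
  have [g' [g'P eg]] := eP g.
  have L : linear (fun x => c *: g' x + k1 x).
    by move=> d x y; rewrite (linearP g') (linearP k1) !scalerDr !scalerA (mulrC c) addrACA.
  exists (mklinear L), (fun x => c *: e g x + k2 x); split=> [|x|x] /=.
  - by exists c, k2.
  - by rewrite g'P k1j kE linearP.
  - by rewrite eg k1q linearP.
have [a' a'P] := Ei _ _ j a jI.
have [g gP] : exists g : {linear T -> I},
    forall x, g (p x) = f' x - k1 x - i (b (a' x)).
  have [g gP] := @desc R _ _ _ p (lsubf (lsubf f' k1) (lcomp i (lcomp b a'))) pS
    (fun x px => ltac:(by have /jp[y <-] := px; rewrite /= a'P k1j -phiP phiE
      raddfD /= -addrA -opprD subrr)).
  by exists g => x; rewrite gP.
exists k2, g; split=> // y; have [x <-] := pS y.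
by rewrite gP !raddfB /= f'P (ses_gf _ s) subr0 k1q addrC subrK.
Qed.

Lemma reso_fgStable n N W : fgm N -> reso n N W -> fgStable W.
Proof.
move=> Nf; elim: n W => [|n IHn] W.
  move=> [f fB]; apply: fgm_stable; have [s sP] := Nf.
  by exists (map f s) => v; case: fB => g _ gK; rewrite -[v]gK; apply: lspan_map.
move=> [W' [I [i [q [Ii /IHn W'f s]]]]] T Tf.
have [hs hsP] := fgStable_step Ii s W'f Tf; exists hs => f.
have [k [g [kh fE]]] := hsP f.
by exists k, I, g, q.
Qed.

End StableHom.

(** * Units and the maximal ideal of a local ring *)

Section LocalRing.
Variables (R : comNzRingType) (m : {pred R}).
Hypothesis noeth : noetherian R.
Hypothesis loc : local_ring m.

Lemma local_lsub : lsub (fun x : R^o => x \in m).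
Proof.
have [[[m0 m1 mD] _] _] := loc; split=> // a x y; exact: mD.
Qed.

Lemma local_one : 1 \notin m.
Proof. by have [[[]]] := loc. Qed.

Lemma local_proper (J : R^o -> Prop) : lsub J -> ~ J 1 -> forall x, J x -> x \in m.
Proof.
move=> JS J1; have [||K [[KS K1] JK Kmax]] :=
  @noeth_max R noeth (fun K => lsub K /\ ~ K 1) J.
- by [].
- by move=> K [].
pose T : {pred R} := [pred x | `[< K x >]].
have TP x : x \in T <-> K x by split=> [Tx|Kx]; apply/(asboolP (K x)).
have Tmax : maximal_ideal T.
  split=> [|J' [J'0 J'1 J'D] TJ' x].
    split; first by apply/TP; case: KS.
      by apply/negP => /TP.
    by move=> a x y /TP Kx /TP Ky; apply/TP; apply: (proj2 KS).
  apply/idP/idP => [J'x|/TJ' //]; apply/TP.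
  apply: (Kmax (fun x => x \in J')) => // [|z Kz]; last by apply/TJ'/TP.
  by split; [split=> [|a u v]; [exact: J'0|exact: J'D]|apply/negP].
move=> x Jx.
have Tx : x \in T by apply/TP; apply: JK.
by rewrite -(proj2 loc _ Tmax).
Qed.

Lemma local_unit x : x \notin m -> exists u, u * x = 1.
Proof.
move=> xm; apply: contrapT => xU; have := xm; rewrite -(mul1r x) => /negP; apply.
apply: (@local_proper (fun y => exists a, y = a * x)).
- split=> [|a _ _ [b ->] [c ->]]; first by exists 0; rewrite mul0r.
  by exists (a * b + c); rewrite mulrDl -mulrA.
- by move=> [a aE]; apply: xU; exists a.
- by exists 1.
Qed.

Lemma local_unit_sub y a : y \in m -> exists u, u * (1 - y * a) = 1.
Proof.
move=> ym; apply: local_unit; apply/negP => H; have /negP := local_one; apply.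
have ya : y * a \in m by rewrite mulrC; apply: (lsubZ a (x := y : R^o) local_lsub).
rewrite -[1](subrK (y * a)).
exact: (lsubD (x := 1 - y * a : R^o) (y := y * a : R^o) local_lsub H ya).
Qed.

End LocalRing.

(** * Nakayama's lemma, one ring element at a time *)

Section Nakayama.
Variable R : comNzRingType.
Hypothesis noeth : noetherian R.
Implicit Types V : lmodType R.

Lemma nakayama_lspan V (y : R) (ts : seq V) :
  (forall a, exists u, u * (1 - y * a) = 1) ->
  (forall z, lspan ts z -> exists2 z', lspan ts z' & z = y *: z') ->
  forall z, lspan ts z -> z = 0.
Proof.
move=> yU; elim: ts => // g ts IHts gP.
have gts : lspan ts g.
  have [|_ [a [w [tw ->]]] gE] := gP g.
    by apply: lspan_mem; rewrite mem_head.
  have [u uE] := yU a.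
  have -> : g = (u * y) *: w.
    rewrite -[LHS]scale1r -uE -!scalerA; congr (u *: _).
    by rewrite scalerBl scale1r {1}gE scalerDr scalerA addrAC subrr add0r.
  exact: lsubZ (lspan_lsub ts) tw.
have tsP z : lspan (g :: ts) z -> lspan ts z.
  by move=> [a [w [tw ->]]]; apply: (proj2 (lspan_lsub ts)).
move=> z /tsP; apply: IHts => z' /(@lspan_cons _ _ g)/gP[z'' /tsP ? ->].
by exists z''.
Qed.

Lemma nakayama V (Y Z : V -> Prop) (vs : seq V) (y : R) :
  lsub Y -> lsub Z -> (forall a, exists u, u * (1 - y * a) = 1) ->
  (forall z, Z z -> exists2 w, lspan vs w & Y (z - w)) ->
  (forall z, Z z -> exists2 z', Z z' & Y (z - y *: z')) ->
  forall z, Z z -> Y z.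
Proof.
move=> YS ZS yU Zvs Zy.
have [Q [p [pS pY]]] := quot_ex YS.
have pE u v : Y (u - v) -> p u = p v.
  by move=> /pY; rewrite raddfB => /eqP; rewrite subr_eq0 => /eqP.
have [||ts tsP] := @noeth_span R noeth Q (map p vs) (fun w => exists2 z, Z z & p z = w).
- split=> [|a _ _ [u Zu <-] [v Zv <-]]; first by exists 0; rewrite ?raddf0 //; case: ZS.
  by exists (a *: u + v); rewrite ?linearP //; apply: (proj2 ZS).
- by move=> _ [z /Zvs[w vw /pE ->] <-]; apply: lspan_map.
move=> z Zz; apply/pY; apply: (@nakayama_lspan Q y ts yU); last by apply/tsP; exists z.
move=> _ /tsP[u /Zy[u' Zu' /pE uu'] <-]; exists (p u'); first by apply/tsP; exists u'.
by rewrite uu' linearZ.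
Qed.

End Nakayama.

(** * Sequences that are regular up to torsion, and lifting along injective covers *)

Section AlmostRegular.
Variable R : comNzRingType.
Implicit Types (U V W A B C D E G I K N Q X Y T F : lmodType R).

(* [rev xs] is a regular sequence up to [s]-torsion. *)
Fixpoint areg (s : R) (xs : seq R^o) : Prop :=
  if xs is x :: xs' then
    areg s xs' /\ forall a, lspan xs' (x * a) -> lspan xs' (s * a)
  else True.

(** These elements form [Hom(R/(xs),V)]. *)
Definition kill V (xs : seq R^o) (v : V) : Prop := forall x, x \in xs -> x *: v = 0.

Lemma kill_lsub V xs : lsub (@kill V xs).
Proof.
split=> [x _|a u v ku kv x xxs]; first exact: scaler0.
by rewrite scalerDr scalerA mulrC -scalerA ku // kv // scaler0 addr0.
Qed.

Lemma kill_lspan V (xs : seq R^o) (v : V) r : kill xs v -> lspan xs r -> r *: v = 0.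
Proof.
move=> kv; apply: (lspan_min (S := fun r : R^o => r *: v = 0)) => //.
split=> [|a x y xv yv]; first exact: scale0r.
by rewrite scalerDl -scalerA xv yv scaler0 addr0.
Qed.

Lemma kill_map V W (f : {linear V -> W}) xs v : kill xs v -> kill xs (f v).
Proof. by move=> kv x /kv xv; rewrite -linearZ /= xv raddf0. Qed.

(** [V] has [n] successive injective covers. An [n]th cosyzygy has [n] of them, a Gorenstein
    injective module any number. *)
Fixpoint dcov (n : nat) V : Prop := if n is n'.+1 then lstep (dcov n') V else True.

Lemma dcovS n V : dcov n.+1 V -> dcov n V.
Proof.
elim: n V => // n IHn V [K [E [f [g [Ei Kn s]]]]]; exists K, E, f, g.
by split=> //; apply: IHn.
Qed.

Lemma dcovW k n V : (k <= n)%N -> dcov n V -> dcov k V.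
Proof. by move=> /subnK <-; elim: (n - k)%N => // i IHi /dcovS. Qed.

Lemma GI_dcov n V : gorenstein_injective V -> dcov n V.
Proof. by elim: n V => // n IHn V /GI_gclass[_ + _]; apply: lstepW. Qed.

Lemma reso_dcov n N V : reso n N V -> dcov n V.
Proof.
elim: n V => // n IHn V [W [I [f [g [Ii NW s]]]]]; exists W, I, f, g.
by split=> //; apply: IHn.
Qed.

(** Up to powers of [s], [Ext^1(R/(xs),K)] is shifted along the covers of [K], one for each element
    of [xs]. Lift [v] to some [e] killed by the earlier elements. Then [x e] comes from [w] in [K],
    which lifts to the next cover; there its lift becomes divisible by [x] after multiplication by
    [s], and the quotient corrects [e]. *)
Lemma almost_surj s xs : areg s xs ->
  forall K E V (f : {linear K -> E}) (g : {linear E -> V}),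
    injective_module E -> ses f g -> dcov (size xs) K ->
    forall v, kill xs v -> exists k e, kill xs e /\ g e = s ^+ k *: v.
Proof.
elim: xs => [|x xs IHxs] /=; first move=> _ K E V f g Ei [_ _ gS] _ v _.
  by have [e eE] := gS v; exists 0%N, e; rewrite eE scale1r.
move=> [xsreg xreg] K E V f g Ei fg Kd v kv.
have kxsv : kill xs v by move=> z zxs; apply: kv; rewrite inE zxs orbT.
have [k [e [ke eE]]] := IHxs xsreg _ _ _ f g Ei fg (dcovS Kd) v kxsv.
have [fI fgE gS] := fg.
have /fgE[w wE] : g (x *: e) = 0.
  rewrite linearZ /= eE scalerA mulrC -scalerA kv ?scaler0 //; exact: mem_head.
have kw : kill xs w.
  move=> z zxs; apply: fI; rewrite linearZ /= wE raddf0 scalerA mulrC -scalerA.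
  by rewrite ke // scaler0.
have [K' [E' [f' [g' [E'i K'd fg']]]]] := Kd.
have [k' [e' [ke' e'E]]] := IHxs xsreg _ _ _ f' g' E'i fg' K'd w kw.
have [|e'' [ke'' e''E]] := @inj_div R E' (lspan xs) x (s *: e') E'i (lspan_lsub xs).
  move=> r; rewrite mulrC => /xreg sr.
  by rewrite scalerA mulrC; apply: kill_lspan sr.
exists (k' + 1 + k)%N, (s ^+ (k' + 1) *: e - f (g' e'')); split.
  move=> z; rewrite inE => /orP[/eqP ->|zxs]; last first.
    rewrite scalerBr scalerA mulrC -scalerA ke // scaler0 sub0r -!linearZ /=.
    by rewrite ke'' ?raddf0 ?oppr0 //; apply: lspan_mem.
  rewrite scalerBr scalerA mulrC -scalerA -wE -!linearZ /= e''E.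
  by rewrite [g' _]linearZ /= e'E scalerA -exprS addn1 subrr.
by rewrite raddfB /= (ses_gf _ fg) subr0 linearZ /= eE scalerA -exprD.
Qed.

Lemma areg_mull u s xs : areg s xs -> areg (u * s) xs.
Proof.
elim: xs => //= x xs IHxs [/IHxs ? xP]; split=> // a /xP.
by rewrite -mulrA; apply: idealM; apply: lspan_lsub.
Qed.

Lemma gen_lspan (s : seq R) (x : R) : generated_ideal s x <-> lspan (s : seq R^o) x.
Proof.
split=> [[c ->]|].
  apply: (@lsub_sum R R^o (lspan _)) => [|i]; first exact: lspan_lsub.
  apply: (lsubZ (c i) (x := (s`_i : R^o)) (lspan_lsub _)).
  by apply: lspan_mem; apply: mem_nth.
elim: s x => [x /= ->|g s IHs _ [a [w [/IHs[c ->] ->]]]].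
  by exists (fun=> 0); rewrite big_ord0.
exists (fun i => if i is i'.+1 then c i' else a).
by rewrite big_ord_recl.
Qed.

Lemma lspan_sub (s t : seq R^o) x : {subset s <= t} -> lspan s x -> lspan t x.
Proof.
by move=> st; apply: lspan_min => [|y /st]; [apply: lspan_lsub|apply: lspan_mem].
Qed.

Lemma gen_rev (s : seq R) (x : R) : generated_ideal (rev s) x <-> lspan (s : seq R^o) x.
Proof. by rewrite gen_lspan; split; apply: lspan_sub => y; rewrite mem_rev. Qed.

Lemma areg_regular (xs : seq R) : areg 1 (xs : seq R^o) -> ~ lspan (xs : seq R^o) 1 ->
  regular_sequence (rev xs).
Proof.
move=> xsr xs1; split; last by rewrite gen_rev.
move=> i a; rewrite size_rev => ixs; rewrite nth_rev //.
have -> : take i (rev xs) = rev (drop (size xs - i) xs).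
  by rewrite take_rev.
rewrite !gen_rev.
have [k [kE kxs]] : exists k, (size xs - i)%N = k.+1 /\ (k < size xs)%N.
  exists (size xs - i.+1)%N; split; first by rewrite -subSn // subSS.
  by rewrite ltn_subrL /=; case: (xs) ixs.
rewrite kE; have -> : (size xs - i.+1)%N = k by rewrite subnS kE.
elim: (xs) k kxs xsr {xs1 i ixs kE} => // x ys IHys [|k] /= kys [ysr xP].
  by rewrite drop0 => /xP; rewrite mul1r.
exact: IHys.
Qed.

Lemma regular_areg (s : seq R) :
  (forall i a, (i < size s)%N ->
     generated_ideal (take i s) (s`_i * a) -> generated_ideal (take i s) a) ->
  areg 1 (rev s : seq R^o).
Proof.
elim/last_ind: s => // s x IHs sP; rewrite rev_rcons /=; split=> [|a].
  apply: IHs => i a si; have := sP i a; rewrite size_rcons ltnS ltnW //.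
  by rewrite nth_rcons si -cats1 takel_cat ?(ltnW si) //; apply.
have := sP (size s) a; rewrite size_rcons leqnn nth_rcons ltnn eqxx -cats1.
rewrite take_size_cat // -{1 2}[s]revK !gen_rev mul1r; exact.
Qed.

End AlmostRegular.

(** * Bass' formula *)

Section Bass.
Variables (R : comNzRingType) (m : {pred R}) (d : nat).
Hypothesis noeth : noetherian R.
Hypothesis loc : local_ring m.
Hypothesis depth_le : forall s : seq R, {subset s <= m} -> regular_sequence s ->
  (size s <= d)%N.
Implicit Types (U V W A B C D E G I K N Q X Y T F : lmodType R).

Section Lifting.
Variables (A B : lmodType R) (pi : {linear A -> B}).
Hypotheses (Ai : injective_module A) (Bi : injective_module B).

Definition annih V (J : R^o -> Prop) (v : V) : Prop := forall r, J r -> r *: v = 0.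

(** For [b] killed by [J] and [pi] surjective with kernel [X]: the class of [b] in [Ext^1(R/J,X)]
    vanishes. *)
Definition lifts (J : R^o -> Prop) (b : B) : Prop := exists2 a, annih J a & pi a = b.

Lemma annihB V J (u v : V) : annih J u -> annih J v -> annih J (u - v).
Proof. by move=> Ju Jv r Jr; rewrite scalerBr Ju // Jv // subr0. Qed.

Lemma annihD V J (u v : V) : annih J u -> annih J v -> annih J (u + v).
Proof. by move=> Ju Jv r Jr; rewrite scalerDr Ju // Jv // addr0. Qed.

Lemma annihZ V J a (v : V) : annih J v -> annih J (a *: v).
Proof. by move=> Jv r Jr; rewrite scalerA mulrC -scalerA Jv // scaler0. Qed.

Lemma annih_map V W (f : {linear V -> W}) J v : annih J v -> annih J (f v).
Proof. by move=> Jv r Jr; rewrite -linearZ /= Jv // raddf0. Qed.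

(* Exactness of [Ext^1(R/(J+y),X) -> Ext^1(R/J,X) -> Ext^1(R/(J:y),X)]. *)
Lemma lifts_colon (J : R^o -> Prop) (y : R) b a : lsub J ->
  (forall b', annih (fun r => exists i c, J i /\ r = i + c * y) b' ->
     lifts (fun r => exists i c, J i /\ r = i + c * y) b') ->
  annih J b -> annih (fun r => J (r * y)) a -> pi a = y *: b -> lifts J b.
Proof.
move=> JS Jy Jb Ja ab.
have [a1 [Ja1 ya1]] := inj_div Ai JS (fun r => Ja r).
have [|a2 Ja2 a2E] := Jy (b - pi a1).
  move=> _ [i [c [Ji ->]]]; rewrite scalerDl -scalerA [y *: _]scalerBr -linearZ /= ya1.
  rewrite ab subrr scaler0 addr0; apply: (annihB Jb _ Ji).
  exact: annih_map.
exists (a2 + a1); last by rewrite raddfD /= a2E subrK.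
apply: annihD Ja1 => r Jr; apply: Ja2; exists r, 0.
by rewrite mul0r addr0.
Qed.

(* Ideals that are maximal with [Ext^1(R/p,X) <> 0] are prime. *)
Lemma maximal_nonlifting J0 b0 : lsub J0 -> annih J0 b0 -> ~ lifts J0 b0 ->
  exists (p : R^o -> Prop) b, [/\ lsub p, ~ p 1, forall x y : R, p (x * y) -> p x \/ p y,
    annih p b /\ ~ lifts p b &
    forall (y : R) c, ~ p y -> annih p c -> lifts p (y *: c) -> lifts p c].
Proof.
move=> J0S J0b0 b0l.
pose Fam J := lsub J /\ exists2 b, annih J b & ~ lifts J b.
have [||p [[pS [b pb bl]] J0p pmax]] := @noeth_max R noeth Fam J0.
- by split=> //; exists b0.
- by move=> J [].
have big J x : lsub J -> (forall r, p r -> J r) -> J x -> ~ p x ->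
    forall c, annih J c -> lifts J c.
  move=> JS pJ Jx px c Jc; apply: contrapT => cl; apply: px.
  by apply: (pmax J) => //; split=> //; exists c.
have yS y : lsub (fun r => exists i c, p i /\ r = i + c * y).
  split=> [|a _ _ [i [c [pi_ ->]]] [i' [c' [pi' ->]]]].
    by exists 0, 0; rewrite mul0r addr0; split=> //; case: pS.
  exists (a *: i + i'), (a * c + c'); split; first exact: (proj2 pS).
  by rewrite scalerDr mulrDl addrACA -mulrA.
have big_y y : ~ p y -> forall c, annih (fun r => exists i e, p i /\ r = i + e * y) c ->
    lifts (fun r => exists i e, p i /\ r = i + e * y) c.
  move=> py; apply: (big _ y) => // [r pr|].
    by exists r, 0; rewrite mul0r addr0.
  by exists 0, 1; rewrite mul1r add0r; split=> //; case: pS.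
have prime x y : p (x * y) -> p x \/ p y.
  move=> pxy; have [py|py] := pselect (p y); [by right|left].
  apply: contrapT => px; apply: bl.
  have [|||c pc cE] := big (fun r => p (r * y)) x _ _ pxy px (y *: b).
  - split=> [|a u v pu pv]; first by rewrite mul0r; case: pS.
    by rewrite mulrDl -mulrA; apply: (proj2 pS).
  - by move=> r pr; rewrite mulrC; apply: idealM.
  - by move=> r pry; rewrite scalerA; apply: pb.
  by apply: lifts_colon (big_y y py) pb pc cE.
exists p, b; split=> //.
  move=> p1; apply: bl; exists 0; first by move=> r _; rewrite scaler0.
  by rewrite raddf0 -[b]scale1r pb.
move=> y c py pc [a pa aE]; apply: lifts_colon (big_y y py) pc _ aE => //.
by move=> r /prime[/pa|/py].
Qed.

End Lifting.

(* A maximal sequence in [p] that is regular locally at [p]. *)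
Lemma maximal_areg (p : R^o -> Prop) : lsub p -> ~ p 1 ->
  (forall x y : R, p (x * y) -> p x \/ p y) ->
  exists (xs : seq R^o) (s t : R), [/\ areg s xs, ~ p s, forall x, x \in xs -> p x &
    forall r : R, lspan xs (r * t) <-> p r].
Proof.
move=> pS p1 prime.
have pM (x y : R) : ~ p x -> ~ p y -> ~ p (x * y) by move=> px py /prime[].
pose Fam J := exists (xs : seq R^o) (s : R),
  [/\ areg s xs, ~ p s, forall x, x \in xs -> p x & J = lspan xs].
have [||J [[xs [s [xsr ps xsp ->]]] _ xsmax]] := @noeth_max R noeth Fam (lspan [::]).
- by exists [::], 1.
- by move=> _ [xs [s [_ _ _ ->]]]; apply: lspan_lsub.
have xsS := lspan_lsub xs.
have xs_p x : lspan xs x -> p x by apply: lspan_min.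
exists xs, s; apply: contrapT => not.
(* The ideal generated by [xs] in the localization at [p], contracted to [R]. It is finitely
   generated, so a single [u] outside [p] clears all denominators. *)
pose Jp (a : R^o) := exists2 u, ~ p u & lspan xs (u * a).
have JpS : lsub Jp.
  split=> [|a x y [u pu ux] [v pv vy]]; first by exists 1; rewrite ?mulr0 //; case: xsS.
  exists (u * v); first exact: pM.
  rewrite mulrDr; apply: lsubD => //; last by rewrite -mulrA; apply: idealM.
  have -> : u * v * (a *: x) = (v * a) * (u * x).
    by rewrite (mulrC u v); apply: (mulrACA v u a x).
  exact: idealM.
have [gs gsP] := noeth_ideal noeth JpS.
have [u pu uP] : exists2 u, ~ p u & forall a, Jp a -> lspan xs (u * a).
  have [u pu uP] : exists2 u, ~ p u & forall a, a \in gs -> lspan xs (u * a).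
    have : forall a, a \in gs -> Jp a by move=> a ags; apply/gsP/lspan_mem.
    elim: (gs) => [|g gs' IHgs] gP; first by exists 1.
    have [|u pu uP] := IHgs; first by move=> a ags; apply: gP; rewrite inE ags orbT.
    have [|v pv vP] := gP g; first by rewrite mem_head.
    exists (u * v); first exact: pM.
    move=> a; rewrite inE => /orP[/eqP ->|/uP ua].
      by rewrite -mulrA; apply: (idealM u xsS vP).
    by rewrite mulrAC mulrC; apply: (idealM v xsS ua).
  exists u => // a /gsP; apply: (@lspan_min R R^o gs (fun a => lspan xs (u * a))) => //.
  split=> [|c x y ux uy]; first by rewrite mulr0; case: xsS.
  by rewrite mulrDr [u * (c *: x)]mulrCA; apply: (proj2 xsS).
(* If every element of [p] were a zero divisor modulo [Jp], some [t] outside [Jp] would satisfy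
   [p t <= Jp], and [u t] would be the witness. Otherwise [x] prolongs the sequence, against
   maximality. *)
have [|x px xP] := @regular_element R noeth Jp p JpS pS.
  move=> t Jpt; apply: contrapT => npt; apply: not; exists (u * t); split=> // r.
  rewrite mulrCA; split=> [urt|pr].
    apply: contrapT => pr; apply: Jpt; exists (u * r); first exact: pM.
    by rewrite -mulrA.
  by apply: uP; apply: contrapT => rt; apply: npt; exists r.
have xJ : lspan xs x.
  apply: (xsmax (lspan (x :: xs))) => [|r|].
  - exists (x :: xs), (u * s); split=> //.
    + split=> [|a xa]; first exact: areg_mull.
      rewrite -mulrA mulrCA; apply: idealM => //; apply/uP/xP; exists 1 => //.
      by rewrite mul1r.
    + exact: pM.
    + by move=> y; rewrite inE => /orP[/eqP ->|/xsp].
  - exact: lspan_cons.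
  - by apply: lspan_mem; rewrite mem_head.
have /uP : Jp 1 by apply: xP; exists 1; rewrite ?mul1r ?mulr1.
by rewrite mulr1 => /xs_p.
Qed.

Lemma bass_injective n N W I V V' V'' E1 B X (rho0 : {linear W -> I})
    (rho : {linear I -> V}) (j : {linear V' -> B}) (q : {linear B -> V})
    (j' : {linear V'' -> E1}) (r : {linear E1 -> V'}) (lam : {linear I -> B})
    (iota : {linear X -> (E1 * I)%type}) :
  fgm N -> reso n N W -> (d <= n)%N ->
  injective_module I -> ses rho0 rho -> injective_module B -> ses j q ->
  gorenstein_injective V'' -> injective_module E1 -> ses j' r ->
  (forall x, q (lam x) = rho x) ->
  ses iota (lcopair (lcomp j r) lam) ->
  injective_module X.
Proof.
move=> Nf NW dn Ii sW Bi sV GV'' E1i sV' lamP sX.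
have Ai := injective_prod E1i Ii.
apply: (baer_ker Ai sX) => J0 b0 J0S J0b0.
apply: contrapT => b0l.
have [p [b [pS p1 prime [pb bl] py_inj]]] :=
  maximal_nonlifting Ai (pi := lcopair (lcomp j r) lam) J0S J0b0
   (fun H => b0l (ltac:(by case: H => a Ja aE; exists a))).
have [xs [s [t [xsr ps xsp tP]]]] := maximal_areg pS p1 prime.
have psX k : ~ p (s ^+ k) by elim: k => // k IHk; rewrite exprS => /prime[].
pose pi := lcopair (lcomp j r) lam.
have p_t V0 (a : V0) : kill xs a -> annih p (t *: a).
  by move=> ka x /tP xt; rewrite scalerA; apply: kill_lspan xt.
(* As [((xs):t) = p], multiplication by [t] embeds [R/p] in [R/(xs)]. The question about [p] is
   moved to [xs], along which elements can be lifted. *)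
have [b1 [kb1 tb1]] : exists b1, kill xs b1 /\ t *: b1 = b.
  have [|b1 [kb1 tb1]] := inj_div Bi (lspan_lsub xs) (y := t) (e := b).
    by move=> x /tP; apply: pb.
  by exists b1; split=> // x /lspan_mem/kb1.
have [iV' _ _] := sV.
(* Once [q b'] is lifted to [I], the difference [b' - lam x] comes from [V'] and lifts to [E1] up to
   a power of [s]. Multiplication by [t] turns elements killed by [xs] into elements killed by
   [p]. *)
have finish b' x : kill xs b' -> kill xs x -> q b' = rho x ->
    exists k', lifts pi p ((s ^+ k') *: (t *: b')).
  move=> kb' kx qb'.
  have [_ jq _] := sV; have /jq[v vE] : q (b' - lam x) = 0.
    by rewrite raddfB /= lamP qb' subrr.
  have kv : kill xs v.
    move=> z zxs; apply: iV'; rewrite linearZ /= vE raddf0 scalerBr kb' //.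
    by rewrite -linearZ kx // raddf0 subr0.
  have [k' [e [ke eE]]] := almost_surj xsr E1i sV' (GI_dcov (size xs) GV'') kv.
  exists k', (t *: (e, s ^+ k' *: x)).
    apply: p_t => z zxs; congr (_, _) => /=; first exact: ke.
    by rewrite scalerA mulrC -scalerA kx // scaler0.
  rewrite linearZ scalerA mulrC -scalerA; congr (t *: _).
  by rewrite /= eE !linearZ /= vE -scalerDr subrK.
(* If [p] contains [m], then [s] is a unit and [xs] is a regular sequence. Its length is at most
   [d <= n], so the [n]th cosyzygy [W] has enough covers to lift a power of [s] times [q b1] to
   [I]. *)
have [pm|] := pselect (forall y, y \in m -> p y).
  have sm : s \notin m by apply/negP => /pm.
  have [u us] := local_unit noeth loc sm.
  have xs1 : areg 1 xs by rewrite -us; apply: areg_mull.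
  have xs_p x : lspan xs x -> p x by apply: lspan_min.
  have xsd : (size xs <= d)%N.
    rewrite -size_rev; apply: depth_le; last by apply: areg_regular => // /xs_p.
    move=> x; rewrite mem_rev => /xsp; exact: (local_proper noeth loc pS).
  have kqb1 : kill xs (q b1) by apply: kill_map.
  have Wd : dcov (size xs) W := dcovW (leq_trans xsd dn) (reso_dcov NW).
  have [k [x [kx xE]]] := almost_surj xsr Ii sW Wd kqb1.
  have [|||k' kl] := finish (s ^+ k *: b1) x; last 1 first.
  - apply: bl; apply: (py_inj (s ^+ k' * s ^+ k)) => //.
      by rewrite -exprD; apply: psX.
    by rewrite -scalerA -tb1 [_ *: (t *: b1)]scalerA mulrC -scalerA.
  - by move=> z zxs; rewrite scalerA mulrC -scalerA kb1 // scaler0.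
  - by [].
  - by rewrite linearZ xE.
(* Otherwise some [y] of [m] lies outside [p]. Elements of [V] killed by [xs] are maps from
   [T = R/(xs)]; modulo those that come from [I] they form [Ext^(n+1)(T,N)], which is finitely
   generated by [vs]. *)
move=> /existsNP[y /not_implyP[ym py]].
have [T [pr [prS prK]]] := quot_ex (lspan_lsub xs).
have Tf : fgm T.
  exists [:: pr 1] => v; have [x <-] := prS v; exists x, 0.
  by rewrite addr0 -linearZ; split=> //; congr (pr _); rewrite [RHS]mulr1.
have [hs hsP] := fgStable_step noeth Ii sW (reso_fgStable noeth Nf NW) Tf.
have kT V0 (f : {linear T -> V0}) : kill xs (f (pr 1)).
  move=> x xxs; rewrite -!linearZ /=.
  have -> : pr (x *: 1) = 0; last exact: raddf0.
  by apply/prK; rewrite [_ *: _]mulr1; apply: lspan_mem.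
pose vs := [seq (h : {linear T -> V}) (pr 1) | h <- hs].
have vsP v : kill xs v -> exists w x, [/\ lspan vs w, kill xs x & v = w + rho x].
  move=> kv; have [f fP] : exists f : {linear T -> V}, forall x, f (pr x) = rmap v x.
    by apply: desc => // x /prK; apply: kill_lspan.
  have [k [g [kh fE]]] := hsP f.
  exists (k (pr 1)), (g (pr 1)); split; last by rewrite -fE fP /= scale1r.
    rewrite /vs; elim: (hs) k kh {fE hsP} => [|h hs' IHhs] k /=; first by move=> ->.
    by move=> [a [k' [/IHhs k'P ->]]]; exists a, (k' (pr 1)).
  exact: kT.
(* [Y] collects the elements for which the obstruction [t c] can be lifted. Nakayama's lemma gives
   [Z <= Y], in particular for [q b1], and then [finish] applies to [b1 - c]. *)
pose Z v := exists x c, [/\ kill xs x, kill xs c & v = rho x + q c].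
pose Y v := exists x c, [/\ kill xs x, kill xs c, lifts pi p (t *: c) & v = rho x + q c].
have l0 : lifts pi p 0 by exists 0; [move=> z _; rewrite scaler0|rewrite raddf0].
have lD a u v : lifts pi p u -> lifts pi p v -> lifts pi p (a *: u + v).
  move=> [u' pu' <-] [v' pv' <-]; exists (a *: u' + v'); last by rewrite linearP.
  by apply: annihD => //; apply: annihZ.
have kD a V0 (u v : V0) := proj2 (kill_lsub V0 xs) a u v.
have k0 V0 := proj1 (kill_lsub V0 xs).
have rearr a (x x' : I) (c c' : B) :
    a *: (rho x + q c) + (rho x' + q c') = rho (a *: x + x') + q (a *: c + c').
  by rewrite !linearP scalerDr addrACA.
have : forall z, Z z -> Y z.
  apply: (@nakayama R noeth V Y Z vs y).
  - split=> [|a _ _ [x [c [kx kc lc ->]]] [x' [c' [kx' kc' lc' ->]]]].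
      by exists 0, 0; rewrite !raddf0 addr0; split=> //; apply: k0.
    exists (a *: x + x'), (a *: c + c'); rewrite rearr; split=> //; try exact: kD.
    by rewrite scalerDr scalerA mulrC -scalerA //; apply: lD.
  - split=> [|a _ _ [x [c [kx kc ->]]] [x' [c' [kx' kc' ->]]]].
      by exists 0, 0; rewrite !raddf0 addr0; split=> //; apply: k0.
    by exists (a *: x + x'), (a *: c + c'); rewrite rearr; split=> //; apply: kD.
  - by move=> a; apply: (local_unit_sub noeth loc).
  - move=> _ [x [c [kx kc ->]]].
    have [|w [x' [vw kx' ->]]] := vsP (rho x + q c).
      by apply: (lsubD (kill_lsub V xs)); apply: kill_map.
    exists w => //; exists x', 0; rewrite !raddf0 addr0 addrAC subrr add0r.
    by split=> //; apply: k0.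
  - move=> _ [x [c [kx kc ->]]].
    (* [p] is prime and [y] lies outside it, so [y] divides within the elements of [B] killed by
       [p]. Pulling the quotient [c1] back along [t] gives [c2] with [t (c - y c2) = 0]. *)
    have [|c1 [pc1 yc1]] := inj_div Bi pS (y := y) (e := t *: c).
      by move=> z /prime[pz|//]; apply: p_t.
    have [|c2 [kc2 tc2]] := inj_div Bi (lspan_lsub xs) (y := t) (e := c1).
      by move=> z /tP; apply: pc1.
    have {}kc2 : kill xs c2 by move=> z /lspan_mem/kc2.
    exists (q c2); first by exists 0, c2; rewrite raddf0 add0r; split.
    exists x, (c - y *: c2); rewrite [q (c - _)]raddfB /= [q (y *: _)]linearZ /= addrA; split=> //.
      by apply: (lsubB (kill_lsub B xs)) => //; apply: (lsubZ _ (kill_lsub B xs)).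
    by rewrite scalerBr scalerA mulrC -scalerA tc2 yc1 subrr.
move=> /(_ (q b1))[|x [c [kx kc lc qb1]]].
  by exists 0, b1; rewrite raddf0 add0r; split.
have [||k kl] := finish (b1 - c) x _ kx.
- by apply: (lsubB (kill_lsub B xs)).
- by rewrite raddfB /= qb1 addrK.
apply: bl; apply: (py_inj (s ^+ k)) => //.
have -> : s ^+ k *: b = s ^+ k *: (t *: c) + s ^+ k *: (t *: (b1 - c)).
  by rewrite -scalerDr -scalerDr addrC subrK tb1.
exact: lD.
Qed.

End Bass.

(** * Descent of Gorenstein injectivity along cosyzygies *)

Section BassFormula.
Variables (R : comNzRingType) (m : {pred R}) (d : nat).
Hypothesis noeth : noetherian R.
Hypothesis loc : local_ring m.
Hypothesis depth_le : forall s : seq R, {subset s <= m} -> regular_sequence s ->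
  (size s <= d)%N.
Implicit Types (U V W A B C D E G I K N Q X Y T F : lmodType R).

(** Injectivity of [X] splits [pi]. A map from an injective module to [V] lifts to [B], by the
    section to [E x I], and its component in [I] lifts it along [g]; hence [Ext^1(-,W)] vanishes on
    injectives. Moreover [X] is a cover of [W] with Gorenstein injective kernel [V''], which
    supplies the step to the left. *)
Lemma bass_step n N W I V (f : {linear W -> I}) (g : {linear I -> V}) :
  fgm N -> reso n N W -> (d <= n)%N -> injective_module I -> ses f g ->
  gorenstein_injective V -> gorenstein_injective W.
Proof.
move=> Nf NW dn Ii s GV.
have [_ [V' [B [j [q [Bi GV' sV]]]]] _] := GI_gclass GV.
have [V'e [V'' [E [j' [r [Ei GV'' sV']]]]] _] := GI_gclass GV'.
have [lam lamP] := V'e _ _ _ _ sV _ Ii g.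
have [fI fg gS] := s; have [jI jq qS] := sV; have [j'I j'r rS] := sV'.
pose pi := lcopair (lcomp j r) lam.
have piS : surj pi.
  move=> b; have [i iE] := gS (q b).
  have /jq[v vE] : q (b - lam i) = 0 by rewrite raddfB /= lamP iE subrr.
  by have [e eE] := rS v; exists (e, i); rewrite /= eE vE subrK.
have [X [iota sX]] := ker_ex piS; have [iotaI iotapi _] := sX.
have Xi : injective_module X.
  exact: (bass_injective noeth loc depth_le Nf NW dn Ii s Bi sV GV'' Ei sV' lamP sX).
have [u uP] : exists u : {linear X -> W}, forall x, f (u x) = (iota x).2.
  apply: (factor (f := lcomp (lsnd _ _) iota)) => // x; apply/fg.
  have := congr1 q (ses_gf x sX).
  by rewrite raddfD /= (ses_gf _ sV) lamP add0r raddf0.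
have [w wP] : exists w : {linear V'' -> X}, forall v, iota (w v) = (j' v, 0).
  apply: (factor (f := lcomp (linl _ _) j')) => // v; apply/iotapi.
  by rewrite /= (ses_gf _ sV') !raddf0 addr0.
have sW : ses w u.
  split=> [|x|x].
  - by apply: linear_inj => v wv; have := wP v; rewrite wv raddf0 => -[/esym/(inj0 j'I)].
  - split=> [ux|[v <-]]; last by apply: fI; rewrite uP wP raddf0.
    have x2 : (iota x).2 = 0 by rewrite -uP ux raddf0.
    have x1 : r (iota x).1 = 0.
      by apply: jI; have := ses_gf x sX; rewrite /= x2 !raddf0 addr0.
    have /j'r[v vE] := x1; exists v; apply: iotaI.
    by rewrite wP vE -x2; case: (iota x).
  - have /jq[v vE] : q (lam (f x)) = 0 by rewrite lamP (ses_gf _ s).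
    have [e eE] := rS v.
    have /iotapi[y yE] : pi (- e, f x) = 0 by rewrite /= !raddfN /= eE vE addNr.
    by exists y; apply: fI; rewrite uP yE.
have [_ [t [_ tK _]]] := injective_split Xi sX.
apply: (@GI_coind_upto R (fun Y => Y = W)) => // _ ->; split.
- apply: (ext1v_inj Ii s) => E' E'i h.
  have [l lP] := V'e _ _ _ _ sV _ E'i h.
  exists (lcomp (lsnd E I) (lcomp t l)) => e.
  have := congr1 q (tK (l e)); rewrite raddfD /= (ses_gf _ sV) lamP add0r lP.
  by [].
- by exists V'', X, w, u; split=> //; right.
- by exists I, V, f, g; split=> //; right.
Qed.

(** [bass_step] takes the property from cosyzygy [k + 1] to cosyzygy [k] as long as [k >= d]. *)
Theorem bass n N : fgm N -> idg n N -> idg d N.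
Proof.
move=> Nf Nn; have [nd|dn] := leqP n d; first exact: idgW Nn.
have [|V []] := @idg_reso R n N N 0 _ Nn; first by exists idfun; exists idfun.
rewrite add0n -(subnKC (ltnW dn)); elim: (n - d)%N V => [|k IHk] V.
  by rewrite addn0 => NV GV; rewrite -[d]addn0; apply: reso_idg NV _.
rewrite addnS => -[W [I [f [g [Ii NW s]]]]] GV; apply: (IHk W) => //.
by apply: (bass_step Nf NW _ Ii s GV); rewrite leq_addr.
Qed.

End BassFormula.

(** * The derived category and the upper bound *)

Section DerivedCategory.
Variable R : comNzRingType.
Implicit Types (X Y Z M K N L F : complex R).

(** [cyc] and [bnd] quantify over all degrees: entries of the differential off its shape vanish, and
    no equation between degrees has to be supplied. *)
Definition cyc X i (x : X i) : Prop := forall j, diff X i j x = 0.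
Definition bnd X i (x : X i) : Prop := exists j y, diff X j i y = x.

Lemma cycP X i j (x : X i) : i = j + 1 -> (cyc x <-> diff X i j x = 0).
Proof.
move=> ij; split=> [//|x0 k]; have [<- //|jk] := eqVneq j k.
by rewrite diff_shape // ij; apply: contra jk => /eqP/addIr ->.
Qed.

Lemma bndP X i j (x : X i) : j = i + 1 -> (bnd x <-> exists y, diff X j i y = x).
Proof.
move=> ji; split=> [[k [y yx]]|[y yx]]; last by exists j, y.
have [kj|kj] := eqVneq k j; first by subst k; exists y.
by exists 0; rewrite raddf0 -yx diff_shape // -ji.
Qed.

Lemma bnd_lsub X i : lsub (@bnd X i).
Proof.
split=> [|a x y /(bndP _ erefl)[u <-] /(bndP _ erefl)[v <-]].
  by exists i, 0; rewrite raddf0.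
by exists (i + 1), (a *: u + v); rewrite linearP.
Qed.

Lemma cyc_lsub X i : lsub (@cyc X i).
Proof.
by split=> [j|a x y cx cy j]; rewrite ?raddf0 // linearP cx cy scaler0 addr0.
Qed.

Lemma bnd_cyc X i (x : X i) : bnd x -> cyc x.
Proof. by move=> [j [y <-]] k; apply: diff_diff. Qed.

Lemma cyc_diff X i j (x : X i) : cyc (diff X i j x).
Proof. by move=> k; apply: diff_diff. Qed.

Lemma cyc_map X Y (f : chain_map X Y) i (x : X i) : cyc x -> cyc (f i x).
Proof. by move=> cx j; rewrite -cmap_diff cx raddf0. Qed.

Lemma bnd_map X Y (f : chain_map X Y) i (x : X i) : bnd x -> bnd (f i x).
Proof. by move=> [j [y <-]]; exists j, (f j y); rewrite cmap_diff. Qed.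

Lemma qisoP X Y (f : chain_map X Y) : quasi_iso f <->
  forall i, (forall x, cyc x -> bnd (f i x) -> bnd x) /\
            (forall y, cyc y -> exists2 x, cyc x & bnd (y - f i x)).
Proof.
rewrite quasi_isoP; split=> [qf i|qf a b c ab bc].
  have [qi qs] := qf (i + 1) i (i - 1) erefl (esym (subrK 1 i)); split=> [x cx|y cy].
    by move=> /(bndP _ erefl)[y /esym/(qi x (cx _))[x' ->]]; exists (i + 1), x'.
  have [x [z [cx ->]]] := qs y (cy _); exists x.
    by apply/(cycP x (esym (subrK 1 i))).
  by exists (i + 1), z; rewrite addrAC subrr add0r.
have [qi qs] := qf b; split=> [x x0 y fx|y y0].
  have /(bndP _ ab)[x' xE] : bnd x by apply: qi; [apply/(cycP _ bc)|exists a, y].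
  by exists x'.
have [|x cx /(bndP _ ab)[z zE]] := qs y; first exact/(cycP _ bc).
by exists x, z; rewrite cx zE addrC subrK.
Qed.

Lemma disom_sym X Y : disomorphic X Y -> disomorphic Y X.
Proof. by move=> [f [g [gf fg]]]; exists g, f. Qed.

Lemma diso_comp X Y Z (g : dhom Y Z) (f : dhom X Y) :
  is_diso g -> is_diso f -> is_diso (DComp g f).
Proof.
move=> [g' [g'g gg']] [f' [f'f ff']]; exists (DComp f' g'); split.
  apply: deq_trans (deq_assoc _ _ _) _; apply: deq_trans f'f.
  apply: deq_comp (deq_refl _); apply: deq_trans (deq_sym (deq_assoc _ _ _)) _.
  by apply: deq_trans (deq_comp (deq_refl _) g'g) _; apply: deq_idr.
apply: deq_trans (deq_assoc _ _ _) _; apply: deq_trans gg'.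
apply: deq_comp (deq_refl _); apply: deq_trans (deq_sym (deq_assoc _ _ _)) _.
by apply: deq_trans (deq_comp (deq_refl _) ff') _; apply: deq_idr.
Qed.

Lemma disom_trans X Y Z : disomorphic X Y -> disomorphic Y Z -> disomorphic X Z.
Proof. by move=> [f fi] [g gi]; exists (DComp g f); apply: diso_comp. Qed.

Lemma diso_map X Y (f : chain_map X Y) : quasi_iso f -> is_diso (DMap f).
Proof. by move=> qf; exists (DInv qf); split; [apply: deq_invl|apply: deq_invr]. Qed.

Lemma diso_inv X Y (f : chain_map X Y) (qf : quasi_iso f) : is_diso (DInv qf).
Proof. by exists (DMap f); split; [apply: deq_invr|apply: deq_invl]. Qed.

Lemma qiso_disom X Y (f : chain_map X Y) : quasi_iso f -> disomorphic X Y.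
Proof. by move=> qf; exists (DMap f); apply: diso_map. Qed.

Lemma dtriangle_iso K X Y N : disomorphic X Y -> dtriangle K X N -> dtriangle K Y N.
Proof.
move=> [h [k [kh hk]]] [u [v [w [A [B [f [a [b [c [[ai bi ci] [/= ab bc ca]]]]]]]]]]].
exists (DComp h u), (DComp v k), w, A, B, f, a, (DComp b k), c; split.
  by split=> //; apply: diso_comp => //; exists h.
split=> //=.
  apply: deq_trans ab; apply: deq_trans (deq_assoc _ _ _) _.
  apply: deq_comp (deq_refl _); apply: deq_trans (deq_sym (deq_assoc _ _ _)) _.
  by apply: deq_trans (deq_comp (deq_refl _) kh) _; apply: deq_idr.
apply: deq_trans (deq_assoc _ _ _) _; apply: deq_trans (deq_sym (deq_assoc _ _ _)).
by apply: deq_comp bc (deq_refl _) .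
Qed.

Definition sesc K X N (f : chain_map K X) (p : chain_map X N) : Prop :=
  forall i, ses (f i) (p i).

Section ConeQuotient.
Variables (K X N : complex R) (f : chain_map K X) (p : chain_map X N).
Hypothesis s : sesc f p.

Fact cone_quot_linear i : linear (fun xk : cone f i => p i xk.1).
Proof. by move=> a [x k] [x' k'] /=; rewrite linearP. Qed.

Fact cone_quot_diff i j (xk : cone f i) :
  p j (diff (cone f) i j xk).1 = diff N i j (p i xk.1).
Proof. by case: xk => x k /=; rewrite raddfD /= (ses_gf _ (s j)) addr0 cmap_diff. Qed.

Definition cone_quot : chain_map (cone f) N :=
  @ChainMap _ _ _ (fun i => mklinear (@cone_quot_linear i)) cone_quot_diff.

Lemma cone_quot_qiso : quasi_iso cone_quot.
Proof.
apply/qisoP => i; have [fI fp pS] := s i; split=> [[x k] cxk|n cn].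
  move=> /(bndP _ erefl)[n /= nE].
  have [_ _ pS1] := s (i + 1); have [x' x'E] := pS1 n.
  have /fp[k' k'E] : p i (x - diff X (i + 1) i x') = 0.
    by rewrite raddfB /= cmap_diff x'E nE subrr.
  have /= := cxk (i - 1); rewrite /cone_diff /= transfer_id => -[dx _].
  have kE : k = - diff K i (i - 1) k'.
    have [fI' _ _] := s (i - 1); apply: fI'; rewrite raddfN /= cmap_diff k'E.
    rewrite raddfB /= diff_diff subr0; apply/eqP; rewrite -subr_eq0 opprK.
    by apply/eqP; apply: etrans dx; apply: addrC.
  exists (i + 1), (x', transfer K i (i + 1 - 1) k').
  rewrite /= /cone_diff /=; congr (_, _).
    by rewrite transferK ?addrK // k'E addrCA subrr addr0.
  by rewrite kE expr1 scaleN1r diff_transfer ?addrK.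
have [x xE] := pS n.
have [_ fp1 _] := s (i - 1).
have /fp1[k kE] : p (i - 1) (diff X i (i - 1) x) = 0 by rewrite cmap_diff xE.
exists (x, - k); last by exists i, 0; rewrite raddf0 /= xE subrr.
apply/(cycP _ (esym (subrK 1 i))); rewrite /= /cone_diff /= transfer_id raddfN /= kE subrr.
congr (_, _); rewrite raddfN /=.
have [fI2 _ _] := s (i - 1 - 1).
have -> : diff K (i - 1) (i - 1 - 1) k = 0.
  by apply: fI2; rewrite cmap_diff kE diff_diff raddf0.
by rewrite oppr0 scaler0.
Qed.

(** The cone of [f] maps to [N] by a quasi-isomorphism, and the connecting morphism is its inverse
    followed by the projection of the cone. *)
Lemma sesc_dtriangle : dtriangle K X N.
Proof.
exists (DMap f), (DMap p), (DComp (DMap (cone_out f)) (DInv cone_quot_qiso)).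
exists K, X, f, (did K), (did X), (DInv cone_quot_qiso).
have idi Y : is_diso (did Y) by exists (did Y); split; apply: deq_idl.
split; first by split=> //; apply: diso_inv.
split=> /=.
- by apply: deq_trans (deq_idl _) _; apply: deq_sym; apply: deq_idr.
- apply: deq_trans (deq_sym (deq_idr _)).
  have pE : deq (DMap p) (DComp (DMap cone_quot) (DMap (cone_in f))).
    by apply: deq_trans (deq_map_comp _ _); apply: deq_ext.
  apply: deq_trans (deq_comp (deq_refl _) pE) _.
  apply: deq_trans (deq_assoc _ _ _) _.
  by apply: deq_trans (deq_comp (deq_invl _) (deq_refl _)) _; apply: deq_idl.
- have E : deq (DMap (shift_map 1 (chain_id K))) (did (shift 1 K)) by apply: deq_ext.
  by apply: deq_trans (deq_comp E (deq_refl _)) _; apply: deq_idl.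
Qed.

End ConeQuotient.

Program Definition zcx (L : int -> lmodType R) : complex R :=
  @Complex R L (fun i j => \0) _ _.
Next Obligation. by []. Qed.
Next Obligation. by []. Qed.

Lemma zero_diff_disom X Y : (forall i j x, diff X i j x = 0) ->
  (forall i j x, diff Y i j x = 0) ->
  (forall i, exists f : {linear X i -> Y i}, bijective f) -> disomorphic X Y.
Proof.
move=> X0 Y0 XY.
have fP i : {f : {linear X i -> Y i} | bijective f}.
  by have [f fB] := cid (XY i); exists f.
have fd i j x : sval (fP j) (diff X i j x) = diff Y i j (sval (fP i) x).
  by rewrite X0 Y0 raddf0.
apply: (qiso_disom (f := @ChainMap _ X Y (fun i => sval (fP i)) fd)).
apply/qisoP => i; have fB := svalP (fP i); split=> /= [x _|y cy].
  move=> [j [y yE]]; rewrite Y0 in yE.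
  by exists i, 0; rewrite raddf0; apply: (bij_inj fB); rewrite -yE raddf0.
have [g _ gK] := fB; exists (g y); first by move=> j.
by exists i, 0; rewrite gK subrr raddf0.
Qed.

Lemma stalk_iso (N : lmodType R) (j : int) : j = 0 ->
  exists f : {linear N -> stalk N j}, bijective f.
Proof. by move=> ->; exists idfun; exists idfun. Qed.

Lemma stalk_trivial (N : lmodType R) (j : int) : j != 0 -> forall x : stalk N j, x = 0.
Proof.
rewrite /stalk /=; case: (j == 0) => //= _ x.
exact: (@module0_eq R x).
Qed.

Lemma trivial_iso (U V : lmodType R) : (forall x : U, x = 0) -> (forall x : V, x = 0) ->
  exists f : {linear U -> V}, bijective f.
Proof.
move=> U0 V0; exists \0; apply: bij_surj => [x y _|y]; first by rewrite (U0 x) (U0 y).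
by exists 0; rewrite (V0 y).
Qed.

Lemma prod_trivl (U V T : lmodType R) (f : {linear T -> V}) : (forall x : U, x = 0) ->
  bijective f -> exists g : {linear T -> (U * V)%type}, bijective g.
Proof.
move=> U0 [h fK hK]; exists (lcomp (linr U V) f); exists (fun x => h x.2) => [x|[x y]] /=.
  exact: fK.
by rewrite hK (U0 x).
Qed.

Lemma prod_trivr (U V T : lmodType R) (f : {linear T -> U}) : (forall x : V, x = 0) ->
  bijective f -> exists g : {linear T -> (U * V)%type}, bijective g.
Proof.
move=> V0 [h fK hK]; exists (lcomp (linl U V) f); exists (fun x => h x.1) => [x|[x y]] /=.
  exact: fK.
by rewrite hK (V0 y).
Qed.

Definition bounded_family (L : int -> lmodType R) : Prop :=
  exists a k, forall i : int, (i < a) || (a + k%:Z <= i) -> forall x : L i, x = 0.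

(** A finite sum of shifted stalks, by induction on the width: degree [a] is split off and replaced
    by zero. *)
Lemma zcx_thick1 (L : int -> lmodType R) : bounded_family L ->
  (forall i, gorenstein_injective (L i)) -> thick1 (@GI R) (zcx L).
Proof.
move=> [a [k]]; elim: k a L => [|k IHk] a L L0 LG.
  apply: thick1_iso (thick1_sum0 _); apply: zero_diff_disom => // i.
  by apply: trivial_iso => [|x]; [exact: module0_eq|apply: (L0 i); lia].
pose L' i : lmodType R := if i == a then module0 R else L i.
have L'0 i : i != a -> exists f : {linear L i -> L' i}, bijective f.
  by rewrite /L' => /negbTE ->; exists idfun; exists idfun.
have L'a (x : L' a) : x = 0.
  by move: x; rewrite /L' eqxx => x; apply: (@module0_eq R x).
apply: (@thick1_iso _ _ (complex_sum (shift a (stalk (L a))) (zcx L'))).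
  apply: disom_sym; apply: zero_diff_disom => // [i j [x y] /=|i].
    by rewrite scaler0.
  have [->|ia] := eqVneq i a.
    have [|f fB] := @stalk_iso (L a) (a - a); first exact: subrr.
    exact: (prod_trivr (V := L' a)) fB.
  have [f fB] := L'0 i ia.
  by apply: (prod_trivl _ fB); apply: stalk_trivial; rewrite subr_eq0.
apply: thick1_sum.
  by apply/thick1_shift/thick1_in; exists (L a).
apply: (IHk (a + 1)) => [i ik x|i].
  have [ia|ia] := eqVneq i a; first by subst i; apply: L'a.
  by have [f [g _ gK]] := L'0 i ia; rewrite -[x]gK (L0 i _ (g x)) ?raddf0 //; lia.
have [->|ia] := eqVneq i a.
  exact/injective_GI/injective_module_trivial/L'a.
have [f [g fK gK]] := L'0 i ia.
have gL : linear g.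
  by move=> c x y; rewrite -[RHS]fK linearP !gK.
by apply: (@GI_iso _ _ _ (mklinear gL)) (LG i); exists f.
Qed.

Definition gi_layer X : Prop :=
  exists L : int -> lmodType R,
    [/\ X = zcx L, bounded_family L & forall i, gorenstein_injective (L i)].

(** There are [n + 1] layers, the first being a subcomplex, as the triangles in [thick] demand. *)
Fixpoint filt (n : nat) X : Prop :=
  if n is n'.+1 then
    exists K N (f : chain_map K X) (p : chain_map X N),
      [/\ gi_layer K, filt n' N & sesc f p]
  else gi_layer X.

Lemma gi_layer_thick1 X : gi_layer X -> thick1 (@GI R) X.
Proof. by move=> [L [-> Lb LG]]; apply: zcx_thick1. Qed.

Program Definition sum0_in X : chain_map X (complex_sum (complex0 R) X) :=
  @ChainMap _ _ _ (fun i => linr (complex0 R i) (X i)) _.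
Next Obligation. by []. Qed.

Lemma sum0_in_qiso X : quasi_iso (sum0_in X).
Proof.
apply/qisoP => i; split=> [x cx|[a x] cx].
  by move=> [j [[b y] E]]; exists j, y; apply: (congr1 snd E).
exists x; first by move=> j; apply: (congr1 snd (cx j)).
exists i, 0; rewrite raddf0; congr (_, _); rewrite /= ?subrr //.
exact/esym/module0_eq.
Qed.

Lemma dtriangle_sum0 K X N : dtriangle K X N ->
  dtriangle K (complex_sum (complex0 R) X) N.
Proof. exact: dtriangle_iso (qiso_disom (sum0_in_qiso X)). Qed.

Lemma filt_thick n X : filt n X -> thick (@GI R) n.+1 X.
Proof.
elim: n X => [|n IHn] X; first exact: gi_layer_thick1.
move=> [K [N [f [p [GK FN s]]]]]; exists K, (complex0 R), N; split.
- exact: dtriangle_sum0 (sesc_dtriangle s).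
- exact: gi_layer_thick1.
- exact: IHn.
Qed.

Lemma thickS_iso n X Y : disomorphic X Y -> filt n.+1 X -> thick (@GI R) n.+2 Y.
Proof.
move=> XY [K [N [f [p [GK FN s]]]]]; exists K, (complex0 R), N; split.
- exact: dtriangle_sum0 (dtriangle_iso XY (sesc_dtriangle s)).
- exact: gi_layer_thick1.
- exact: filt_thick.
Qed.

End DerivedCategory.

(** * Extensions of complexes with zero differential *)

Section TwistedSum.
Variables (R : comNzRingType) (Y : complex R) (L : int -> lmodType R).
Variable g : forall i j, {linear L i -> Y j}.
Hypothesis g_shape : forall i j x, i != j + 1 -> g i j x = 0.
Hypothesis g_cyc : forall i j x, cyc (g i j x).

Fact tw_linear i j : linear (fun p : Y i * L i => (diff Y i j p.1 + g i j p.2, 0 : L j)).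
Proof.
move=> a [y l] [y' l'] /=; rewrite !linearP /=; congr (_, _).
  by rewrite /= scalerDr addrACA.
by rewrite /= scaler0 addr0.
Qed.

(* An extension of the complex [L], with zero differential, by [Y]; the map [g] has
   degree -1. *)
Program Definition tw : complex R :=
  @Complex R (fun i => (Y i * L i)%type) (fun i j => mklinear (@tw_linear i j)) _ _.
Next Obligation. by move=> i j [y l] ij /=; rewrite diff_shape // g_shape // addr0. Qed.
Next Obligation.
by move=> i j k [y l] /=; rewrite raddfD /= diff_diff add0r g_cyc raddf0 addr0.
Qed.

Program Definition tw_in : chain_map Y tw :=
  @ChainMap _ _ _ (fun i => linl (Y i) (L i)) _.
Next Obligation. by move=> i j x /=; rewrite raddf0 addr0. Qed.

Program Definition tw_out : chain_map tw (zcx L) :=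
  @ChainMap _ _ _ (fun i => lsnd (Y i) (L i)) _.
Next Obligation. by []. Qed.

Lemma tw_sesc : sesc tw_in tw_out.
Proof.
move=> i; split=> [x y [] //|[y l]|l]; last by exists (0, l).
by split=> [/= ->|[x <-] //]; exists y.
Qed.

End TwistedSum.

Section TwistedSumMap.
Variables (R : comNzRingType) (L : int -> lmodType R) (Y N : complex R).
Variable p : chain_map Y N.
Variable g : forall i j, {linear L i -> Y j}.
Hypothesis g_shape : forall i j x, i != j + 1 -> g i j x = 0.
Hypothesis g_cyc : forall i j x, cyc (g i j x).

Fact pg_shape i j x : i != j + 1 -> lcomp (p j) (g i j) x = 0.
Proof. by move=> ij; rewrite /= g_shape // raddf0. Qed.
Fact pg_cyc i j x : cyc (lcomp (p j) (g i j) x).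
Proof. exact: cyc_map. Qed.

Program Definition tw_map : chain_map (tw g_shape g_cyc) (tw pg_shape pg_cyc) :=
  @ChainMap _ _ _ (fun i => lpair (lcomp (p i) (lfst (Y i) (L i))) (lsnd (Y i) (L i))) _.
Next Obligation. by move=> i j [y l] /=; rewrite raddfD /= cmap_diff. Qed.

Lemma tw_map_sesc K (f : chain_map K Y) : sesc f p ->
  sesc (chain_comp (tw_in g_shape g_cyc) f) tw_map.
Proof.
move=> s i; have [fI fp pS] := s i; split=> [|[y l]|[n l]].
- by move=> x y [/fI].
- split=> [[/fp[x <-] ->]|[x [<- <-]]]; first by exists x.
  by rewrite /= (ses_gf _ (s i)).
- by have [y yE] := pS n; exists (y, l); rewrite /= yE.
Qed.

End TwistedSumMap.

(** The new layer is the last quotient. The first layer [K] of [Y] stays a subcomplex, with quotient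
    the twisted sum over [N]. *)
Lemma filt_tw (R : comNzRingType) n (Y : complex R) (L : int -> lmodType R)
    (g : forall i j, {linear L i -> Y j})
    (g_shape : forall i j x, i != j + 1 -> g i j x = 0)
    (g_cyc : forall i j x, cyc (g i j x)) :
  bounded_family L -> (forall i, gorenstein_injective (L i)) -> filt n Y ->
  filt n.+1 (tw g_shape g_cyc).
Proof.
move=> Lb LG; elim: n Y g g_shape g_cyc => [|n IHn] Y g gS gc.
  move=> GY; exists Y, (zcx L), (tw_in gS gc), (tw_out gS gc); split.
  - exact: GY.
  - have GL : gi_layer (zcx L) by exists L.
    exact: GL.
  - exact: tw_sesc.
move=> [K [N [f [p [GK FN s]]]]].
exists K, (tw (pg_shape p gS) (pg_cyc p gc)), (chain_comp (tw_in gS gc) f), (tw_map p gS gc).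
by split=> //; [apply: IHn|apply: tw_map_sesc].
Qed.

(** * The fibre of a map to a complex with zero differential *)

Section Step.
Variables (R : comNzRingType) (M : complex R) (L : int -> lmodType R).
Variable phi : forall i, {linear M i -> L i}.
Hypothesis phi_bnd : forall i x, bnd x -> phi i x = 0.

Lemma transfer_phi i j x : transfer L i j (phi i x) = phi j (transfer M i j x).
Proof.
have [<-|ij] := eqVneq i j; first by rewrite !transfer_id.
by rewrite !transfer_neq ?raddf0.
Qed.

Lemma phi_transfer_diff i j k x : phi k (transfer M j k (diff M i j x)) = 0.
Proof.
by rewrite -transfer_phi phi_bnd ?raddf0 //; exists i, x.
Qed.

Fact fib_linear i j : linear (fun p : L (i + 1) * M i =>
  (phi (j + 1) (transfer M i (j + 1) p.2), diff M i j p.2)).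
Proof. by move=> a [l x] [l' x'] /=; rewrite !linearP. Qed.

Program Definition fib : complex R :=
  @Complex R (fun i => (L (i + 1) * M i)%type) (fun i j => mklinear (@fib_linear i j)) _ _.
Next Obligation.
by move=> i j [l x] ij /=; rewrite transfer_neq // raddf0 diff_shape.
Qed.
Next Obligation.
by move=> i j k [l x] /=; rewrite phi_transfer_diff diff_diff.
Qed.

Variables (X : complex R) (h : chain_map fib X).
Hypothesis h_qiso : quasi_iso h.

Definition att i j : {linear L i -> X j} :=
  lcomp (h j) (lcomp (linl (L (j + 1)) (M j)) (transfer L i (j + 1))).

Fact att_shape i j x : i != j + 1 -> att i j x = 0.
Proof. by move=> ij; rewrite /att /= transfer_neq // -/(0 : fib j) raddf0. Qed.

Lemma cyc_inl j (l : L (j + 1)) : cyc ((l, 0) : fib j).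
Proof. by move=> k; rewrite /= !raddf0. Qed.

Fact att_cyc i j x : cyc (att i j x).
Proof. exact/cyc_map/cyc_inl. Qed.

(** [M] is an extension of [L] by its fibre up to quasi-isomorphism; here the fibre is replaced by a
    model [X]. *)
Definition att_cx : complex R := tw att_shape att_cyc.

Fact att_map_linear i : linear (fun x : M i => (h i (0, x), - phi i x) : att_cx i).
Proof.
move=> a x y; rewrite !linearP /=; congr (_, _).
have -> : (0, a *: x + y) = a *: ((0, x) : fib i) + (0, y).
  by congr (_, _); rewrite /= scaler0 addr0.
exact: linearP.
Qed.

(** [x |-> h (0, x)] fails to be a chain map by the term [h (phi x, 0)], which the second coordinate
    [- phi x] cancels. *)
Program Definition att_map : chain_map M att_cx :=
  @ChainMap _ _ _ (fun i => mklinear (@att_map_linear i)) _.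
Next Obligation.
move=> i j x /=; rewrite phi_bnd ?oppr0; last by exists i, x.
congr (_, _); rewrite raddfN /= transfer_phi.
have -> : diff X i j (h i (0, x)) = h j (diff fib i j (0, x)) by rewrite cmap_diff.
rewrite -raddfD; congr (h j _).
by congr (_, _); rewrite /= ?subrr ?addr0.
Qed.

Lemma att_qiso : quasi_iso att_map.
Proof.
apply/qisoP => i; split=> [x cx|[x l] cxl].
  move=> /(bndP _ erefl)[[y l] /= [yE /esym/eqP]]; rewrite oppr_eq0 => /eqP px.
  have [hi _] := proj1 (qisoP h) h_qiso i.
  have /hi : cyc ((- transfer L (i + 1) (i + 1) l, x) : fib i).
    move=> j; rewrite /= cx; congr (_, _).
    by rewrite -transfer_phi px raddf0.
  have bh : bnd (h i (- transfer L (i + 1) (i + 1) l, x)).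
    exists (i + 1), y; rewrite -[LHS](addrK (att (i + 1) i l)) yE /att /= -raddfB.
    by congr (h i _); congr (_, _); rewrite /= ?sub0r ?subr0.
  by move=> /(_ bh)[j [[e n] [_ nE]]]; exists j, n.
have hqi := proj1 (qisoP h) h_qiso.
have i1 : i = i - 1 + 1 by rewrite subrK.
have phi0 m : cyc ((0, m) : fib i) -> phi i m = 0 /\ cyc m.
  move=> cm; split=> [|j]; last exact: (congr1 snd (cm j)).
  have := congr1 fst (cm (i - 1)); rewrite /= -transfer_phi => E.
  by rewrite -[LHS](transferK _ i1) E raddf0.
(* The cycle condition makes the image of [l] in [X] a boundary, so [(l, 0)] bounds in the fibre,
   and this means that [l] comes from a cycle of [M]. Adding the image of [m] leaves the cycle [x']
   of [X]. *)
have [m [lm cm]] : exists m, l = phi i m /\ cyc m.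
  pose e0 : fib (i - 1) := (transfer L i (i - 1 + 1) l, 0).
  have /(proj1 (hqi _) _ (cyc_inl _)) : bnd (h (i - 1) e0).
    exists i, (- x); rewrite raddfN; apply/eqP; rewrite eq_sym -subr_eq0 opprK.
    by apply/eqP; apply: etrans (congr1 fst (cxl (i - 1))); apply: addrC.
  move=> /(bndP _ i1)[[e m] E]; exists m; split.
    have E1 := congr1 fst E; rewrite /= -transfer_phi in E1.
    by rewrite -[LHS](transferK _ i1) -E1 transferK.
  by apply/(cycP _ i1); apply: (congr1 snd E).
pose x' := x + h i (0, m).
have cx' : cyc x'.
  move=> j; have /= := congr1 fst (cxl j); rewrite /x' raddfD /= lm transfer_phi => E.
  have -> : diff X i j (h i (0, m)) = h j (diff fib i j (0, m)) by rewrite cmap_diff.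
  by rewrite -[RHS]E /= cm.
have [[e m'] cf [k [z zE]]] := proj2 (hqi i) _ cx'.
have [pm' cm'] : phi i m' = 0 /\ cyc m'.
  by apply: phi0 => j; have := cf j; rewrite /=.
exists (m' - m); first exact: (lsubB (cyc_lsub M i)).
apply/(bndP _ erefl).
have /(bndP _ erefl)[z' z'E] : bnd (x' - h i (e, m')) by exists k, z.
have pE : phi i (m' - m) = - l by rewrite raddfB /= pm' sub0r -lm.
exists (z', e); rewrite /= z'E transfer_id pE opprK.
congr (_, _); rewrite /= ?subrr // /x'.
have -> : (0, m' - m) = ((0, m') : fib i) - (0, m) by congr (_, _); rewrite /= subrr.
have -> : ((e, m') : fib i) = ((e, 0) : fib i) + (0, m').
  by congr (_, _); rewrite /= ?addr0 ?add0r.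
rewrite raddfB raddfD /=.
move: (h i (e, 0)) (h i (0, m')) (h i (0, m)) => a b c.
by rewrite opprB opprD -!addrA; congr (x + (c + _)); rewrite [- b + a]addrC addKr.
Qed.

End Step.

(** * Homology up to isomorphism, and the homology of the fibre *)

Section HomologyModels.
Variable R : comNzRingType.
Implicit Types (M X F : complex R) (H V L : lmodType R).
Local Notation GI := (@gorenstein_injective R).

(* [rho] exhibits [H] as the quotient of the cycles of degree [i] by the boundaries. *)
Definition isH M i H (rho : M i -> H -> Prop) : Prop :=
  [/\ linrel rho, forall x, cyc x <-> exists v, rho x v, forall v, exists x, rho x v
    & forall x v, rho x v -> (v = 0 <-> bnd x)].

Definition hasH M i H : Prop := exists rho, @isH M i H rho.

Lemma isH_homology M i :
  isH (fun x (h : homology M i) => exists z : cycles M i,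
    ker_val z = x /\ Defs.mpi (in_boundaries_submod M i) z = h).
Proof.
have pL : linear (Defs.mpi (in_boundaries_submod M i)).
  by move=> a' u v; rewrite mpiD -(mquot_scale_pi (in_boundaries_submod M i)).
pose p := mklinear pL.
have i1 : i = i - 1 + 1 by rewrite subrK.
split=> [|x|v|_ _ [z [<- <-]]].
- split=> [|a _ _ _ _ [z [<- <-]] [w [<- <-]]].
    by exists 0; split=> //; apply: (raddf0 p).
  by exists (a *: z + w); split=> //; apply: (linearP p).
- split=> [/(cycP _ i1)/lkerP[z <-]|[v [z [<- _]]]].
    by exists (p z), z.
  by apply/(cycP _ i1); apply: kerP.
- by exists (ker_val (mrepr v)), (mrepr v); split=> //; apply: mreprK.
- have -> : (Defs.mpi (in_boundaries_submod M i) z = 0) <->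
    (Defs.mpi (in_boundaries_submod M i) z = Defs.mpi (in_boundaries_submod M i) 0).
    by rewrite -(raddf0 p).
  rewrite mpi_eq subr0 inE; split=> [/asboolP[y yE]|/(bndP _ erefl) yE]; last exact/asboolP.
  by exists (i + 1), y.
Qed.

Lemma hasH_homology M i : hasH M i (homology M i).
Proof. by eexists; apply: isH_homology. Qed.

Lemma isH_trivial M i H rho : @isH M i H rho -> (forall x : M i, cyc x -> bnd x) ->
  forall v : H, v = 0.
Proof.
move=> [_ cP vP bP] cb v; have [x xv] := vP v; apply/(bP _ _ xv)/cb/cP.
by exists v.
Qed.

Definition trivial_module V : Prop := forall x : V, x = 0.

Lemma trivial_GI V : trivial_module V -> GI V.
Proof. by move=> V0; apply/injective_GI/injective_module_trivial. Qed.

(* [phi] induces an embedding of [H_i(M)] into [L], with cokernel of dimension at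
   most [n]. *)
Definition hull n M i (L : lmodType R) (phi : {linear M i -> L}) : Prop :=
  exists H V rho (e : {linear H -> L}) (v : {linear L -> V}),
    [/\ @isH M i H rho, ses e v, idg n V & forall x u, rho x u -> phi x = e u].

Lemma hull_bnd n M i L phi : @hull n M i L phi -> forall x, bnd x -> phi x = 0.
Proof.
move=> [H [V [rho [e [v [[_ cP _ bP] _ _ rP]]]]]] x bx.
have /cP[u xu] := bnd_cyc bx; rewrite (rP _ _ xu).
by have /(bP _ _ xu) -> := bx; rewrite raddf0.
Qed.

Lemma hull_ex n M i H rho : @isH M i H rho -> idg n.+1 H ->
  exists L (phi : {linear M i -> L}),
    [/\ injective_module L, hull n phi & trivial_module H -> trivial_module L].
Proof.
move=> rH; have [rL cP vP bP] := rH => -[I [V [f [g [Ii Vn s]]]]].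
have ext L (e : {linear H -> L}) : injective_module L ->
    exists phi : {linear M i -> L}, forall x u, rho x u -> phi x = e u.
  move=> Li; have [||phi phiP] := @inj_rel R L (M i) (fun x l => exists2 u, rho x u & l = e u) Li.
  - split=> [|a x y _ _ [u xu ->] [w yw ->]]; first by exists 0; rewrite ?raddf0 //; case: rL.
    by exists (a *: u + w); rewrite ?linearP //; apply: (proj2 rL).
  - move=> _ [u ru ->]; have /(bP _ _ ru) -> : bnd (0 : M i); last exact: raddf0.
    by case: (bnd_lsub M i).
  by exists phi => x u xu; apply: phiP; exists u.
(* Where the homology vanishes the zero module is taken, so that the family of hulls is bounded. *)
have [H0|H0] := pselect (trivial_module H).
  exists (module0 R); have Z0 := injective_module_trivial (@module0_eq R).
  have [phi phiP] := ext (module0 R) \0 Z0; exists phi; split=> // [|_]; last exact: module0_eq.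
  exists H, (module0 R), rho, \0, idfun; split=> //; first exact: id_ses.
  exact: injective_idg.
have [phi phiP] := ext I f Ii; exists I, phi; split=> //.
by exists H, V, rho, f, g.
Qed.

Section Fib.
Variables (M : complex R) (L : int -> lmodType R)
  (phi : forall i, {linear M i -> L i}).
Hypothesis phi_bnd : forall i x, bnd x -> phi i x = 0.
Local Notation F := (fib phi_bnd).

Lemma fib_cyc i (e : L (i + 1)) (m : M i) : cyc ((e, m) : F i) <-> phi i m = 0 /\ cyc m.
Proof.
have i1 : i = i - 1 + 1 by rewrite subrK.
split=> [cm|[pm cm] j]; last by rewrite /= -transfer_phi pm raddf0 cm.
split=> [|j]; last exact: (congr1 snd (cm j)).
have := congr1 fst (cm (i - 1)); rewrite /= -transfer_phi => E.
by rewrite -[LHS](transferK _ i1) E raddf0.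
Qed.

Lemma fib_bnd i (e : L (i + 1)) (m : M i) :
  bnd ((e, m) : F i) <-> exists m', phi (i + 1) m' = e /\ diff M (i + 1) i m' = m.
Proof.
split=> [/(bndP _ erefl)[[e' m'] E]|[m' [<- <-]]].
  exists m'; split; last exact: (congr1 snd E).
  by have := congr1 fst E; rewrite /= transfer_id.
by exists (i + 1), (0, m'); rewrite /= transfer_id.
Qed.

Lemma fib_trivial i : trivial_module (L (i + 1)) -> trivial_module (M i) ->
  trivial_module (F i).
Proof. by move=> L0 M0 [l x]; rewrite (L0 l) (M0 x). Qed.

Lemma fib_isH_far i H rho : trivial_module (L (i + 1)) -> trivial_module (L i) ->
  @isH M i H rho -> isH (fun (x : F i) v => rho x.2 v).
Proof.
move=> L1 L0 [rL cP vP bP]; split=> [|[e m]|v|[e m] v /bP ->].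
- split; first by case: rL.
  by move=> a [e m] [e' m'] u v; apply: (proj2 rL).
- by rewrite fib_cyc /= -cP; split=> [[]//|]; split=> //; apply: L0.
- by have [x xv] := vP v; exists (0, x).
- rewrite fib_bnd; split=> [/(bndP _ erefl)[m' m'E]|[m' [_ <-]]].
    by exists m'; split=> //; apply: etrans (L1 _) (esym (L1 _)).
  by exists (i + 1), m'.
Qed.

(** The long exact sequence: [phi] is injective on homology, so [H_i] of the fibre is the cokernel
    of [H_(i+1)(M) -> L (i + 1)]. A cycle [(l, m)] has [m = d m'], and its class is that of
    [l - phi m']. *)
Lemma fib_isH_hull n i : hull n (phi i) -> hull n (phi (i + 1)) ->
  exists V, hasH F i V /\ idg n V.
Proof.
move=> [H0 [V0 [r0 [e0 [v0 [[r0L c0P _ b0P] [e0I _ _] _ phi0]]]]]].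
move=> [H [V [rho [e [v [[rL cP uP bP] s Vn phi1]]]]]]; have [eI ev vS] := s.
exists V; split=> //; exists (fun (x : F i) w => phi i x.2 = 0 /\
  exists m', diff M (i + 1) i m' = x.2 /\ w = v (x.1 - phi (i + 1) m')).
have v_cyc m : cyc m -> v (phi (i + 1) m) = 0.
  by move=> /cP[u mu]; rewrite (phi1 _ _ mu) (ses_gf _ s).
have bnd0 m : cyc m -> phi i m = 0 -> bnd m.
  move=> /c0P[u mu] pm; apply/(b0P _ _ mu); apply: (inj0 e0I).
  by rewrite -(phi0 _ _ mu).
split=> [|[l m]|w|[l m] w /= [pm [m' [m'E ->]]]].
- split=> [|a [l m] [l' m'] _ _ /= [pm [n1 [n1E ->]]] [pm' [n2 [n2E ->]]]].
    split; first exact: raddf0.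
    by exists 0; rewrite !raddf0 addr0 raddf0.
  split; first by rewrite linearP pm pm' scaler0 addr0.
  exists (a *: n1 + n2); split; first by rewrite linearP n1E n2E.
  by rewrite -linearP; congr (v _); rewrite (linearP (phi (i + 1))) scalerBr opprD addrACA.
- rewrite fib_cyc /=; split=> [[pm cm]|[w [pm [m' [m'E _]]]]]; last first.
    by split=> //; rewrite -m'E; apply: cyc_diff.
  have /(bndP _ erefl)[m' m'E] := bnd0 m cm pm.
  by exists (v (l - phi (i + 1) m')); split=> //; exists m'.
- have [l <-] := vS w; exists (l, 0); split; first exact: raddf0.
  by exists 0; rewrite !raddf0 addr0.
- rewrite fib_bnd ev; split=> [[u uE]|[m'' [<- m''E]]].
    have [x xu] := uP u; exists (m' + x).
    have cx : cyc x by apply/cP; exists u.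
    rewrite !raddfD /= (phi1 _ _ xu) uE cx addr0 m'E; split=> //.
    by rewrite addrCA subrr addr0.
  apply/ev; rewrite -raddfB /=; apply: v_cyc => j; have [->|ij] := eqVneq j i.
    by rewrite raddfB /= m''E m'E subrr.
  by rewrite diff_shape //; apply: contra ij => /eqP/addIr ->.
Qed.

(** The long exact sequence at a degree where [L] vanishes: all of [H_i(M)] survives and the
    cokernel [V] is added below it. *)
Lemma fib_ses n i H rho : trivial_module (L i) -> hull n (phi (i + 1)) ->
  @isH M i H rho ->
  exists V (a : {linear V -> homology F i}) (b : {linear homology F i -> H}),
    idg n V /\ ses a b.
Proof.
move=> L0 [H1 [V [r1 [e [v [[r1L c1P u1P b1P] s Vn phi1]]]]]] [rL cP hP bP].
have [eI ev vS] := s.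
have [r2L c2P k2P b2P] := isH_homology F i.
set r2 := (fun x (h : homology F i) => _) in r2L c2P k2P b2P.
have [||w [l [lw /b2P k0]]|a aP] := @linrel_fun R V (homology F i)
    (fun w k => exists l, v l = w /\ r2 (l, 0) k).
- split=> [|a _ _ k k' [l [<- lk]] [l' [<- lk']]].
    by exists 0; rewrite raddf0; split=> //; case: r2L.
  exists (a *: l + l'); rewrite linearP; split=> //.
  have := proj2 r2L a _ _ _ _ lk lk'.
  by congr (r2 _ _); congr (_, _); rewrite /= scaler0 addr0.
- move=> w; have [l <-] := vS w.
  have /c2P[k lk] : cyc ((l, 0) : F i).
    by apply/fib_cyc; rewrite raddf0; split=> //; case: (cyc_lsub M i).
  by exists k, l.
- apply/k0/fib_bnd; have /ev[u uE] := lw; have [x xu] := u1P u.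
  exists x; rewrite (phi1 _ _ xu) uE; split=> //.
  have cx : cyc x by apply/c1P; exists u.
  exact: cx.
have bnd2 (x : F i) : bnd x -> bnd x.2.
  by case: x => l x /fib_bnd[m' [_ <-]]; exists (i + 1), m'.
have [||h [[l m] [/= k0 mh]]|b bP'] := @linrel_fun R (homology F i) H
    (fun k h => exists x : F i, r2 x k /\ rho x.2 h).
- split=> [|c k k' h h' [x [xk xh]] [x' [xk' xh']]].
    by exists 0; split; [case: r2L|case: rL].
  by exists (c *: x + x'); split; [apply: (proj2 r2L)|apply: (proj2 rL)].
- move=> k; have [[l m] xk] := k2P k.
  have /fib_cyc[_ /cP[h mh]] : cyc ((l, m) : F i) by apply/c2P; exists k.
  by exists h, (l, m).
- by apply/(bP _ _ mh)/(bnd2 (l, m))/(b2P _ _ k0).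
have rho0 h : rho 0 h -> h = 0.
  by move=> /bP ->; case: (bnd_lsub M i).
exists V, a, b; split=> //; split=> [|k|h].
- apply: linear_inj => w aw.
  have /aP[l [<- l0]] : a w = 0 by [].
  have /(b2P _ _ l0)/fib_bnd[m' [<- m'0]] : (0 : homology F i) = 0 by [].
  have /c1P[u mu] : cyc m'.
    by apply/(cycP _ erefl).
  by rewrite (phi1 _ _ mu) (ses_gf _ s).
- split=> [/bP'[[l m] [xk /= mh]]|[w <-]].
    have /(bP _ _ mh)/(bndP _ erefl)[m' m'E] : (0 : H) = 0 by [].
    exists (v (l - phi (i + 1) m')).
    apply/aP; exists (l - phi (i + 1) m'); split=> //.
    have r0 : r2 (phi (i + 1) m', m) 0.
      have bm : bnd ((phi (i + 1) m', m) : F i) by apply/fib_bnd; exists m'.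
      have /c2P[k' k'E] := bnd_cyc bm.
      by have /(b2P _ _ k'E) <- := bm.
    have := proj2 r2L (-1) _ _ _ _ r0 xk; rewrite scaler0 add0r.
    congr (r2 _ _); rewrite scaleN1r addrC; congr (_, _); exact: subrr.
  have [l [lw lk]] : exists l, v l = w /\ r2 (l, 0) (a w) by apply/aP.
  apply/bP'; exists (l, 0); split=> //=; exact: (proj1 rL).
- have [x xh] := hP h.
  have /c2P[k xk] : cyc ((0, x) : F i).
    by apply/fib_cyc; split; [apply: L0|apply/cP; exists h].
  by exists k; apply/bP'; exists (0, x).
Qed.

End Fib.
End HomologyModels.

(** * Filtration by Gorenstein injective layers *)

Section UpperBound.
Variable R : comNzRingType.
Implicit Types (M X F : complex R) (H V L B Q A : lmodType R).
Local Notation GI := (@gorenstein_injective R).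

Definition good X i : Prop :=
  exists B Q (b : {linear B -> X i}) (q : {linear X i -> Q}),
    [/\ GI B, GI Q, ses b q & forall x, bnd x <-> exists y, b y = x].

Definition supported X (a s : int) : Prop :=
  forall i, (i < a) || (s < i) -> trivial_module (X i).

(** The differential vanishes on the boundaries and maps into them, so the subcomplex of boundaries
    and its quotient both have zero differential. *)
Lemma good_filt X a s : (forall i, good X i) -> supported X a s -> filt 1 X.
Proof.
move=> gX Xas.
have gi i : {B : lmodType R & {Q : lmodType R & {b : {linear B -> X i} &
    {q : {linear X i -> Q} | [/\ GI B, GI Q, ses b q & forall x, bnd x <-> exists y, b y = x]}}}}.
  have /cid[B /cid[Q /cid[b /cid[q H]]]] := gX i.
  by exists B, Q, b, q.
pose B i := projT1 (gi i); pose Q i := projT1 (projT2 (gi i)).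
pose b i : {linear B i -> X i} := projT1 (projT2 (projT2 (gi i))).
pose q i : {linear X i -> Q i} := sval (projT2 (projT2 (projT2 (gi i)))).
have gP i : [/\ GI (B i), GI (Q i), ses (b i) (q i) & forall x, bnd x <-> exists y, b i y = x].
  by rewrite /b /q /B /Q; case: (gi i) => B0 [Q0 [b0 [q0 H]]].
have bd i j x : b j (diff (zcx B) i j x) = diff X i j (b i x).
  rewrite raddf0; have [_ _ _ bP] := gP i.
  by apply/esym/bnd_cyc/bP; exists x.
have qd i j x : q j (diff X i j x) = diff (zcx Q) i j (q i x).
  have [_ _ s' bP] := gP j; have /bP[y <-] : bnd (diff X i j x) by exists i, x.
  exact: (ses_gf _ s').
have bf (A : int -> lmodType R) : (forall i, trivial_module (X i) -> trivial_module (A i)) ->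
    bounded_family A.
  move=> AX; exists a, (`|s - a| + 1)%N => i ias; apply/AX/Xas; lia.
exists (zcx B), (zcx Q), (@ChainMap _ (zcx B) X b bd), (@ChainMap _ X (zcx Q) q qd); split.
- exists B; split=> // [|i]; last by have [] := gP i.
  apply: bf => i X0 y; have [_ _ [bI _ _] _] := gP i.
  by apply: (inj0 bI); apply: X0.
- have GQ : gi_layer (zcx Q); last exact: GQ.
  exists Q; split=> // [|i]; last by have [] := gP i.
  apply: bf => i X0 y; have [_ _ [_ _ qS] _] := gP i.
  by have [x <-] := qS y; rewrite (X0 x) raddf0.
- by move=> i; have [] := gP i.
Qed.

Definition exact_above M (s : int) : Prop := forall i, s < i -> forall x : M i, cyc x -> bnd x.

Definition layered M a s : Prop := exists X (h : chain_map M X),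
  [/\ quasi_iso h, forall i, good X i & supported X a s].

Lemma trivial_good_GI X i : good X i -> (forall x : X i, bnd x -> x = 0) -> GI (X i).
Proof.
move=> [B [Q [b [q [GB GQ s bP]]]]] X0; apply: (GI_ext s _ GQ).
apply: trivial_GI => y; have [bI _ _] := s.
by apply: (inj0 bI); apply/X0/bP; exists y.
Qed.

Lemma good_pair (B Q X1 L1 : lmodType R) (b : {linear B -> X1}) (q : {linear X1 -> Q}) :
  ses b q -> ses (lcomp (linl X1 L1) b) (lpair (lcomp q (lfst X1 L1)) (lsnd X1 L1)).
Proof.
move=> s; have [bI bq qS] := s; split=> [|[x l]|[z l]].
- by move=> x y [/bI].
- split=> [[/bq[y <-] /= ->]|[y [<- <-]]]; first by exists y.
  by rewrite /= (ses_gf _ s).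
- by have [x xE] := qS z; exists (x, l); rewrite /= xE.
Qed.

(** As [X] ends in degree [s - 1], it has no boundaries there and its term is Gorenstein injective.
    Attaching [L s] creates boundaries in that degree alone: the image of [L s], isomorphic to the
    cokernel [V] of the hull. The quotient by [V] is Gorenstein injective by [GI_coker]. *)
Lemma layered_step M a s (L : int -> lmodType R) (phi : forall i, {linear M i -> L i})
    (phi_bnd : forall i x, bnd x -> phi i x = 0) :
  (forall i, injective_module (L i)) -> (forall i, i = s -> hull 0 (phi i)) ->
  (forall i, i != s -> trivial_module (L i)) -> a <= s ->
  layered (fib phi_bnd) a (s - 1) -> layered M a s.
Proof.
move=> Li Lh L0 as_ [X [h [hq gX Xas]]].
exists (att_cx h), (att_map h); split; first exact: att_qiso.
- move=> j; have [B [Q [b [q [GB GQ s1 bP]]]]] := gX j.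
  have bndE x l : bnd ((x, l) : att_cx h j) <->
      l = 0 /\ exists x1 l1, x = diff X (j + 1) j x1 + h j (l1, 0).
    split=> [/(bndP _ erefl)[[x1 l1] E]|[-> [x1 [l1 ->]]]].
      split; first exact: (esym (congr1 snd E)).
      exists x1, l1; have := congr1 fst E.
      by rewrite /= transfer_id.
    by exists (j + 1), (x1, l1); rewrite /= transfer_id.
  have [js|js] := eqVneq (j + 1) s; last first.
    exists B, (Q * L j)%type, (lcomp (linl _ _) b), (lpair (lcomp q (lfst _ _)) (lsnd _ _)).
    split=> //; [|exact: good_pair|].
      by apply: GI_prod => //; apply: injective_GI.
    move=> [x l]; rewrite bndE; split=> [[-> [x1 [l1 ->]]]|[y [yx <-]]].
      have /bP[y yE] : bnd (diff X (j + 1) j x1) by exists (j + 1), x1.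
      exists y; rewrite /= yE (L0 _ js l1); congr (_, _).
      by rewrite -[in RHS]/(0 : fib phi_bnd j) raddf0 addr0.
    split=> //; have /(bndP _ erefl)[x1 x1E] : bnd x by apply/bP; exists y.
    exists x1, 0; rewrite x1E -[in RHS]/(0 : fib phi_bnd j) raddf0 addr0.
    by [].
  have [H [V [rho [e [v [[rL cP uP rbP] s2 Vn phi1]]]]]] := Lh _ js.
  have [eI ev vS] := s2.
  have X0 x : bnd (x : X j) -> x = 0.
    move=> /(bndP _ erefl)[y <-]; rewrite (Xas (j + 1) _ y) ?raddf0 //; lia.
  have cyc0 (l : L (j + 1)) : cyc ((l, 0) : fib phi_bnd j) by apply: cyc_inl.
  have [c cE] : exists c : {linear V -> X j}, forall l, c (v l) = h j (l, 0).
    apply: (desc (f := lcomp (h j) (linl (L (j + 1)) (M j)))) => // l /ev[u uE] /=.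
    have [m mu] := uP u; apply: X0; apply: (bnd_map h (x := ((l, 0) : fib phi_bnd j))).
    apply/fib_bnd; exists m.
    rewrite (phi1 _ _ mu) uE; split=> //.
    have cm : cyc m by apply/cP; exists u.
    exact: cm.
  have cI : injective c.
    apply: linear_inj => w; have [l <-] := vS w; rewrite cE => hl.
    have [hi _] := proj1 (qisoP h) hq j.
    have /fib_bnd[m [ml m0]] : bnd ((l, 0) : fib phi_bnd j).
      by apply: hi => //; rewrite hl; case: (bnd_lsub X j).
    have /cP[u mu] : cyc m by apply/(cycP _ erefl).
    by rewrite -ml (phi1 _ _ mu) (ses_gf _ s2).
  have [Q2 [q2 sc]] := coker_ex cI.
  have GX := trivial_good_GI (gX j) X0.
  exists V, (Q2 * L j)%type, (lcomp (linl _ _) c), (lpair (lcomp q2 (lfst _ _)) (lsnd _ _)).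
  split=> //; [|exact: good_pair|].
    by apply: GI_prod; [apply: GI_coker sc _ GX|apply: injective_GI].
  move=> [x l]; rewrite bndE; split=> [[-> [x1 [l1 ->]]]|[w [<- <-]]].
    exists (v l1); rewrite /= cE; congr (_, _).
    have -> : diff X (j + 1) j x1 = 0 by apply: X0; exists (j + 1), x1.
    by rewrite add0r.
  split=> //; have [l1 <-] := vS w; exists 0, l1.
  by rewrite cE raddf0 add0r.
- move=> i ias [x l]; rewrite (Xas i _ x) ?(L0 i _ l) //; lia.
Qed.

(** Every element of degree [s] is a cycle, so the projection of [M s] to its homology extends by
    zero to a quasi-isomorphism. *)
Lemma layered0 M s : (forall i, i < s -> trivial_module (M i)) -> exact_above M s ->
  (exists H, hasH M s H /\ GI H) -> layered M s s.
Proof.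
move=> M0 Ms [H [[rho [rL cP vP bP]] GH]].
have fam i : {A : lmodType R & {p : {linear M i -> A} | [/\ GI A,
    i = s -> surj p /\ forall x, p x = 0 <-> bnd x & i <> s -> trivial_module A]}}.
  have [is_|is_] := pselect (i = s); last first.
    exists (module0 R), \0; split=> //; first exact/trivial_GI/module0_eq.
    by move=> _; apply: module0_eq.
  have : exists (A : lmodType R) (p : {linear M i -> A}), [/\ GI A,
    i = s -> surj p /\ forall x, p x = 0 <-> bnd x & i <> s -> trivial_module A].
    subst i; have Mc (x : M s) : cyc x.
      apply/(cycP _ (esym (subrK 1 s))); apply: M0; lia.
    have [||p pP] := linrel_fun rL.
    - by move=> x; apply/cP.
    - move=> u /bP ->; by case: (bnd_lsub M s).
    exists H, p; split=> // _; split=> [v|x].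
      by have [x /pP xv] := vP v; exists x.
    by apply: bP; apply/pP.
  by move=> /cid[A /cid[p pP]]; exists A, p.
pose A i := projT1 (fam i); pose p i : {linear M i -> A i} := sval (projT2 (fam i)).
have [GA pS A0] : [/\ forall i, GI (A i), forall i, i = s -> surj (p i) /\
    (forall x, p i x = 0 <-> bnd x) & forall i, i <> s -> trivial_module (A i)].
  by split=> i; rewrite /A /p; case: (fam i) => ? [? []].
have pd i j x : p j (diff M i j x) = diff (zcx A) i j (p i x).
  have [/pS[_ pj]|/A0 Aj] := pselect (j = s); last exact: Aj.
  by apply/pj; exists i, x.
exists (zcx A), (@ChainMap _ M (zcx A) p pd); split.
- apply/qisoP => i; have [is_|is_] := pselect (i = s); last first.
    split=> [x cx _|y _].
      have [/M0 Mi|si] := boolP (i < s); first by exists i, 0; rewrite raddf0 (Mi x).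
      by apply: Ms cx; move: si is_; lia.
    exists 0; first by case: (cyc_lsub M i).
    by exists i, 0; rewrite (A0 i is_ y) !raddf0 addr0.
  have [pSi pi] := pS i is_; split=> [x _ [j [y yE]]|y _].
    by apply/pi.
  have [x xE] := pSi y; exists x; last by exists i, 0; rewrite xE subrr raddf0.
  by subst i; apply/(cycP _ (esym (subrK 1 s))); apply: M0; lia.
- move=> i; exists (module0 R), (A i), \0, idfun; split=> //.
  + exact/trivial_GI/module0_eq.
  + exact/id_ses/module0_eq.
  + by move=> x; split=> [[j [y <-]]|[y <-]]; [exists 0|exists i, 0].
- move=> i ias; apply: A0; lia.
Qed.

Lemma single_hull M s H : hasH M s H -> idg 1 H ->
  exists (L : int -> lmodType R) (phi : forall i, {linear M i -> L i}),
    [/\ forall i x, bnd x -> phi i x = 0, forall i, injective_module (L i),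
      forall i, i = s -> hull 0 (phi i) & forall i, i != s -> trivial_module (L i)].
Proof.
move=> [rho rH] H1.
have fam i : {L : lmodType R & {phi : {linear M i -> L} | [/\ forall x, bnd x -> phi x = 0,
    injective_module L, i = s -> hull 0 phi & i != s -> trivial_module L]}}.
  have [is_|is_] := pselect (i = s); last first.
    exists (module0 R), \0; split=> //.
    - exact/injective_module_trivial/module0_eq.
    - by move=> _; apply: module0_eq.
  have H2 : exists L (phi : {linear M i -> L}), [/\ forall x, bnd x -> phi x = 0,
      injective_module L, i = s -> hull 0 phi & i != s -> trivial_module L].
    subst i; have [L [phi [Li ph _]]] := hull_ex rH H1.
    by exists L, phi; split=> //; [apply: hull_bnd ph|rewrite eqxx].
  by have /cid[L /cid[phi phiP]] := H2; exists L, phi.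
exists (fun i => projT1 (fam i)), (fun i => sval (projT2 (fam i))).
by split=> i; case: (fam i) => ? [? []].
Qed.

(** [phi] is injective on the top homology, so the fibre has none in degree [s]. *)
Lemma fib_exact_above M s n (L : int -> lmodType R) (phi : forall i, {linear M i -> L i})
    (phi_bnd : forall i x, bnd x -> phi i x = 0) :
  exact_above M s -> (forall i, i = s -> hull n (phi i)) ->
  (forall i, s < i -> trivial_module (L i)) -> exact_above (fib phi_bnd) (s - 1).
Proof.
move=> Ms Lh L0 i si [l m] /fib_cyc[pm cm]; apply/fib_bnd.
have /(bndP _ erefl)[m' m'E] : bnd m.
  have [is_|is_] := eqVneq i s; last by apply: Ms cm; move: si is_; lia.
  have [H [V [rho [e [v [[rL cP uP bP] s2 Vn phi1]]]]]] := Lh _ is_.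
  move: cm => /cP[u mu]; apply/(bP _ _ mu); have [eI _ _] := s2.
  by apply: (inj0 eI); rewrite -(phi1 _ _ mu).
exists m'; split=> //; have L1 : trivial_module (L (i + 1)) by apply: L0; lia.
by rewrite (L1 l) (L1 (phi _ _)).
Qed.

(** Induction on the width, removing only the top homology each time. In degree [s - 1] the homology
    of the fibre is an extension of the old one by the Gorenstein injective cokernel, so its
    dimension remains at most one. The support grows by one degree at the bottom. *)
Lemma layered_idg1 k s M : (forall i, i < s - k%:Z -> trivial_module (M i)) ->
  exact_above M s -> (forall i, exists H, hasH M i H /\ idg 1 H) ->
  layered M (s - k%:Z - 1) s.
Proof.
elim: k s M => [|k IHk] s M M0 Ms MH; have [H [rH H1]] := MH s;
  have [L [phi [pb Li Lh L0]]] := single_hull rH H1; apply: (layered_step (phi_bnd := pb)) => //;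
  try lia.
- have -> : s - 0 - 1 = s - 1 by lia.
  apply: layered0.
  + by move=> i is_; apply: fib_trivial; [apply: L0; lia|apply: M0; lia].
  + by apply: fib_exact_above Ms Lh _ => i si; apply: L0; lia.
  (* [M] vanishes in degree [s - 1], so the fibre has only the cokernel of the hull as homology
     there. *)
  + have [H' [[rho' rH'] _]] := MH (s - 1).
    have Ls : trivial_module (L (s - 1)) by apply: L0; lia.
    have [V [a [b [GV sab]]]] := fib_ses pb Ls (Lh _ (subrK 1 s)) rH'.
    exists (homology (fib pb) (s - 1)); split; first exact: hasH_homology.
    apply: GI_ext sab GV _; apply: trivial_GI; apply: isH_trivial rH' _ => x _.
    by exists (s - 1), 0; rewrite raddf0 (M0 _ _ x) //; lia.
have -> : s - k.+1%:Z - 1 = s - 1 - k%:Z - 1 by lia.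
apply: IHk.
- by move=> i is_; apply: fib_trivial; [apply: L0; lia|apply: M0; lia].
- by apply: fib_exact_above Ms Lh _ => i si; apply: L0; lia.
move=> i; have [H' [[rho' rH'] H'1]] := MH i.
have [is_|is_] := eqVneq (i + 1) s.
  have Li0 : trivial_module (L i) by apply: L0; lia.
  have [V [a [b [GV sab]]]] := fib_ses pb Li0 (Lh _ is_) rH'.
  exists (homology (fib pb) i); split; first exact: hasH_homology.
  by apply: idg_ext sab _ H'1; apply: idgS.
have [is0|is0] := eqVneq i s; last first.
  exists H'; split=> //; eexists; apply: fib_isH_far rH'; exact: L0.
exists (homology (fib pb) i); split; first exact: hasH_homology.
apply: injective_idg; apply: injective_module_trivial.
apply: (isH_trivial (isH_homology (fib pb) i)).
by apply: (fib_exact_above Ms Lh); [move=> j sj; apply: L0; lia|lia].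
Qed.

Lemma filt_idg n M (t s : int) : (forall i, i < t -> trivial_module (M i)) ->
  exact_above M s -> (forall i, exists H, hasH M i H /\ idg n.+1 H) ->
  exists X (h : chain_map M X), quasi_iso h /\ filt n.+1 X.
Proof.
elim: n t M => [|n IHn] t M M0 Ms MH.
  have [|X [h [hq gX Xas]]] := @layered_idg1 `|s - t|%N s M _ Ms MH.
    by move=> i it; apply: M0; lia.
  by exists X, h; split=> //; apply: good_filt Xas.
have fam i : {L : lmodType R & {phi : {linear M i -> L} | [/\ hull n.+1 phi,
    injective_module L & (i < t) || (s < i) -> trivial_module L]}}.
  have H2 : exists L (phi : {linear M i -> L}), [/\ hull n.+1 phi,
      injective_module L & (i < t) || (s < i) -> trivial_module L].
    have [H [[rho rH] Hn]] := MH i.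
    have [L [phi [Li ph HL]]] := hull_ex rH Hn.
    exists L, phi; split=> // its; apply/HL/(isH_trivial rH) => x cx.
    move: its => /orP[/M0 Mi|si]; last exact: Ms si x cx.
    by exists i, 0; rewrite raddf0 (Mi x).
  by have /cid[L /cid[phi phiP]] := H2; exists L, phi.
pose L i := projT1 (fam i); pose phi i : {linear M i -> L i} := sval (projT2 (fam i)).
have [Lh Li L0] : [/\ forall i, hull n.+1 (phi i), forall i, injective_module (L i) &
    forall i, (i < t) || (s < i) -> trivial_module (L i)].
  by split=> i; rewrite /L /phi; case: (fam i) => ? [? []].
have pb i x : bnd x -> phi i x = 0 := hull_bnd (Lh i) (x := x).
(* [L t] sits in degree [t - 1] of the fibre. *)
have [|||X [h [hq FX]]] := IHn (t - 1) (fib pb).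
- by move=> i it; apply: fib_trivial; [apply: L0; lia|apply: M0; lia].
- have Fs : exact_above (fib pb) (s - 1).
    by apply: (fib_exact_above Ms (fun i _ => Lh i)) => j sj; apply: L0; lia.
  by move=> i si; apply: Fs; lia.
- by move=> i; apply: fib_isH_hull.
exists (att_cx h), (att_map h); split; first exact: att_qiso.
apply: filt_tw => //; last by move=> i; apply: injective_GI.
by exists t, (`|s - t| + 1)%N => i its; apply: L0; lia.
Qed.

(** The subcomplex with zero below [t], the cycles in degree [t] and all of [M] above. It makes the
    lower end literally zero, which the induction on fibres uses; at the upper end exactness
    suffices. *)
Lemma truncation M t : (forall i, i < t -> forall x : M i, cyc x -> bnd x) ->
  exists M' (f : chain_map M' M), quasi_iso f /\
    forall i, i < t -> trivial_module (M' i).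
Proof.
move=> Mt; pose S i (x : M i) := (i < t -> x = 0) /\ (i = t -> cyc x).
have SL i : lsub (@S i).
  split=> [|a x y [x1 x2] [y1 y2]]; first by split=> // _; case: (cyc_lsub M i).
  split=> it; first by rewrite x1 // y1 // scaler0 addr0.
  by apply: (proj2 (cyc_lsub M i)); [apply: x2|apply: y2].
have fam i : {A : lmodType R & {f : {linear A -> M i} | injective f /\
    forall x, S i x <-> exists a, f a = x}}.
  by have /cid[A /cid[f fP]] := sub_ex (SL i); exists A, f.
pose A i := projT1 (fam i); pose f i : {linear A i -> M i} := sval (projT2 (fam i)).
have [fI fS] : (forall i, injective (f i)) /\ forall i x, S i x <-> exists a, f i a = x.
  by split=> i; rewrite /A /f; case: (fam i) => ? [? []].
have Sd i j a : S j (diff M i j (f i a)).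
  have [f1 f2] : S i (f i a) by apply/fS; exists a.
  have [ij|ij] := eqVneq i (j + 1); last first.
    by rewrite diff_shape //; case: (SL j).
  split=> jt; last exact: cyc_diff.
  have [it|it] := eqVneq i t; first exact: f2.
  by rewrite f1 ?raddf0 //; move: it; lia.
have df i j : {d : {linear A i -> A j} | forall a, f j (d a) = diff M i j (f i a)}.
  apply: cid; apply: (factor (f := lcomp (diff M i j) (f i))) => // a.
  by apply/fS/Sd.
pose d i j := sval (df i j).
have dP i j a : f j (d i j a) = diff M i j (f i a) := svalP (df i j) a.
have dsh i j a : i != j + 1 -> d i j a = 0.
  by move=> ij; apply: (inj0 (fI j)); rewrite dP diff_shape.
have dd i j k a : d j k (d i j a) = 0.
  by apply: (inj0 (fI k)); rewrite !dP diff_diff.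
exists (Complex dsh dd), (@ChainMap _ (Complex dsh dd) M f dP); split; last first.
  by move=> i it a; apply: (inj0 (fI i)); have [/(_ it)] : S i (f i a) by apply/fS; exists a.
apply/qisoP => i; split=> [a ca /(bndP _ erefl)[y yE]|y cy].
  have [it|it] := boolP (i < t).
    exists i, 0; rewrite raddf0; apply: (fI i); rewrite raddf0.
    by have [/(_ it) ->] : S i (f i a) by apply/fS; exists a.
  have /fS[b bE] : S (i + 1) y by split=> i1; [lia|lia].
  by exists (i + 1), b; apply: (fI i); rewrite /= dP bE.
have [it|it] := boolP (i < t).
  exists 0; first by case: (cyc_lsub (Complex dsh dd) i).
  by rewrite raddf0 subr0; apply: Mt.
have /fS[a aE] : S i y by split=> //; lia.
exists a; last by exists i, 0; rewrite raddf0 -aE; apply/esym/subrr.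
by move=> j; apply: (inj0 (fI j)); rewrite /= dP aE; apply: cy.
Qed.

Lemma hasH_qiso M M' (f : chain_map M' M) i H : quasi_iso f -> hasH M i H -> hasH M' i H.
Proof.
move=> /qisoP/(_ i)[fi fs] [rho [rL cP vP bP]].
exists (fun x v => cyc x /\ rho (f i x) v); split=> [|x|v|x v [cx fxv]].
- split=> [|a x y u v [cx xu] [cy yv]].
    by split; [case: (cyc_lsub M' i)|rewrite raddf0; case: rL].
  by split; [apply: (proj2 (cyc_lsub M' i))|rewrite linearP; apply: (proj2 rL)].
- by split=> [cx|[v []//]]; have /cP[v xv] := cyc_map f cx; exists v.
- have [y yv] := vP v; have [|x cx yx] := fs y; first by apply/cP; exists v.
  exists x; split=> //; have /cP[w xw] := cyc_map f cx.
  suff -> : v = w by [].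
  apply/eqP; rewrite -subr_eq0; apply/eqP/(bP _ _ _)/yx.
  have := proj2 rL (-1) _ _ _ _ xw yv; rewrite !scaleN1r.
  by rewrite [- _ + y]addrC [- _ + v]addrC.
- rewrite (bP _ _ fxv); split=> [/fi|/bnd_map]; exact.
Qed.

Theorem thick_upper n M : (exists b : nat, forall i : int, (b < `|i|)%N ->
    forall x : M i, cyc x -> bnd x) ->
  (forall i, idg n.+1 (homology M i)) -> thick (@Defs.GI R) n.+2 M.
Proof.
move=> [b Mb] MH.
have [|M' [f [fq M'0]]] := @truncation M (- b%:Z); first by move=> i ib; apply: Mb; lia.
have [||X [h [hq FX]]] := @filt_idg n M' (- b%:Z) b%:Z M'0.
- move=> i ib x cx; have [fi _] := proj1 (qisoP f) fq i.
  by apply: fi => //; apply: Mb; [lia|apply: cyc_map].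
- move=> i; exists (homology M i); split=> //.
  by apply: hasH_qiso fq _; apply: hasH_homology.
apply: thickS_iso FX; apply: disom_trans (qiso_disom fq).
exact/disom_sym/qiso_disom/hq.
Qed.

End UpperBound.

(** * Koszul complexes and the lower bound *)

Section Koszul.
Variable R : comNzRingType.
Implicit Types (X Y Z K N : complex R).

Program Definition smul (x : R) Y : chain_map Y Y :=
  @ChainMap _ Y Y (fun i => lscale (Y i) x) _.
Next Obligation. by move=> x Y i j y /=; rewrite linearZ. Qed.

Definition kos1 (x : R) Y : complex R := cone (smul x Y).

Lemma kos1_diff x Y i j (y : Y i) (z : Y (i - 1)) :
  diff (kos1 x Y) i j (y, z) =
  (diff Y i j y + x *: transfer Y (i - 1) j z, - diff Y (i - 1) (j - 1) z).
Proof. by rewrite /= /cone_diff /= scaleN1r. Qed.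

Lemma kos1_cyc x Y i (y : Y i) (z : Y (i - 1)) :
  cyc ((y, z) : kos1 x Y i) <-> cyc z /\ diff Y i (i - 1) y + x *: z = 0.
Proof.
rewrite (cycP _ (esym (subrK 1 i))) kos1_diff transfer_id.
rewrite (cycP z (esym (subrK 1 (i - 1)))); split=> [[-> /eqP]|[dz ->]].
  by rewrite oppr_eq0 => /eqP ->.
by rewrite dz oppr0.
Qed.

Lemma kos1_bnd x Y i (y : Y i) (z : Y (i - 1)) :
  bnd ((y, z) : kos1 x Y i) <->
  exists a b, y = diff Y (i + 1) i a + x *: b /\ z = - diff Y i (i - 1) b.
Proof.
have i1 : i = i + 1 - 1 by rewrite addrK.
split=> [/(bndP _ erefl)[[a b]]|[a [b [-> ->]]]].
  rewrite kos1_diff => -[<- <-]; exists a, (transfer Y (i + 1 - 1) i b).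
  by rewrite diff_transfer.
exists (i + 1), (a, transfer Y i (i + 1 - 1) b).
by rewrite kos1_diff transferK // diff_transfer.
Qed.

Fact kmap1_linear x Y Z (f : chain_map Y Z) i :
  linear (fun p : kos1 x Y i => (f i p.1, f (i - 1) p.2) : kos1 x Z i).
Proof. by move=> a [y z] [y' z'] /=; rewrite !linearP. Qed.

Lemma transfer_map Y Z (f : chain_map Y Z) i j y :
  f j (transfer Y i j y) = transfer Z i j (f i y).
Proof.
have [<-|ij] := eqVneq i j; first by rewrite !transfer_id.
by rewrite !transfer_neq ?raddf0.
Qed.

Fact kmap1_diff x Y Z (f : chain_map Y Z) i j (p : kos1 x Y i) :
  mklinear (@kmap1_linear x Y Z f j) (diff (kos1 x Y) i j p) =
  diff (kos1 x Z) i j (mklinear (@kmap1_linear x Y Z f i) p).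
Proof.
case: p => y z; rewrite [RHS]kos1_diff kos1_diff.
by rewrite /= raddfD /= linearZ /= !raddfN /= !cmap_diff transfer_map.
Qed.

Definition kmap1 x Y Z (f : chain_map Y Z) : chain_map (kos1 x Y) (kos1 x Z) :=
  ChainMap (@kmap1_diff x Y Z f).

Lemma bndD X i (x y : X i) : bnd x -> bnd y -> bnd (x + y).
Proof. exact: (lsubD (bnd_lsub X i)). Qed.
Lemma bndN X i (x : X i) : bnd x -> bnd (- x).
Proof. exact: (lsubN (bnd_lsub X i)). Qed.
Lemma bndZ X i a (x : X i) : bnd x -> bnd (a *: x).
Proof. exact: (lsubZ a (bnd_lsub X i)). Qed.
Lemma bnd0 X i : bnd (0 : X i).
Proof. by case: (bnd_lsub X i). Qed.
Lemma bnd_diff X i j (x : X i) : bnd (diff X i j x).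
Proof. by exists i, x. Qed.
Lemma bnd_sym X i (x y : X i) : bnd (x - y) -> bnd (y - x).
Proof. by move=> /bndN; rewrite opprB. Qed.
Lemma bnd_trans X i (x y z : X i) : bnd (x - y) -> bnd (y - z) -> bnd (x - z).
Proof. by move=> xy yz; rewrite -[x](subrK y) -addrA; apply: bndD. Qed.
Lemma bnd_congr X i (x y : X i) : bnd (x - y) -> bnd y -> bnd x.
Proof. by move=> xy by_; rewrite -[x](subrK y); apply: bndD. Qed.

Lemma cycD X i (x y : X i) : cyc x -> cyc y -> cyc (x + y).
Proof. exact: (lsubD (cyc_lsub X i)). Qed.
Lemma cycB X i (x y : X i) : cyc x -> cyc y -> cyc (x - y).
Proof. exact: (lsubB (cyc_lsub X i)). Qed.
Lemma cycZ X i a (x : X i) : cyc x -> cyc (a *: x).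
Proof. exact: (lsubZ a (cyc_lsub X i)). Qed.
Lemma cyc0 X i : cyc (0 : X i).
Proof. by case: (cyc_lsub X i). Qed.

(** The five lemma for the cones of multiplication by [x], carried out on elements. *)
Lemma kmap1_qiso x Y Z (s : chain_map Y Z) : quasi_iso s -> quasi_iso (kmap1 x s).
Proof.
move=> /qisoP sq; apply/qisoP => i; have [si ss] := sq i; have [si1 ss1] := sq (i - 1).
have i1 : i = i - 1 + 1 by rewrite subrK.
split=> [[y z]|[a b]].
  move=> /kos1_cyc[cz yz] /kos1_bnd[a [b /= [sy sz]]].
  have /(bndP _ i1)[w wE] : @bnd R Y (i - 1) z.
    by apply: si1 => //; rewrite sz; apply/bndN/bnd_diff.
  have cbw : cyc (b + s i w).
    by apply/(cycP _ i1); rewrite raddfD /= -cmap_diff wE sz addrN.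
  have [c cc [k [e eE]]] := ss _ cbw.
  have /(bndP _ erefl)[f fE] : bnd (y + x *: w - x *: c).
    apply: si.
      apply: cycB; last exact: cycZ.
      by apply/(cycP _ i1); rewrite raddfD /= linearZ /= wE.
    rewrite raddfB raddfD /= !linearZ /= sy.
    have -> : diff Z (i + 1) i a + x *: b + x *: s i w + x *: - s i c =
        diff Z (i + 1) i a + x *: diff Z k i e.
      by rewrite eE !scalerDr !addrA.
    by apply: bndD; [|apply: bndZ]; apply: bnd_diff.
  apply/kos1_bnd; exists f, (c - w); rewrite fE scalerBr addrA subrK addrK.
  by split=> //; rewrite raddfB /= cc sub0r opprK wE.
move=> /kos1_cyc[cb ab].
have [c cc /(bndP _ i1)[e eE]] := ss1 _ cb.
have /(bndP _ i1)[f fE] : bnd (x *: c).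
  apply: si1; first exact: cycZ.
  exists i, (- (a + x *: e)).
  rewrite linearZ /= raddfN raddfD /= linearZ /= eE scalerBr addrA ab sub0r.
  exact: opprK.
have caf : cyc (a + x *: e + s i f).
  apply/(cycP _ i1); rewrite !raddfD /= -cmap_diff fE !linearZ /= eE.
  by rewrite scalerBr addrA ab sub0r addNr.
have [g cg /(bndP _ erefl)[h hE]] := ss _ caf.
exists (g - f, c).
  by apply/kos1_cyc; split=> //; rewrite raddfB /= cg sub0r fE addNr.
apply/kos1_bnd; exists h, (- e); split=> /=.
  rewrite hE raddfB /= scalerN opprB.
  by rewrite -!addrA; congr (a + _); rewrite [RHS]addrC -!addrA addNr addr0.
by rewrite [diff _ _ _ (- e)]raddfN /= opprK eE.
Qed.

Fixpoint kos (xs : seq R) Y : complex R := if xs is x :: xs' then kos1 x (kos xs' Y) else Y.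

Fixpoint kmap (xs : seq R) Y Z (f : chain_map Y Z) : chain_map (kos xs Y) (kos xs Z) :=
  if xs is x :: xs' then kmap1 x (kmap xs' f) else f.

Lemma kmap_qiso xs Y Z (s : chain_map Y Z) : quasi_iso s -> quasi_iso (kmap xs s).
Proof. by elim: xs => //= x xs IHxs /IHxs; apply: kmap1_qiso. Qed.

Lemma kmap_ext xs Y Z (f g : chain_map Y Z) : (forall i, f i =1 g i) ->
  forall i, kmap xs f i =1 kmap xs g i.
Proof.
by move=> fg; elim: xs => //= x xs IHxs i [y z] /=; rewrite !IHxs.
Qed.

Lemma kmap_id xs Y i y : kmap xs (chain_id Y) i y = y.
Proof. by elim: xs i y => //= x xs IHxs i [y z] /=; rewrite !IHxs. Qed.

Lemma kmap_comp xs X Y Z (g : chain_map Y Z) (f : chain_map X Y) i x :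
  kmap xs (chain_comp g f) i x = kmap xs g i (kmap xs f i x).
Proof. by elim: xs i x => //= a xs IHxs i [y z] /=; rewrite !IHxs. Qed.

(* [hrel xs f x y]: the map induced by [f] on the homology of the Koszul
   complexes sends the class of [x] to that of [y]. *)
Fixpoint hrel xs X Y (f : dhom X Y) i : kos xs X i -> kos xs Y i -> Prop :=
  match f in dhom X Y return kos xs X i -> kos xs Y i -> Prop with
  | DMap X Y f => fun x y => bnd (y - kmap xs f i x)
  | DInv X Y s _ => fun y x => bnd (y - kmap xs s i x)
  | DComp X Y Z g f => fun x z => exists y, [/\ cyc y, hrel f x y & hrel g y z]
  end.

Arguments hrel xs {X Y} f {i} _ _.

Lemma hrel_congr xs X Y (f : dhom X Y) i (x x' : kos xs X i) (y y' : kos xs Y i) :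
  bnd (x - x') -> bnd (y - y') -> hrel xs f x y -> hrel xs f x' y'.
Proof.
elim: f x x' y y' => {X Y} [X Y f|X Y s q|X Y Z g IHg f IHf] x x' y y' xx yy /=.
- move=> fxy; have := bnd_map (kmap xs f) xx; rewrite raddfB => fxx.
  exact: bnd_trans (bnd_trans (bnd_sym yy) fxy) fxx.
- move=> fxy; have := bnd_map (kmap xs s) yy; rewrite raddfB => syy.
  exact: bnd_trans (bnd_trans (bnd_sym xx) fxy) syy.
- move=> [z [cz xz zy]]; exists z; split=> //.
    by apply: IHf xz => //; rewrite subrr; apply: bnd0.
  by apply: IHg zy => //; rewrite subrr; apply: bnd0.
Qed.

Lemma hrel_total xs X Y (f : dhom X Y) i (x : kos xs X i) : cyc x ->
  exists2 y, cyc y & hrel xs f x y.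
Proof.
elim: f x => {X Y} [X Y f|X Y s q|X Y Z g IHg f IHf] x cx /=.
- exists (kmap xs f i x); first exact: cyc_map.
  by rewrite subrr; apply: bnd0.
- exact: (proj2 (proj1 (qisoP _) (kmap_qiso xs q) i) x cx).
- have [y cy xy] := IHf x cx; have [z cz yz] := IHg y cy.
  by exists z => //; exists y.
Qed.

Lemma hrel_lin xs X Y (f : dhom X Y) i a (x x' : kos xs X i) (y y' : kos xs Y i) :
  hrel xs f x y -> hrel xs f x' y' -> hrel xs f (a *: x + x') (a *: y + y').
Proof.
have L (V W : complex R) (g : chain_map V W) (v v' : V i) (w w' : W i) :
    bnd (w - g i v) -> bnd (w' - g i v') -> bnd (a *: w + w' - g i (a *: v + v')).
  move=> wv wv'; rewrite linearP opprD addrACA -scalerBr.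
  by apply: bndD => //; apply: bndZ.
elim: f x x' y y' => {X Y} [X Y f|X Y s q|X Y Z g IHg f IHf] x x' y y' /=.
- exact: L.
- exact: L.
- move=> [z [cz xz zy]] [z' [cz' xz' zy']]; exists (a *: z + z'); split.
  + by apply: cycD => //; apply: cycZ.
  + exact: IHf.
  + exact: IHg.
Qed.

Lemma hrel_bnd xs X Y (f : dhom X Y) i (x : kos xs X i) (y : kos xs Y i) :
  cyc x -> cyc y -> hrel xs f x y -> bnd x -> bnd y.
Proof.
elim: f x y => {X Y} [X Y f|X Y s q|X Y Z g IHg f IHf] x y cx cy /=.
- by move=> xy bx; apply: bnd_congr xy _; apply: bnd_map.
- move=> xy bx; apply: (proj1 (proj1 (qisoP _) (kmap_qiso xs q) i) y cy).
  by apply: bnd_congr bx; apply: bnd_sym.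
- by move=> [z [cz xz zy]] bx; apply: IHg zy _ => //; apply: IHf xz bx.
Qed.

(** Each generator of the congruence holds on homology. The restriction to cycles is forced by the
    identity laws, since the middle element of a composite has to be a cycle. *)
Lemma hrel_deq xs X Y (f g : dhom X Y) : deq f g -> forall i (x : kos xs X i) (y : kos xs Y i),
  cyc x -> cyc y -> (hrel xs f x y <-> hrel xs g x y).
Proof.
have bb (V : complex R) (i : int) (v : V i) : @bnd R V i (v - v) by rewrite subrr; apply: bnd0.
elim=> {X Y f g} [//|X Y f g _ IH|X Y f g h _ IH1 _ IH2|X Y Z g g' f f' _ IHg _ IHf
  |X Y Z T h g f|X Y f|X Y f|X Y f g fg|X Y Z g f|X Y s q|X Y s q] i x y cx cy /=.
- by rewrite IH.
- by rewrite IH1 // IH2.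
- split=> -[z [cz xz zy]]; exists z; split=> //.
  + by rewrite -IHf.
  + by rewrite -IHg.
  + by rewrite IHf.
  + by rewrite IHg.
- split=> [[z [cz [w [cw xw wz]] zy]]|[w [cw xw [z [cz wz zy]]]]].
    by exists w; split=> //; exists z.
  by exists z; split=> //; exists w.
- split=> [[z [cz xz]]|xy].
    by rewrite kmap_id => yz; apply: hrel_congr xz => //; apply: bnd_sym.
  by exists y; split=> //; rewrite kmap_id.
- split=> [[z [cz]]|xy].
    by rewrite kmap_id => xz zy; apply: hrel_congr zy.
  by exists x; split=> //; rewrite kmap_id.
- by rewrite (kmap_ext fg).
- rewrite kmap_comp; split=> [xy|[z [cz xz zy]]].
    by exists (kmap xs f i x); split=> //; apply: cyc_map.
  have := bnd_map (kmap xs g) xz; rewrite raddfB; exact: bnd_trans.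
- have [si _] := proj1 (qisoP _) (kmap_qiso xs q) i.
  rewrite kmap_id; split=> [[z [cz xz zy]]|xy].
    apply: si; first exact: cycB.
    by rewrite raddfB; apply: bnd_trans (bnd_sym zy) _.
  exists (kmap xs s i x); split=> //; first exact: cyc_map.
  by have := bnd_map (kmap xs s) xy; rewrite raddfB; apply: bnd_sym.
- have [_ ss] := proj1 (qisoP _) (kmap_qiso xs q) i.
  rewrite kmap_id; split=> [[z [cz xz zy]]|xy].
    exact: bnd_trans zy (bnd_sym xz).
  have [z cz xz] := ss x cx; exists z; split=> //.
  exact: bnd_trans xy xz.
Qed.

Lemma diso_inj xs X Y (f : dhom X Y) i (x x' : kos xs X i) (y : kos xs Y i) :
  is_diso f -> cyc x -> cyc x' -> cyc y -> hrel xs f x y -> hrel xs f x' y -> bnd (x - x').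
Proof.
move=> [g [gf _]] cx cx' cy xy x'y; have [z cz yz] := hrel_total g cy.
have /(hrel_deq gf cx cz) /= : hrel xs (DComp g f) x z by exists y.
have /(hrel_deq gf cx' cz) /= : hrel xs (DComp g f) x' z by exists y.
by rewrite !kmap_id => zx' zx; apply: bnd_trans (bnd_sym zx) zx'.
Qed.

Lemma diso_surj xs X Y (f : dhom X Y) i (y : kos xs Y i) : is_diso f -> cyc y ->
  exists2 x, cyc x & hrel xs f x y.
Proof.
move=> [g [_ fg]] cy; have [x cx yx] := hrel_total g cy; exists x => //.
have [z cz xz] := hrel_total f cx.
have /(hrel_deq fg cy cz) /= : hrel xs (DComp f g) y z by exists x.
rewrite kmap_id => zy; apply: hrel_congr xz => //.
by rewrite subrr; apply: bnd0.
Qed.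

(** Koszul construction and cone commute; interchanging the two shifts costs the sign on the doubly
    shifted component. *)
Fact swap_linear x X Y (f : chain_map X Y) i : linear (fun p : kos1 x (cone f) i =>
  ((p.1.1, p.2.1), (p.1.2, - p.2.2)) : cone (kmap1 x f) i).
Proof.
move=> a [[b c] [b' c']] [[d e] [d' e']] /=.
by rewrite opprD -scalerN.
Qed.

Lemma transfer_pair X Y (f : chain_map X Y) i j (y : Y i) (z : X (i - 1)) :
  transfer (cone f) i j (y, z) = (transfer Y i j y, transfer X (i - 1) (j - 1) z).
Proof.
have [<-|ij] := eqVneq i j; first by rewrite !transfer_id.
by rewrite !transfer_neq //; apply: contra ij => /eqP/addIr ->.
Qed.

Lemma transfer_kos1 x X i j (y : X i) (z : X (i - 1)) :
  transfer (kos1 x X) i j (y, z) = (transfer X i j y, transfer X (i - 1) (j - 1) z).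
Proof.
have [<-|ij] := eqVneq i j; first by rewrite !transfer_id.
by rewrite !transfer_neq //; apply: contra ij => /eqP/addIr ->.
Qed.

Lemma cone_diffE X Y (f : chain_map X Y) i j (y : Y i) (z : X (i - 1)) :
  diff (cone f) i j (y, z) =
  (diff Y i j y + f j (transfer X (i - 1) j z), - diff X (i - 1) (j - 1) z).
Proof. by rewrite /= /cone_diff /= scaleN1r. Qed.

Fact swap_diff x X Y (f : chain_map X Y) i j (p : kos1 x (cone f) i) :
  mklinear (@swap_linear x X Y f j) (diff (kos1 x (cone f)) i j p) =
  diff (cone (kmap1 x f)) i j (mklinear (@swap_linear x X Y f i) p).
Proof.
case: p => [[y z] [y' z']]; rewrite kos1_diff transfer_pair !cone_diffE.
rewrite /= -[transfer _ _ _ (z, - z')]/(transfer (kos1 x X) (i - 1) j (z, - z')).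
rewrite (@transfer_kos1 x X) /=.
have tN : transfer X (i - 1 - 1) (j - 1) (- z') = - transfer X (i - 1 - 1) (j - 1) z'.
  exact: raddfN.
have dN : diff X (i - 1 - 1) (j - 1 - 1) (- z') = - diff X (i - 1 - 1) (j - 1 - 1) z'.
  exact: raddfN.
congr (_, _); congr (_, _) => /=.
- by rewrite addrAC.
- by rewrite tN opprD; congr (_ + _); apply/esym; apply: raddfN.
- by rewrite tN scalerN opprB; apply: addrC.
- by rewrite dN.
Qed.

Definition swap x X Y (f : chain_map X Y) : chain_map (kos1 x (cone f)) (cone (kmap1 x f)) :=
  ChainMap (@swap_diff x X Y f).

(** A comparison map compatible with the inclusion of [Y] suffices: it carries a vanishing class to
    the cone of [kmap xs f], where a preimage can be read off. *)
Lemma kos_cone xs X Y (f : chain_map X Y) :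
  exists th : chain_map (kos xs (cone f)) (cone (kmap xs f)),
    forall i y, th i (kmap xs (cone_in f) i y) = (y, 0).
Proof.
elim: xs => [|x xs [th thP]]; first by exists (chain_id _).
exists (chain_comp (swap x (kmap xs f)) (kmap1 x th)) => i [y z] /=.
rewrite -[cone_in _]/(cone_in f) !thP /= oppr0.
by [].
Qed.

Lemma kos_cone_exact xs X Y (f : chain_map X Y) i (y : kos xs Y i) : cyc y ->
  bnd (kmap xs (cone_in f) i y) -> exists2 x, cyc x & bnd (y - kmap xs f i x).
Proof.
move=> cy by_; have [th thP] := kos_cone xs f.
have := bnd_map th by_; rewrite thP => /(bndP _ erefl)[[y' x]].
have i1 : i = i + 1 - 1 by rewrite addrK.
rewrite /= /cone_diff /= => -[yE]; rewrite scaleN1r => /eqP; rewrite oppr_eq0 => /eqP xE.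
exists (transfer (kos xs X) (i + 1 - 1) i x).
  by apply/(cycP _ (esym (subrK 1 i))); rewrite diff_transfer.
by rewrite -yE addrK; apply: bnd_diff.
Qed.

(** Koszul homology is exact at the middle term of a cone triangle, and the isomorphism of triangles
    carries this over. *)
Lemma dtriangle_exact xs K Y N : dtriangle K Y N ->
  exists (u : dhom K Y) (v : dhom Y N), forall i (y : kos xs Y i), cyc y ->
    hrel xs v y 0 -> exists2 k, cyc k & hrel xs u k y.
Proof.
move=> [u [v [w [A [B [f [a [b [c [[/= ai bi ci] [/= ab bc _]]]]]]]]]]].
exists u, v => i y cy vy.
have c00 : hrel xs c (0 : kos xs N i) 0.
  have [z cz z0] := hrel_total c (cyc0 (kos xs N) i).
  have bz := hrel_bnd (cyc0 _ _) cz z0 (bnd0 _ _).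
  by apply: hrel_congr z0; rewrite subr0 //; apply: bnd0.
have /(hrel_deq bc cy (cyc0 _ _)) /= : hrel xs (DComp c v) y 0.
  by exists 0; split=> //; apply: cyc0.
move=> [z [cz yz]]; rewrite sub0r => /bndN; rewrite opprK.
move=> /(kos_cone_exact cz)[x cx zx].
have [k ck kx] := diso_surj ai cx.
have /(hrel_deq ab ck cz) /= [y2 [cy2 ky2 y2z]] : hrel xs (DComp (DMap f) a) k z.
  by exists x.
exists k => //; apply: hrel_congr ky2; first by rewrite subrr; apply: bnd0.
exact: diso_inj bi cy2 cy cz y2z yz.
Qed.

Definition kin x xs Y i (y : kos xs Y i) : kos (x :: xs) Y i := (y, 0).

Lemma kin_cyc x xs Y i (y : kos xs Y i) : cyc y -> cyc (kin x y).
Proof.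
move=> cy; apply/kos1_cyc; split; first exact: cyc0.
by rewrite cy scaler0 addr0.
Qed.

Lemma kin_bnd x xs Y i (y : kos xs Y i) : cyc y ->
  bnd (kin x y) <-> exists2 z, cyc z & bnd (y - x *: z).
Proof.
move=> cy; rewrite kos1_bnd; split=> [[a [b [-> /esym/eqP]]]|[z cz /(bndP _ erefl)[a aE]]].
  rewrite oppr_eq0 => /eqP b0; exists b; last by rewrite addrK; apply: bnd_diff.
  by apply/(cycP _ (esym (subrK 1 i))).
by exists a, z; rewrite aE subrK cz oppr0.
Qed.

Lemma kinB x xs Y i (y z : kos xs Y i) : kin x (y - z) = kin x y - kin x z.
Proof. by rewrite /kin; congr (_, _); rewrite /= subrr. Qed.

Lemma hrel_kin x xs X Y (f : dhom X Y) i (a : kos xs X i) (b : kos xs Y i) :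
  cyc a -> cyc b -> hrel xs f a b -> hrel (x :: xs) f (kin x a) (kin x b).
Proof.
have kb V (v : kos xs V i) : bnd v -> bnd (kin x v).
  by move=> /(bndP _ erefl)[w wE]; apply/kos1_bnd; exists w, 0; rewrite wE scaler0 !raddf0 addr0.
have km V W (g : chain_map V W) (v : kos xs V i) :
    kmap (x :: xs) g i (kin x v) = kin x (kmap xs g i v).
  by rewrite /kin /=; congr (_, _); apply: raddf0.
elim: f a b => {X Y} [X Y f|X Y s q|X Y Z g IHg f IHf] a b ca cb.
- by move=> /kb; rewrite kinB /hrel km.
- by move=> /kb; rewrite kinB /hrel km.
- move=> [z [cz az zb]]; exists (kin x z); split; first exact: kin_cyc.
    exact: IHf.
  exact: IHg.
Qed.

End Koszul.
Arguments hrel {R} xs {X Y} f {i} _ _.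

(** * Divisibility in homology and maps that vanish on homology *)

Section KoszulGhost.
Variable R : comNzRingType.
Implicit Types (X Y Z K N M L : complex R).

(** The division is done in an injective cover: lift [v] to an element killed by [xs], divide by [x]
    there, and map back. *)
Lemma GI_kdiv x xs (V : lmodType R) (v : V) : areg 1 (x :: xs : seq R^o) ->
  gorenstein_injective V -> kill xs v -> exists2 w, kill xs w & v = x *: w.
Proof.
move=> [xsr xr] GV kv; have [_ [K [E [f [g [Ei GK s]]]]] _] := GI_gclass GV.
have [k [e [ke]]] := almost_surj xsr Ei s (GI_dcov _ GK) kv.
rewrite expr1n scale1r => eE.
have [|e' [ke' e'E]] := @inj_div R E (lspan xs) x e Ei (lspan_lsub xs).
  by move=> r; rewrite mulrC => /xr; rewrite mul1r; apply: kill_lspan.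
exists (g e'); last by rewrite -linearZ /= e'E.
by move=> y yxs; rewrite -linearZ /= ke' ?raddf0 //; apply: lspan_mem.
Qed.

Definition hkill X i (xs : seq R) (v : X i) : Prop := forall y, y \in xs -> bnd (y *: v).

(** The property of [GI_kdiv] for [H(X)]. In this form it is inherited by isomorphic objects,
    shifts, sums and summands, hence by all of [thick1]. *)
Definition hdiv x xs X : Prop := forall i (v : X i), cyc v -> hkill xs v ->
  exists w, [/\ cyc w, hkill xs w & bnd (v - x *: w)].

Lemma hdiv_stalk x (xs : seq R) V : areg 1 (x :: xs : seq R^o) -> gorenstein_injective V ->
  hdiv x xs (stalk V).
Proof.
move=> xr GV i v cv kv; have [i0|i0] := eqVneq i 0; last first.
  exists 0; split; first exact: cyc0.
    by move=> y _; rewrite scaler0; apply: bnd0.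
  by rewrite (stalk_trivial i0 (v - _)); apply: bnd0.
have b0 (w : stalk V i) : bnd w -> w = 0 by move=> [j [y <-]].
subst i; have [|w kw vw] := @GI_kdiv x xs V v xr GV.
  by move=> y /kv /b0.
exists w; split=> [j //|y yxs|]; first by have -> := kw y yxs; apply: bnd0.
by rewrite vw subrr; apply: bnd0.
Qed.

Lemma diso_bnd X Y (f : dhom X Y) i (x : X i) (y : Y i) :
  is_diso f -> cyc x -> cyc y -> hrel [::] f x y -> bnd y -> bnd x.
Proof.
move=> fi cx cy xy bY; have x0 : hrel [::] f x 0.
  by apply: hrel_congr xy; rewrite ?subrr ?subr0 //; apply: bnd0.
have := hrel_lin (-1) x0 x0; rewrite !scaleN1r !addNr => z0.
by have := diso_inj (xs := [::]) fi cx (cyc0 X i) (cyc0 Y i) x0 z0; rewrite subr0.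
Qed.

Lemma hrelZ X Y (f : dhom X Y) i a (x : X i) (y : Y i) :
  hrel [::] f x y -> hrel [::] f (a *: x) (a *: y).
Proof.
move=> xy; have := hrel_lin (-1) xy xy; rewrite !scaleN1r !addNr => z0.
by have := hrel_lin a xy z0; rewrite !addr0.
Qed.

Lemma hdiv_iso x xs X Y : disomorphic X Y -> hdiv x xs X -> hdiv x xs Y.
Proof.
move=> /disom_sym[g gi] Xd i v cv kv.
have [u cu vu] := hrel_total (xs := [::]) g cv.
have [|w [cw kw uw]] := Xd i u cu.
  by move=> y /kv; apply: hrel_bnd (hrelZ y vu); apply: cycZ.
have [w' cw' ww'] := diso_surj (xs := [::]) gi cw.
exists w'; split=> // [y yxs|].
  by apply: diso_bnd gi _ _ (hrelZ y ww') (kw y yxs); apply: cycZ.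
have E : hrel [::] g (v - x *: w') (u - x *: w).
  by rewrite ![_ - _]addrC -!scaleNr; apply: hrel_lin.
by apply: diso_bnd gi _ _ E uw; apply: cycB => //; apply: cycZ.
Qed.

Lemma shift_cyc n X i (v : shift n X i) : cyc v <-> @cyc R X (i - n) v.
Proof.
split=> cv; last by move=> j /=; rewrite cv scaler0.
move=> j; have := cv (j + n); rewrite /= addrK => /(congr1 (fun w => (-1) ^+ `|n|%N *: w)).
by rewrite scalerA -expr2 sqrr_sign scale1r scaler0.
Qed.

Lemma shift_bnd n X i (v : shift n X i) : bnd v <-> @bnd R X (i - n) v.
Proof.
split=> [[j [y <-]]|[j [y <-]]]; first by apply: bndZ; exists (j - n), y.
exists (j + n), ((-1) ^+ `|n|%N *: transfer X j (j + n - n) y) => /=.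
rewrite [diff _ _ _ _]linearZ /= scalerA -expr2 sqrr_sign scale1r.
by rewrite diff_transfer // addrK.
Qed.

Lemma hdiv_shift n x xs X : hdiv x xs X -> hdiv x xs (shift n X).
Proof.
move=> Xd i v /shift_cyc cv kv; have [|w [cw kw vw]] := Xd _ v cv.
  by move=> y /kv /shift_bnd.
by exists w; split; [apply/shift_cyc|move=> y /kw yw; apply/shift_bnd|apply/shift_bnd].
Qed.

Lemma sum_cyc X Y i (v : X i) (w : Y i) :
  cyc ((v, w) : complex_sum X Y i) <-> cyc v /\ cyc w.
Proof.
split=> [c|[cv cw] j]; last by rewrite /= cv cw.
by split=> j; [apply: (congr1 fst (c j))|apply: (congr1 snd (c j))].
Qed.

Lemma sum_bnd X Y i (v : X i) (w : Y i) :
  bnd ((v, w) : complex_sum X Y i) <-> bnd v /\ bnd w.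
Proof.
split=> [[j [[a b] [<- <-]]]|]; first by split; exists j; [exists a|exists b].
by move=> [/(bndP _ erefl)[a <-] /(bndP _ erefl)[b <-]]; exists (i + 1), (a, b).
Qed.

Lemma hdiv_sum x xs X Y : hdiv x xs (complex_sum X Y) <-> hdiv x xs X /\ hdiv x xs Y.
Proof.
split=> [XYd|[Xd Yd] i [v1 v2] /sum_cyc[c1 c2] kv].
  split=> i v cv kv.
    have [|y yxs|[w1 w2] [/sum_cyc[c1 c2] kw /sum_bnd[b1 _]]] := XYd i (v, 0).
    - by apply/sum_cyc; split=> //; apply: cyc0.
    - by apply/sum_bnd; split; rewrite /= ?scaler0; [apply: kv|apply: bnd0].
    by exists w1; split=> // y /kw /sum_bnd[].
  have [|y yxs|[w1 w2] [/sum_cyc[c1 c2] kw /sum_bnd[_ b2]]] := XYd i (0, v).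
  - by apply/sum_cyc; split=> //; apply: cyc0.
  - by apply/sum_bnd; split; rewrite /= ?scaler0; [apply: bnd0|apply: kv].
  by exists w2; split=> // y /kw /sum_bnd[].
have [y /kv /sum_bnd[]//|w1 [d1 k1 b1]] := Xd i v1 c1.
have [y /kv /sum_bnd[]//|w2 [d2 k2 b2]] := Yd i v2 c2.
exists (w1, w2); split=> [|y yxs|]; first exact/sum_cyc.
  by apply/sum_bnd; split; [apply: k1|apply: k2].
exact/sum_bnd.
Qed.

Lemma hdiv_thick1 x (xs : seq R) X : areg 1 (x :: xs : seq R^o) -> thick1 (@GI R) X -> hdiv x xs X.
Proof.
move=> xr; elim=> {X} [_ [V GV ->]|X Y XY _|n X _|i v _ _|X Y _ Xd _ Yd|X Y _].
- exact: hdiv_stalk.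
- exact: hdiv_iso.
- exact: hdiv_shift.
- exists 0; split; first exact: cyc0.
    by move=> y _; rewrite scaler0; apply: bnd0.
  by exists i, 0; apply: etrans (@module0_eq R _) (esym (@module0_eq R _)).
- exact/hdiv_sum.
- by move=> /hdiv_sum[].
Qed.

(** [i - size xs] as an iterated subtraction, so that the projection [kpr] to the component of
    highest Koszul degree needs no cast. *)
Fixpoint kdeg (xs : seq R) (i : int) : int := if xs is _ :: xs' then kdeg xs' (i - 1) else i.

Fixpoint kpr xs X i : kos xs X i -> X (kdeg xs i) :=
  if xs is x :: xs' return kos xs X i -> X (kdeg xs i) then
    fun p => kpr (xs := xs') (p.2 : kos xs' X (i - 1))
  else id.

Lemma kpr_linear xs X i : linear (@kpr xs X i).
Proof. by elim: xs i => [//|x xs IHxs] i a [y z] [y' z'] /=; rewrite -IHxs. Qed.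

Lemma kprB xs X i (p q : kos xs X i) a : kpr (p - a *: q) = kpr p - a *: kpr q.
Proof. by rewrite [p - _]addrC -scaleNr kpr_linear scaleNr addrC. Qed.

Lemma kpr0 xs X i : kpr (0 : kos xs X i) = 0.
Proof. by have := kprB (0 : kos xs X i) 0 1; rewrite !scale1r !subrr. Qed.

Lemma kprZ xs X i (p : kos xs X i) a : kpr (a *: p) = a *: kpr p.
Proof. by rewrite -[a *: p]addr0 kpr_linear kpr0 addr0. Qed.

(* The homology of the Koszul complex is the part of [H(X)] killed by [xs]. *)
Definition khom xs X : Prop := forall i,
  [/\ forall p : kos xs X i, cyc p -> cyc (kpr p) /\ hkill xs (kpr p),
      forall p : kos xs X i, cyc p -> (bnd p <-> bnd (kpr p))
    & forall v : X (kdeg xs i), cyc v -> hkill xs v ->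
        exists2 p : kos xs X i, cyc p & bnd (v - kpr p)].

Lemma khom_surj x xs X : khom xs X -> hdiv x xs X ->
  forall i (p : kos xs X i), cyc p -> exists2 q, cyc q & bnd (p - x *: q).
Proof.
move=> kX Xd i p cp; have [k1 k2 k3] := kX i; have [cv kv] := k1 p cp.
have [w [cw kw vw]] := Xd _ _ cv kv; have [q cq wq] := k3 w cw kw.
exists q => //; apply/k2; first by apply: cycB => //; apply: cycZ.
by rewrite kprB; apply: bnd_trans vw _; rewrite -scalerBr; apply: bndZ.
Qed.

Fixpoint hdivs xs X : Prop := if xs is x :: xs' then hdivs xs' X /\ hdiv x xs' X else True.

(** If [x] acts surjectively on the homology of [kos xs' X], the long exact sequence of the cone
    leaves only the kernel of [x], shifted by one. *)
Lemma hdivs_khom xs X : hdivs xs X -> khom xs X.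
Proof.
elim: xs => [_ i|x xs IHxs [Xds Xd]].
  by split=> // v cv _; exists v; rewrite // subrr; apply: bnd0.
have kX := IHxs Xds; have sX := khom_surj kX Xd; move=> i; have [k1 k2 k3] := kX (i - 1).
have i1 : i = i - 1 + 1 by rewrite subrK.
split=> [[y z] /kos1_cyc[cz yz]|[y z] /kos1_cyc[cz yz]|v cv kv] /=.
- have [cv kv] := k1 z cz; split=> // a; rewrite inE => /orP[/eqP ->|/kv //].
  rewrite -kprZ; apply/k2; first exact: cycZ.
  exists i, (- y); rewrite raddfN; apply/eqP; rewrite eq_sym -subr_eq0 opprK.
  by apply/eqP; apply: etrans yz; apply: addrC.
- rewrite -(k2 z cz); split=> [/kos1_bnd[a [b [_ ->]]]|/(bndP _ i1)[b bE]].
    exact/bndN/bnd_diff.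
  have [|c cc /(bndP _ erefl)[e eE]] := sX i (y + x *: b).
    by apply/(cycP _ i1); rewrite raddfD /= linearZ /= bE.
  apply/kos1_bnd; exists e, (c - b); split; first by rewrite eE scalerBr addrA subrK addrK.
  by rewrite [diff _ _ _ (c - b)]raddfB /= cc sub0r opprK.
- have [|z cz vz] := k3 v cv; first by move=> a axs; apply: kv; rewrite inE axs orbT.
  have /(bndP _ i1)[w wE] : bnd (x *: z).
    apply/k2; first exact: cycZ.
    rewrite kprZ; apply: bnd_congr (kv x _); last exact: mem_head.
    by rewrite -scalerBr; apply/bndZ/bnd_sym.
  exists (- w, z) => //; apply/kos1_cyc; split=> //.
  by rewrite raddfN /= wE addNr.
Qed.

Lemma areg_hdivs (xs : seq R) X : areg 1 (xs : seq R^o) -> thick1 (@GI R) X -> hdivs xs X.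
Proof.
move=> + GX; elim: xs => //= x xs IHxs xr; split; first by apply: IHxs; case: xr.
exact: hdiv_thick1.
Qed.

Lemma kin_ghost x (xs : seq R) K i (k : kos xs K i) : areg 1 (x :: xs : seq R^o) ->
  thick1 (@GI R) K -> cyc k -> bnd (kin x k).
Proof.
move=> xr /(areg_hdivs xr)[Kds Kd] ck; apply/kin_bnd => //.
exact: khom_surj (hdivs_khom Kds) Kd _ _ ck.
Qed.

Fixpoint cin xs X i : X i -> kos xs X i :=
  if xs is x :: xs' return X i -> kos xs X i then fun v => kin x (cin xs' v) else id.

Lemma cin_cyc xs X i (v : X i) : cyc v -> cyc (cin xs v).
Proof. by move=> cv; elim: xs => //= x xs; apply: kin_cyc. Qed.

Lemma cin_hrel xs X Y (f : dhom X Y) i (x : X i) (y : Y i) : cyc x -> cyc y ->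
  hrel [::] f x y -> hrel xs f (cin xs x) (cin xs y).
Proof.
by move=> cx cy xy; elim: xs => //= a xs IHxs; apply: hrel_kin => //; apply: cin_cyc.
Qed.

Lemma cin_map xs X Y (f : chain_map X Y) i (x : X i) : kmap xs f i (cin xs x) = cin xs (f i x).
Proof. by elim: xs => //= x' xs ->; rewrite /kin; congr (_, _); apply: raddf0. Qed.

Lemma cin_linear xs X i : linear (@cin xs X i).
Proof.
elim: xs => // x xs IHxs a u v /=; rewrite IHxs /kin; congr (_, _).
by rewrite /= scaler0 addr0.
Qed.

Program Definition sum_out X Y : chain_map (complex_sum X Y) Y :=
  @ChainMap _ _ _ (fun i => lsnd (X i) (Y i)) _.
Next Obligation. by []. Qed.

(** The image of [y] in [N] dies in the Koszul complex of the first [n] elements, by induction.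
    There [y] comes from the homology of [K], which the last element kills. *)
Lemma ghost n (xs : seq R) Y i (y : Y i) : size xs = n.+1 -> areg 1 (xs : seq R^o) ->
  thick (@GI R) n.+1 Y -> cyc y -> bnd (cin xs y).
Proof.
elim: n xs Y i y => [|n IHn] [|x xs] // Y i y [sxs] xr.
  case: xs sxs xr => // _ xr GY cy.
  exact: (@kin_ghost x [::]).
move=> [K [L [N [T GK NT]]]] cy; have [u [v uv]] := dtriangle_exact xs T.
have cy' : cyc ((0, y) : complex_sum L Y i) by apply/sum_cyc; split=> //; apply: cyc0.
have [z cz yz] := hrel_total (xs := [::]) v cy'.
have z0 : bnd (cin xs z) by apply: IHn NT cz => //; case: xr.
have [|k ck ky] := uv i (cin xs ((0, y) : complex_sum L Y i)) (cin_cyc xs cy').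
  apply: hrel_congr (cin_hrel xs cy' cz yz); rewrite ?subrr ?subr0 //; exact: bnd0.
have := hrel_kin x ck (cin_cyc xs cy') ky.
move=> /hrel_bnd H; have {}H := H (kin_cyc x ck) (kin_cyc x (cin_cyc xs cy')) (kin_ghost xr GK ck).
by have := bnd_map (kmap (x :: xs) (sum_out L Y)) H; rewrite (cin_map (x :: xs)).
Qed.

(** * The lowest degree of the homology *)

Section LowestDegree.
Variables (M : complex R) (t : int).
Hypothesis Mt : forall i, i < t -> forall x : M i, cyc x -> bnd x.

(** The components of positive Koszul degree involve homology of [M] below [t], which vanishes; in
    degree [t] only classes from [M] remain. *)
Lemma kos_low xs : (forall i, i < t -> forall x : kos xs M i, cyc x -> bnd x) /\
  forall z : kos xs M t, cyc z -> exists2 v, cyc v & bnd (z - cin xs v).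
Proof.
elim: xs => [|x xs [low top]].
  by split=> // z cz; exists z => //; rewrite subrr; apply: bnd0.
have red i (p : kos (x :: xs) M i) : i <= t -> cyc p -> exists2 y, cyc y & bnd (p - kin x y).
  case: p => y z it /kos1_cyc[cz yz]; have i1 : i = i - 1 + 1 by rewrite subrK.
  have /(bndP _ i1)[b bE] : @bnd R (kos xs M) (i - 1) z by apply: low cz; lia.
  exists (y + x *: b).
    by apply/(cycP _ i1); rewrite raddfD /= linearZ /= bE.
  apply/kos1_bnd; exists 0, (- b); split.
    by rewrite raddf0 add0r scalerN /= opprD addrA subrr sub0r.
  by rewrite [diff _ _ _ (- b)]raddfN /= opprK bE; apply: subr0.
split=> [i it p cp|p cp].
  have [|y cy py] := red i p _ cp; first by lia.
  apply: bnd_congr py _; have /(bndP _ erefl)[a <-] := low i it y cy.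
  by apply/kos1_bnd; exists a, 0; rewrite scaler0 !raddf0 addr0.
have [|y cy py] := red t p _ cp; first by lia.
have [v cv yv] := top y cy; exists v => //; apply: bnd_trans py _ => /=.
rewrite -kinB; move: yv => /(bndP _ erefl)[a <-].
by apply/kos1_bnd; exists a, 0; rewrite scaler0 !raddf0 addr0.
Qed.

(** Membership in [Y + x_1 Z + ... + x_n Z], where [Z] is the module of cycles of degree [t]. *)
Fixpoint xsZ (xs : seq R) (Y : M t -> Prop) (v : M t) : Prop :=
  if xs is x :: xs' then exists2 w, cyc w & xsZ xs' Y (v - x *: w) else Y v.

Lemma xsZ_lsub xs (Y : M t -> Prop) : lsub Y -> lsub (xsZ xs Y).
Proof.
move=> YS; elim: xs => //= x xs IHxs; split=> [|a u v [u' cu uE] [v' cv vE]].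
  by exists 0; [apply: cyc0|rewrite scaler0 subr0; case: IHxs].
exists (a *: u' + v'); first by apply: (proj2 (cyc_lsub M t)).
have -> : a *: u + v - x *: (a *: u' + v') = a *: (u - x *: u') + (v - x *: v').
  by rewrite scalerDr scalerBr opprD addrACA !scalerA [x * a]mulrC.
exact: (proj2 IHxs).
Qed.

Lemma xsZ_sub xs (Y : M t -> Prop) v : Y v -> xsZ xs Y v.
Proof.
move=> Yv; elim: xs => //= x xs IHxs; exists 0; first exact: cyc0.
by rewrite scaler0 subr0.
Qed.

Lemma cin_xsZ xs (v : M t) : cyc v -> bnd (cin xs v) -> xsZ xs (@bnd R M t) v.
Proof.
elim: xs v => //= x xs IHxs v cv /kin_bnd[|z cz vz]; first exact: cin_cyc.
have [_ top] := kos_low xs; have [w cw zw] := top z cz; exists w => //.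
apply: IHxs; first by apply: cycB => //; apply: cycZ.
have -> : cin xs (v - x *: w) = cin xs v - x *: cin xs w.
  by rewrite [v - _]addrC -scaleNr cin_linear scaleNr addrC.
by apply: bnd_trans vz _; rewrite -scalerBr; apply: bndZ.
Qed.

(** The elements are removed one at a time: Nakayama's lemma for [x] is applied modulo [Y] enlarged
    by the multiples of the remaining elements. *)
Lemma nakayama_cyc (m : {pred R}) (vs : seq (M t)) xs (Y : M t -> Prop) :
  noetherian R -> local_ring m -> {subset xs <= m} -> lsub Y ->
  (forall z : M t, cyc z -> exists2 w, lspan vs w & Y (z - w)) ->
  (forall z : M t, cyc z -> xsZ xs Y z) -> forall z : M t, cyc z -> Y z.
Proof.
move=> noeth loc + YS fgZ; elim: xs => //= x xs IHxs xm zP; apply: IHxs.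
  by move=> y yxs; apply: xm; rewrite inE yxs orbT.
apply: (@nakayama R noeth (M t) (xsZ xs Y) (@cyc R M t) vs x).
- exact: xsZ_lsub.
- exact: cyc_lsub.
- by move=> a; apply: (local_unit_sub noeth loc); apply: xm; apply: mem_head.
- by move=> z /fgZ[w vw Yw]; exists w => //; apply: xsZ_sub.
- exact: zP.
Qed.

End LowestDegree.

End KoszulGhost.

(** * The level *)

Section Level.
Variable R : comNzRingType.
Implicit Types (M : complex R).

Definition exact M : Prop := forall i (x : M i), cyc x -> bnd x.

Lemma exact_disom0 M : exact M -> disomorphic M (complex0 R).
Proof.
move=> Me; apply: disom_sym.
have z0 i j x : (\0 : {linear complex0 R j -> M j}) (diff (complex0 R) i j x) =
    diff M i j ((\0 : {linear complex0 R i -> M i}) x).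
  by rewrite /= raddf0.
apply: (@qiso_disom _ _ _ (@ChainMap R (complex0 R) M (fun i => \0) z0)).
apply/qisoP => i; split=> [x _ _|y cy].
  by exists i, 0; apply: etrans (@module0_eq R _) (esym (@module0_eq R _)).
exists 0; first exact: cyc0.
by rewrite /= subr0; apply: Me.
Qed.

Lemma exact_homology M i : (forall h : homology M i, h = 0) ->
  forall x : M i, cyc x -> bnd x.
Proof.
move=> M0 x; have [_ cP _ bP] := isH_homology M i.
by move=> /cP[h xh]; apply/(bP _ _ xh); apply: M0.
Qed.

Lemma finitely_generated_fgm (V : lmodType R) : finitely_generated V -> fgm V.
Proof.
move=> [n [g gP]]; exists (codom g) => v; have [c ->] := gP v.
apply: (@lsub_sum R V (lspan (codom g))) => [|i]; first exact: lspan_lsub.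
apply: (lsubZ _ (lspan_lsub _)).
by apply: lspan_mem; apply: codom_f.
Qed.

Lemma homology_gen M i : fgm (homology M i) ->
  exists vs : seq (M i), forall z, cyc z -> exists2 w, lspan vs w & bnd (z - w).
Proof.
move=> [s sP]; have [rL cP vP bP] := isH_homology M i.
set rho := (fun x (h : homology M i) => _) in rL cP vP bP.
have [rep repP] := choice vP; exists (map rep s) => z /cP[h zh].
suff [w ws wh] : exists2 w, lspan (map rep s) w & rho w h.
  exists w => //; have wz : rho (z - w) 0.
    have := proj2 rL (-1) _ _ _ _ wh zh; rewrite !scaleN1r addNr.
    by rewrite [- w + z]addrC.
  exact/(bP _ _ wz).
apply: (lspan_min (S := fun h => exists2 w, lspan (map rep s) w & rho w h)) (sP h).
  split=> [|a u v [u' su ru] [v' sv rv]].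
    by exists 0; [case: (lspan_lsub (map rep s))|case: rL].
  exists (a *: u' + v'); first exact: (proj2 (lspan_lsub _)).
  exact: (proj2 rL).
by move=> v vs; exists (rep v); rewrite ?repP //; apply/lspan_mem/map_f.
Qed.

(** Induction on the degree, starting below the bounded homology: once all lower degrees are exact,
    [t] is the lowest degree that may carry homology, and Nakayama's lemma clears it. *)
Lemma level_lower (m : {pred R}) M n (xs : seq R) : noetherian R -> local_ring m ->
  in_Dbf M -> size xs = n.+1 -> {subset xs <= m} -> areg 1 (xs : seq R^o) ->
  thick (@GI R) n.+1 M -> exact M.
Proof.
move=> noeth loc [[b Mb] Mfg] sxs xm xr Mn.
have step t : (forall i, i < t -> forall x : M i, cyc x -> bnd x) ->
    forall x : M t, cyc x -> bnd x.
  move=> Mt; have [vs vsP] := homology_gen (finitely_generated_fgm (Mfg t)).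
  apply: (nakayama_cyc noeth loc xm (bnd_lsub M t) vsP) => z cz.
  by apply: cin_xsZ => //; apply: ghost sxs xr Mn cz.
have low (k : nat) : forall i, i < - b%:Z + k%:Z -> forall x : M i, cyc x -> bnd x.
  elim: k => [|k IHk] i ik; first by apply/exact_homology/Mb; lia.
  have [ik'|ik'] := boolP (i < - b%:Z + k%:Z); first exact: IHk.
  have -> : i = - b%:Z + k%:Z by lia.
  exact: step.
by move=> i; apply: (low (`|i| + b + 1)%N); lia.
Qed.

Definition dsum_in_fun (V : int -> lmodType R) (i : int) (x : V i) : dprod V :=
  fun j => transfer V i j x.

Fact dsum_in_finsupp (V : int -> lmodType R) i (x : V i) : dsum_in_fun x \in @finsupp R int V.
Proof.
rewrite inE; apply/asboolP; exists [:: i] => j; rewrite inE => ji.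
by rewrite /dsum_in_fun transfer_neq // eq_sym.
Qed.

Fact dsum_in_linear (V : int -> lmodType R) i :
  linear (fun x : V i => DSum (dsum_in_finsupp x) : dsum V).
Proof.
move=> a x y; apply: val_inj; apply: functional_extensionality_dep => j.
exact: linearP.
Qed.

Fact dsum_out_linear (V : int -> lmodType R) i :
  linear (fun x : dsum V => dsum_val x i : V i).
Proof. by []. Qed.

Lemma idg_dsum n (V : int -> lmodType R) i : idg n (dsum V) -> idg n (V i).
Proof.
apply: (idg_retract (i := mklinear (@dsum_in_linear V i)) (r := mklinear (@dsum_out_linear V i))).
by move=> x /=; apply: transfer_id.
Qed.

Lemma enat_infP (P : nat -> Prop) n : enat_inf P = Some n <->
  P n /\ forall k, P k -> (n <= k)%N.
Proof.
rewrite /enat_inf; case: pselect => [exP|exP]; last first.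
  by split=> // -[Pn _]; case: exP; exists n; apply/asboolP.
case: ex_minnP => k /asboolP Pk kmin; split=> [[<-]|[Pn nmin]].
  by split=> // l Pl; apply: kmin; apply/asboolP.
congr Some; apply/eqP; rewrite eqn_leq nmin // andbT.
by apply: kmin; apply/asboolP.
Qed.

Lemma enat_inf_None (P : nat -> Prop) : enat_inf P = None <-> forall k, ~ P k.
Proof.
rewrite /enat_inf; case: pselect => [exP|exP]; split=> //.
  by have [k /asboolP Pk] := exP => /(_ k).
by move=> _ k Pk; case: exP; exists k; apply/asboolP.
Qed.

Lemma areg_drop k (xs : seq R) : areg 1 (xs : seq R^o) -> areg 1 (drop k xs : seq R^o).
Proof. by elim: xs k => [|x xs IHxs] [|k] //= [/(IHxs k)]. Qed.

Lemma level_gt (m : {pred R}) M (s : seq R) : noetherian R -> local_ring m ->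
  in_Dbf M -> ~ disomorphic M (complex0 R) -> {subset s <= m} -> regular_sequence s ->
  forall n, thick (@GI R) n M -> (size s < n)%N.
Proof.
move=> noeth loc Mb M0 sm [sr _] [|n] Mn; first by [].
rewrite ltnNge; apply/negP => ns.
(* [areg] reads sequences from the end, so this keeps the first [n + 1] elements of [s]. *)
pose xs := drop (size s - n.+1) (rev s).
have sxs : size xs = n.+1 by rewrite size_drop size_rev subKn.
apply: M0; apply: exact_disom0.
apply: (level_lower noeth loc Mb sxs _ _ Mn).
  by move=> x /mem_drop; rewrite mem_rev => /sm.
exact/areg_drop/regular_areg.
Qed.

(** Each [H_i(M)] is a retract of the total homology, so Bass' formula bounds its dimension by
    [d + 1]. Here [d + 1] bounds the depth, and dimension [d + 1] gives [d + 2] layers. *)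
Lemma level_le (m : {pred R}) M d : noetherian R -> local_ring m ->
  (forall s : seq R, {subset s <= m} -> regular_sequence s -> (size s <= d.+1)%N) ->
  in_Dbf M -> Gid (total_homology M) <> None -> thick (@GI R) d.+2 M.
Proof.
move=> noeth loc sd [[b Mb] Mfg] Mid; apply: thick_upper.
  by exists b => i bi; apply: exact_homology; apply: Mb.
move=> i; have [n Mn] : exists n, GI_coresolution (total_homology M) n.
  by apply: contrapT => H; apply: Mid; apply/enat_inf_None => n Mn; apply: H; exists n.
apply: (@bass R m _ noeth loc sd n); first exact/finitely_generated_fgm/Mfg.
exact/idg_dsum/gid_le_idg/coresolution_gid_le.
Qed.

End Level.

(** Infinite depth corresponds to infinite level. The zero object, whose level is 0, is set
    apart. *)
Theorem theoremD (R : comNzRingType) (m : {pred R})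
  (R_noetherian : noetherian R)
  (R_local : local_ring m)
  (depth_gt0 : depth m <> Some 0%N)
  (M : complex R)
  (M_Dbf : in_Dbf M)
  (M_neq0 : ~ disomorphic M (complex0 R))
  (Gid_fin : Gid (total_homology M) <> None) :
  level (@GI R) M = omap succn (depth m).
Proof.
have gt := level_gt R_noetherian R_local M_Dbf M_neq0.
(* With no finite depth the lengths of regular sequences are unbounded, while any [n] with [M] in
   [thick n] would bound them. *)
case dE : (depth m) depth_gt0 => [[|d]|] //= _; last first.
  apply/enat_inf_None => n Mn; move: dE => /enat_inf_None/(_ n); apply=> k [s [<- sm sr]].
  exact: ltnW (gt s sm sr n Mn).
move: dE => /enat_infP[sd dmin]; apply/enat_infP; split.
  apply: (level_le R_noetherian R_local) M_Dbf Gid_fin => s sm sr.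
  by apply: sd; exists s.
move=> n Mn; rewrite ltnNge; apply/negP => nd.
(* Membership in [thick n] makes every regular sequence shorter than [n], so the depth is at most
   [n - 1]. *)
have /dmin : forall k, (exists s : seq R, [/\ size s = k, {subset s <= m} &
    regular_sequence s]) -> (k <= n.-1)%N.
  by move=> k [s [<- sm sr]]; have := gt s sm sr n Mn; case: (n).
by case: n nd {Mn} => // n nd; rewrite leqNgt nd.
Qed.
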